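(* Let $g$ belong to the range of the operator $T\colon L^\infty\to L_{\mathrm{exp}}$. The unique solution $f\in L^\infty$ of the airfoil equation $$\frac1\pi\,\mathrm{p.v.}\int_{-1}^1\frac{f(x)}{x-t}\,dx=g(t),\quad \text{a.e. } t\in(-1,1),$$ (that is, of $T(f)=g$) is $$f=\check T(g)=-w\,T\Big(\frac gw\Big).$$
   Context: All function spaces are over the interval $(-1,1)$ with Lebesgue measure $\mu$, functions are complex-valued and identified when equal a.e.; $L^0$ is the space of all measurable functions, $L^p=L^p(-1,1)$. Finite Hilbert transform: for $f\in L^1$, $T(f)(t):=\lim_{\varepsilon\to0^+}\frac1\pi\left(\int_{-1}^{t-\varepsilon}+\int_{t+\varepsilon}^1\right)\frac{f(x)}{x-t}\,dx$, which exists for a.e. $t\in(-1,1)$ and is measurable. $w(x):=\sqrt{1-x^2}$ for $x\in(-1,1)$. For $f\in L^1$ with $f/w\in L^1$, $\check T(f):=-w\,T(f/w)\in L^0$. (Here $\check T$ denotes ''T check''.) $f^*\colon[0,2]\to[0,\infty]$ is the decreasing rearrangement of $f\in L^0$. The Zygmund space $L_{\mathrm{exp}}$ consists of all $f\in L^0$ with $\|f\|_{L_{\mathrm{exp}}}:=\sup_{0<t<2}\frac{\int_0^t f^*(s)\,ds}{t\log(2e/t)}<\infty$ (equivalently, $\int_{-1}^1 e^{\lambda|f|}\,d\mu<\infty$ for some $\lambda>0$). One has $L_{\mathrm{exp}}\subseteq L^p$ for all $1\le p<\infty$, and hence $g/w\in L^1$ for every $g\in L_{\mathrm{exp}}$.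 The operator $T$ maps $L^\infty$ boundedly into $L_{\mathrm{exp}}$. *)

(* Defs.v *)
From HB Require Import structures.
From mathcomp Require Import all_boot all_order all_algebra.
From mathcomp Require Import all_classical all_reals all_analysis.
From mathcomp Require Import complex.

Set Implicit Arguments.
Unset Strict Implicit.
Unset Printing Implicit Defensive.

Import Order.TTheory GRing.Theory Num.Theory.
Import ComplexField.Normc.
Import numFieldNormedType.Exports.

Local Open Scope classical_set_scope.
Local Open Scope complex_scope.
Local Open Scope ring_scope.

Section FiniteHilbertTransform.
Context {R : realType}.
Local Notation mu := (@lebesgue_measure R).
Implicit Types f g : R -> R[i].

Definition I11 : set R := `]-1, 1[.

(* A function on (-1, 1) is represented by a function on R whose values outside
   I11 are irrelevant.  A class of Lebesgue-measurable functions modulo a.e.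
   equality on (-1, 1) is represented by its Borel-measurable members; such a
   member always exists. *)
Definition ae_eq11 f g : Prop := ae_eq mu I11 f g.

Definition L0 : set (R -> R[i]) :=
  [set f | measurable_fun I11 (fun x => complex.Re (f x)) /\
           measurable_fun I11 (fun x => complex.Im (f x))].

Definition Linfty : set (R -> R[i]) :=
  [set f | L0 f /\
    ('N[mu]_+oo[(fun x => (normc (f x))%:E) \_ I11] < +oo)%E].

(* The distribution function l |-> mu {x in (-1, 1) : |f x| > l}. *)
Definition distribution_function f (l : R) : \bar R :=
  mu (I11 `&` [set x | l < normc (f x)]).

(* f^*(s), with inf of the empty set equal to +oo. *)
Definition rearrangement f (s : R) : \bar R :=
  ereal_inf
    [set l%:E | l in [set l : R | 0 <= l /\
                                  (distribution_function f l <= s%:E)%E]].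

Definition Lexp_norm f : \bar R :=
  ereal_sup
    [set ((\int[mu]_(s in `]0%R, t[) rearrangement f s) *
          ((t * ln (2 * expR 1 / t))^-1)%R%:E)%E
    | t in [set t : R | 0 < t < 2]].

Definition Lexp : set (R -> R[i]) := [set f | L0 f /\ (Lexp_norm f < +oo)%E].

Definition Cintegral (D : set R) f : R[i] :=
  Rintegral mu D (fun x => complex.Re (f x)) +i*
  Rintegral mu D (fun x => complex.Im (f x)).

(* The type R[i]^o is R[i] with its norm topology. *)
Definition truncated_hilbert f (t eps : R) : R[i]^o :=
  (pi^-1)%:C *
    (Cintegral `]-1, t - eps[ (fun x => f x / (x - t)%:C) +
     Cintegral `]t + eps, 1[ (fun x => f x / (x - t)%:C)).

(* The limit exists for a.e. t in (-1, 1) when f is integrable on (-1, 1);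
   where it does not exist, lim returns an unspecified value. *)
Definition hilbert f (t : R) : R[i] :=
  lim (truncated_hilbert f t eps @[eps --> 0^'+]).

Definition w (x : R) : R := Num.sqrt (1 - x ^+ 2).

Definition check_hilbert g (t : R) : R[i] :=
  - ((w t)%:C * hilbert (fun x => g x / (w x)%:C) t).

(* The range of the operator hilbert : Linfty -> Lexp. *)
Definition hilbert_range : set (R -> R[i]) :=
  [set g | Lexp g /\ exists2 f, Linfty f & ae_eq11 (hilbert f) g].

End FiniteHilbertTransform.

(* Main.v *)
From HB Require Import structures.
Require Import Defs.
From mathcomp Require Import all_boot all_order all_algebra.
From mathcomp Require Import all_classical all_reals all_analysis.
From mathcomp Require Import measurable_realfun ess_sup_inf.
From mathcomp Require Import complex zify ring lra.

Set Implicit Arguments.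
Unset Strict Implicit.
Unset Printing Implicit Defensive.

Import Order.TTheory GRing.Theory Num.Theory.
Import numFieldNormedType.Exports.

Local Open Scope classical_set_scope.
Local Open Scope ring_scope.

(* For a real bounded f supported in [-1, 1] let P_d f and Q_d f be its Poisson
   and conjugate Poisson integrals.  The energy identity for
   (Q_d f - Q_e f)^2 + (P_d f - P_e f)^2 makes Q_d f converge a.e. to a function
   G (the trace of f), and the truncated Hilbert integrals of f have the same
   limit at Lebesgue points.  If H is the trace of h, then the integral of G h is
   minus that of f H.  For h(x) = w(x) q_e(x - t), where q_e is the conjugate
   Poisson kernel and e -> 0, this gives T(w G) = (1/pi) (integral of f) - w f
   a.e.; for h(x) = w(x) / (x - a), where a -> 1 or a -> -1, it shows that G / w
   has integral 0 and that x G(x) / w(x) has the integral of - f.  Since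
   w(x)^2 = (1 - t^2) - (x - t)(x + t), these facts combine to T(G / w) = - f / w.
   Membership of G in L_exp serves only to make G / w integrable.  So f is
   determined by its transform, which also yields uniqueness. *)

(** The duality rule [trace_dual] holds for bounded functions supported in [-1, 1]. The kernel 1 /
    (w(x) (x - t)), onto which one would like to move the transform, is unbounded, so the inversion
    formula is not a direct case of duality. Multiplying by w makes the test functions bounded, and
    their transforms follow from the one explicit transform - y of w; the price is that T(w G) comes
    out instead of T(G / w). Passing from one to the other costs two moments of G / w, which are out
    of reach of duality too. They are limits of identities with a pole a outside [-1, 1], in which
    the factor a + (1/pi) (integral of w(x) / (x - a)) has square a^2 - 1 and so dies at the edge.
    For the a.e. convergence, the energies (integral of f P_s f) tend to the integral of f^2. Along
    a suitable sequence the differences of Q_d f are then summable in a weighted L^1, which gives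
    pointwise limits together with a dominating function; a semigroup identity replaces the sequence
    by the full limit d -> 0. *)

(* J, poisson and cpoisson are locked because unification would unfold them. *)
HB.lock Definition J {R : realType} (f : R -> R) : R :=
  \int[@lebesgue_measure R]_x f x.

(** * Real integrals over the line: convergence theorems, Fubini, reflection *)

Section integral_layer.
Context {R : realType}.
Local Notation mu := (@lebesgue_measure R).
Implicit Types (f g h : R -> R) (c : R).

Definition ig f : Prop := mu.-integrable setT (EFin \o f).

Lemma ae_sub (P Q : R -> Prop) : {ae mu, forall x, P x} ->
  (forall x, P x -> Q x) -> {ae mu, forall x, Q x}.
Proof.
move=> hP PQ; apply: (@filterS _ _ (ae_filter_ringOfSetsType mu) P) => //.
Qed.

Lemma ae_and (P Q : R -> Prop) : {ae mu, forall x, P x} ->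
  {ae mu, forall x, Q x} -> {ae mu, forall x, P x /\ Q x}.
Proof.
move=> hP hQ; exact: (@filterI _ _ (ae_filter_ringOfSetsType mu) P Q).
Qed.

Lemma JE f : J f = \int[mu]_x f x.
Proof. by rewrite unlock. Qed.

Lemma EFin_J f : ig f -> (J f)%:E = (\int[mu]_x (f x)%:E)%E.
Proof. by move=> hf; rewrite JE fineK//; exact: integrable_fin_num. Qed.

Lemma ig_measurable f : ig f -> measurable_fun setT f.
Proof. by move=> /integrableP[/measurable_EFinP]. Qed.

Lemma ig_le f g : measurable_fun setT f -> ig g ->
  (forall x, `|f x| <= g x) -> ig f.
Proof.
move=> mf ig0 fg; apply: (le_integrable measurableT _ _ ig0).
- exact/measurable_EFinP.
- move=> x _ /=; rewrite lee_fin; exact: le_trans (fg x) (ler_norm _).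
Qed.

Lemma igD f g : ig f -> ig g -> ig (fun x => f x + g x).
Proof. by move=> hf hg; exact: (integrableD measurableT hf hg). Qed.

Lemma igZ c f : ig f -> ig (fun x => c * f x).
Proof. by move=> hf; exact: (integrableZl measurableT c hf). Qed.

Lemma igN f : ig f -> ig (fun x => - f x).
Proof. move=> hf; rewrite (_ : (fun x => - f x) = fun x => -1 * f x); first exact: igZ.
by apply/funext => x; rewrite mulN1r. Qed.

Lemma igB f g : ig f -> ig g -> ig (fun x => f x - g x).
Proof. by move=> hf hg; apply: igD => //; exact: igN. Qed.

Lemma ig_norm f : ig f -> ig (fun x => `|f x|).
Proof. exact: integrable_norm. Qed.

Lemma JD f g : ig f -> ig g -> J (fun x => f x + g x) = J f + J g.
Proof. by move=> hf hg; rewrite !JE RintegralD. Qed.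

Lemma JB f g : ig f -> ig g -> J (fun x => f x - g x) = J f - J g.
Proof. by move=> hf hg; rewrite !JE RintegralB. Qed.

Lemma JZ c f : ig f -> J (fun x => c * f x) = c * J f.
Proof. by move=> hf; rewrite !JE RintegralZl. Qed.

Lemma J0 : J (fun=> 0 : R) = 0.
Proof. by rewrite !JE /Rintegral integral0_eq. Qed.

Lemma JN f : ig f -> J (fun x => - f x) = - J f.
Proof.
move=> hf; rewrite -mulN1r -JZ//; congr J; apply/funext => x.
by rewrite mulN1r.
Qed.

Lemma J_le f g : ig f -> ig g -> (forall x, f x <= g x) -> J f <= J g.
Proof. by move=> hf hg fg; rewrite !JE; apply: le_Rintegral. Qed.

Lemma J_ge0 f : (forall x, 0 <= f x) -> 0 <= J f.
Proof. by move=> f0; rewrite JE; apply: Rintegral_ge0. Qed.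

Lemma J_norm f : ig f -> `|J f| <= J (fun x => `|f x|).
Proof. by move=> hf; rewrite !JE; exact: le_normr_Rintegral. Qed.

Lemma J_normle f g : ig f -> ig g -> (forall x, `|f x| <= g x) ->
  `|J f| <= J g.
Proof.
by move=> hf hg fg; apply: le_trans (J_norm hf) _; apply: J_le => //; exact: ig_norm.
Qed.

Lemma ig_ae f g : measurable_fun setT g -> ig f ->
  {ae mu, forall x, f x = g x} -> ig g.
Proof.
move=> mg /integrableP[mf fi] fg; apply/integrableP; split.
  exact/measurable_EFinP.
rewrite (_ : integral _ _ _ = \int[mu]_x `|(EFin \o f) x|)%E//.
apply: ae_eq_integral => //.
- by apply: measurableT_comp => //; exact/measurable_EFinP.
- exact: measurableT_comp.
- by apply: ae_sub fg _ => x fgx _ /=; rewrite fgx.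
Qed.

Lemma J_ae f g : measurable_fun setT f -> measurable_fun setT g ->
  {ae mu, forall x, f x = g x} -> J f = J g.
Proof.
move=> mf mg fg; rewrite !JE /Rintegral; congr fine.
apply: ae_eq_integral => //; try exact/measurable_EFinP.
by apply: ae_sub fg _ => x fgx _ /=; rewrite fgx.
Qed.


Lemma J_dominated_ae (F : nat -> R -> R) f g :
  (forall n, measurable_fun setT (F n)) -> measurable_fun setT f -> ig g ->
  {ae mu, forall x, F ^~ x @ \oo --> f x} ->
  {ae mu, forall x, forall n, `|F n x| <= g x} ->
  ig f /\ J (F n) @[n --> \oo] --> J f.
Proof.
move=> mF mf hg Ff Fg.
have [|||||hf _ cv] := @dominated_convergence _ _ _ mu setT measurableT
   (fun n => EFin \o F n) (EFin \o f) (EFin \o g).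
- by move=> n; apply/measurable_EFinP; exact: mF.
- exact/measurable_EFinP.
- apply: ae_sub Ff _ => x cvx _ /=; apply: cvg_EFin => //.
  by near=> n.
- exact: hg.
- by apply: ae_sub Fg _ => x Fgx n _ /=; rewrite lee_fin.
split => //; rewrite JE (_ : (fun n => J (F n)) = fun n => \int[mu]_x F n x).
  by apply: fine_cvg; rewrite /Rintegral fineK//; exact: integrable_fin_num.
by apply/funext => n; rewrite JE.
Unshelve. all: end_near. Qed.

Lemma J_dominated (F : nat -> R -> R) f g :
  (forall n, measurable_fun setT (F n)) -> measurable_fun setT f -> ig g ->
  {ae mu, forall x, F ^~ x @ \oo --> f x} ->
  (forall n x, `|F n x| <= g x) ->
  ig f /\ J (F n) @[n --> \oo] --> J f.
Proof.
move=> mF mf hg Ff Fg; apply: (J_dominated_ae mF mf hg Ff).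
by apply: aeW => x n; exact: Fg.
Qed.

(** The product bound [a x * b y] yields integrability on the plane and of every section, so the
    inner integrals are genuine real numbers. *)
Lemma Fubini_J (F : R -> R -> R) (a b : R -> R) :
  measurable_fun setT (fun z : R * R => F z.1 z.2) ->
  ig a -> ig b -> (forall x y, `|F x y| <= a x * b y) ->
  [/\ measurable_fun setT (fun x => J (F x)),
      measurable_fun setT (fun y => J (fun x => F x y)) &
      J (fun x => J (F x)) = J (fun y => J (fun x => F x y))].
Proof.
move=> mF ha hb Fab.
have iF : (mu \x mu)%E.-integrable setT (fun z : R * R => (F z.1 z.2)%:E).
  apply/integrable12ltyP; first exact/measurable_EFinP.
  apply: (@le_lt_trans _ _ (\int[mu]_x (`|a x|%:E * \int[mu]_y `|b y|%:E))%E).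
    apply: ge0_le_integral => //.
    - by move=> x _; exact: integral_ge0.
    - apply: (@measurable_fun_fubini_tonelli_F _ _ _ _ _ mu
        (fun z : R * R => `|(F z.1 z.2)%:E|)%E).
      + by apply: measurableT_comp => //; exact/measurable_EFinP.
      + by [].
    - apply: emeasurable_funM => //.
      by apply/measurable_EFinP; apply: measurableT_comp => //; exact: ig_measurable.
    - move=> x _; rewrite -ge0_integralZl//; last first.
        by apply/measurable_EFinP; apply: measurableT_comp => //; exact: ig_measurable.
      apply: ge0_le_integral => //.
      + apply: measurableT_comp => //.
        by apply/measurable_EFinP; apply: (measurableT_comp mF).
      + apply: emeasurable_funM => //.
        by apply/measurable_EFinP; apply: measurableT_comp => //; exact: ig_measurable.
      + move=> y _; rewrite -EFinM lee_fin; apply: le_trans (Fab x y) _.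
        by rewrite -normrM ler_norm.
  move: ha hb => /integrableP[ma ha] /integrableP[mb hb].
  rewrite ge0_integralZr//; last 2 first.
  - apply/measurable_EFinP; apply: measurableT_comp => //.
    exact/measurable_EFinP.
  - exact: integral_ge0.
  by rewrite lte_mul_pinfty//; [exact: integral_ge0|rewrite ge0_fin_numE//; exact: integral_ge0].
have mFx x : measurable_fun setT (F x).
  exact: (measurableT_comp mF (pair1_measurable x)).
have mFy y : measurable_fun setT (F^~ y).
  exact: (measurableT_comp mF (pair2_measurable y)).
have iFx x : ig (F x).
  by apply: (ig_le (mFx x) (igZ (a x) hb)) => y; exact: Fab.
have iFy y : ig (F^~ y).
  apply: (ig_le (mFy y) (igZ (b y) ha)) => x; rewrite mulrC; exact: Fab.
have E1 x : (\int[mu]_y (F x y)%:E = (J (F x))%:E)%E.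
  by rewrite EFin_J.
have E2 y : (\int[mu]_x (F x y)%:E = (J (F^~ y))%:E)%E.
  by rewrite EFin_J.
split.
- apply/measurable_EFinP; have := measurable_fubini_F iF; apply: eq_measurable_fun => x _.
  exact: E1.
- apply/measurable_EFinP; have := measurable_fubini_G iF; apply: eq_measurable_fun => x _.
  exact: E2.
- have := Fubini iF; rewrite /fubini_F /fubini_G /=.
  under eq_integral do rewrite E1.
  under [X in _ = X -> _]eq_integral do rewrite E2.
  by rewrite !JE /Rintegral => ->.
Qed.

Lemma J_reflect (t : R) f : ig f ->
  ig (fun x => f (2 * t - x)) /\ J (fun x => f (2 * t - x)) = J f.
Proof.
move=> hf; pose phi x := 2 * t - x : R.
have mphi : measurable_fun setT phi by exact: measurable_funB.
have mphi' : @measurable_fun _ _ (measurableTypeR R) (measurableTypeR R) setT phi by [].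
have E (A : set R) : measurable A -> mu A = pushforward mu (phi : R -> measurableTypeR R) A.
  move=> mA; apply: lebesgue_measure_unique => //= _ [[a b]] _ <-.
  (* Reflection moves the closed end of the half-open interval to the other side and keeps its
     length. *)
  rewrite /pushforward (_ : phi @^-1` _ = `[2 * t - b, 2 * t - a[%classic).
    rewrite !lebesgue_measure_itv/= !lte_fin -!EFinB.
    rewrite ltrD2l ltrN2; case: ifP => // _; congr EFin; ring.
  by apply/seteqP; split => x /=; rewrite !in_itv/= /phi; lra.
have key (h : R -> \bar R) : measurable_fun setT h -> (forall x, 0 <= h x)%E ->
    (\int[mu]_x h (phi x) = \int[mu]_x h x)%E.
  move=> mh h0; rewrite -[LHS](ge0_integral_pushforward mphi' mu measurableT mh)//.
  by apply: eq_measure_integral => A mA _; exact: esym (E A mA).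
move/integrableP : hf => [mf fi].
have mf' : measurable_fun setT f by exact/measurable_EFinP.
split.
  apply/integrableP; split.
    by apply/measurable_EFinP; apply: (measurableT_comp mf').
  rewrite (key (fun x => `|(f x)%:E|)%E)//.
  by apply: measurableT_comp.
(* [key] changes variables for nonnegative functions only, hence the split into positive and
   negative parts. *)
rewrite !JE /Rintegral; congr fine; rewrite [LHS]integralE [RHS]integralE.
congr (_ - _)%E.
- rewrite unlock; apply: (key (fun x => maxe (f x)%:E 0%E)) => [|x].
    by apply: measurable_maxe => //; exact/measurable_EFinP.
  by rewrite le_max lexx orbT.
- rewrite unlock; apply: (key (fun x => maxe (- (f x)%:E)%E 0%E)) => [|x].
    by apply: measurable_maxe => //; apply: measurableT_comp => //; exact/measurable_EFinP.
  by rewrite le_max lexx orbT.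
Qed.

End integral_layer.

(** * Monotone limits and improper integrals through primitives *)

Section line_integrals.
Context {R : realType}.
Local Notation mu := (@lebesgue_measure R).
Implicit Types (f g h F : R -> R) (a b c : R).

(** The supremum may be infinite on a null set, where [fine] replaces it by 0; this is why the
    convergence is only almost everywhere. *)
Lemma Beppo_Levi (u : nat -> R -> R) (M : R) : (forall n, ig (u n)) ->
  (forall n x, 0 <= u n x) -> (forall x, nondecreasing_seq (u^~ x)) ->
  (forall n, J (u n) <= M) ->
  exists2 h, ig h & {ae mu, forall x, u^~ x @ \oo --> h x}.
Proof.
move=> iu u0 ndu uM; pose H x := limn (fun n => (u n x)%:E).
have mu_ n : measurable_fun setT (fun x => (u n x)%:E).
  by apply/measurable_EFinP; exact: ig_measurable.
have ndE x : nondecreasing_seq (fun n => (u n x)%:E).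
  by move=> m n mn; rewrite lee_fin; exact: ndu.
have cvE x : cvgn (fun n => (u n x)%:E).
  exact: ereal_nondecreasing_is_cvgn.
have mH : measurable_fun setT H.
  apply: (emeasurable_fun_cvg (fun n x => (u n x)%:E)) => // x _; exact: cvE.
have H0 x : (0 <= H x)%E.
  by apply: lime_ge => //; apply: nearW => n; rewrite lee_fin.
have iH : (\int[mu]_x H x <= M%:E)%E.
  rewrite /H monotone_convergence//; last first.
    by move=> n x _; rewrite lee_fin.
  apply: lime_le.
  - apply: ereal_nondecreasing_is_cvgn => m n mn.
    apply: ge0_le_integral => //.
    + by move=> x _; rewrite lee_fin.
    + exact: mu_.
    + exact: mu_.
    + by move=> x _; rewrite lee_fin; exact: ndu.
  - apply: nearW => n.
    by rewrite -(EFin_J (iu n)) lee_fin.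
have iH' : mu.-integrable setT H.
  apply/integrableP; split => //; apply: le_lt_trans (ltry M).
  by under eq_integral do rewrite gee0_abs//.
exists (fine \o H).
  have mfH : measurable_fun setT (fine \o H) by exact: measurableT_comp.
  apply/integrableP; split; first exact/measurable_EFinP.
  move/integrableP : iH' => [_]; apply: le_lt_trans.
  apply: ge0_le_integral => //.
  - by apply: measurableT_comp => //; exact/measurable_EFinP.
  - exact: measurableT_comp.
  - move=> x _ /=; rewrite !gee0_abs ?lee_fin ?fine_ge0//.
    case: (H x) (H0 x) => //= [r|_]; last by rewrite normr0 leey.
    by rewrite !lee_fin => r0; rewrite ger0_norm.
have := integrable_ae measurableT iH'.
move=> hae; apply: ae_sub hae _ => x /(_ I) fH /=.
have h : (u n x)%:E @[n --> \oo] --> (fine (H x))%:E by rewrite fineK//; exact: cvE.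
exact: (fine_cvg h).
Qed.

Lemma measurable_itv_restrict f a b : {within `[a, b], continuous f} ->
  measurable_fun setT (f \_ `[a, b]).
Proof.
move=> cf; apply/(measurable_restrictT _ _).1 => //.
exact: subspace_continuous_measurable_fun.
Qed.

Lemma ig_restrict f (A : set R) : measurable A ->
  mu.-integrable A (EFin \o f) -> ig (f \_ A).
Proof.
move=> mA fA; rewrite /ig -restrict_EFin.
by apply/integrable_restrict => //=; rewrite setTI.
Qed.

Lemma ig_itv f a b : {within `[a, b], continuous f} -> ig (f \_ `[a, b]).
Proof.
move=> cf; apply: ig_restrict => //.
by apply: continuous_compact_integrable => //; exact: segment_compact.
Qed.

Lemma FTC_J f F a b : a < b -> {within `[a, b], continuous f} ->
  {within `[a, b], continuous F} ->
  (forall x : R, a < x < b -> is_derive x 1 F (f x)) ->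
  J (f \_ `[a, b]) = F b - F a.
Proof.
move=> ab cf cF dF; rewrite JE -Rintegral_mkcond /Rintegral.
rewrite (@continuous_FTC2 _ f F a b) //=.
  have [_ Fa Fb] := (continuous_within_itvP F ab).1 cF.
  split => // x; rewrite in_itv/= => xab; by have [] := dF _ xab.
by move=> x; rewrite in_itv/= => xab; have dFx := dF _ xab; rewrite derive1E derive_val.
Qed.

Lemma J_seg f F a b : a < b -> continuous f ->
  (forall x : R, is_derive x 1 F (f x)) ->
  ig (f \_ `[a, b]) /\ J (f \_ `[a, b]) = F b - F a.
Proof.
move=> ab cf dF; split.
  by apply: ig_itv; apply: continuous_subspaceT.
apply: FTC_J => //; apply: continuous_subspaceT => // x.
by apply/differentiable_continuous/derivable1_diffP; have [] := dF x.
Qed.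

Lemma cvg_restrict_line f x : (f \_ `[- n%:R, n%:R]) x @[n --> \oo] --> f x.
Proof.
apply: cvg_near_cst; near=> n; rewrite patchE ifT// inE/= in_itv/= -ler_norml.
near: n; exact: nbhs_infty_ger.
Unshelve. all: end_near. Qed.

Lemma J_line f F l : ig f -> continuous f ->
  (forall x : R, is_derive x 1 F (f x)) ->
  F n%:R - F (- n%:R) @[n --> \oo] --> l -> J f = l.
Proof.
move=> hf cf dF Fl.
have [_ cv] : ig f /\ J (f \_ `[- n%:R, n%:R]) @[n --> \oo] --> J f.
  apply: (J_dominated _ _ (ig_norm hf)).
  - by move=> n; apply: measurable_itv_restrict; exact: continuous_subspaceT.
  - exact: ig_measurable.
  - by apply: aeW => x; exact: cvg_restrict_line.
  - by move=> n x; rewrite patchE; case: ifP => // _; rewrite normr0.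
apply: (cvg_unique _ cv) => //; apply: cvg_trans Fl; apply: near_eq_cvg.
near=> n; have n0 : - n%:R < n%:R :> R.
  by rewrite gtrN// ltr0n; near: n; exact: nbhs_infty_gt.
by have [_ ->] := J_seg n0 cf dF.
Unshelve. all: end_near. Qed.

(** The integrals over growing symmetric segments are increments of the primitive, hence bounded,
    and monotone convergence applies. *)
Lemma ig_line f F (M : R) : (forall x, 0 <= f x) -> continuous f ->
  (forall x : R, is_derive x 1 F (f x)) -> (forall x, `|F x| <= M) -> ig f.
Proof.
move=> f0 cf dF FM.
(* The index is shifted so that every segment is nondegenerate, as [J_seg] requires. *)
have S n : (- n.+1%:R < n.+1%:R :> R) by rewrite gtrN// ltr0n.
have [n|n x|x|n|h ih cv] := @Beppo_Levi (fun n => f \_ `[- n.+1%:R, n.+1%:R]) (M + M).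
- by have [] := J_seg (S n) cf dF.
- by rewrite patchE; case: ifP.
- move=> m n mn; rewrite !patchE; case: ifPn => [|_]; last by case: ifP.
  rewrite inE/= in_itv/= -ler_norml => xm; rewrite ifT// inE/= in_itv/= -ler_norml.
  by rewrite (le_trans xm)// ler_nat.
- have [_ ->] := J_seg (S n) cf dF; rewrite (le_trans (ler_norm _))//.
  by rewrite (le_trans (ler_normB _ _))// lerD.
apply: (ig_ae _ ih) => //; first exact: continuous_measurable_fun.
apply: ae_sub cv _ => x cv; apply: (cvg_unique _ cv) => //.
by have := @cvg_restrict_line f x; rewrite -cvg_shiftS.
Qed.

End line_integrals.

(** * Poisson and conjugate Poisson kernels of the half-plane *)

HB.lock Definition poisson {R : realType} (d u : R) : R :=
  pi^-1 * (d / (u ^+ 2 + d ^+ 2)).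

HB.lock Definition cpoisson {R : realType} (d u : R) : R :=
  pi^-1 * (u / (u ^+ 2 + d ^+ 2)).

Section poisson_kernels.
Context {R : realType}.
Local Notation mu := (@lebesgue_measure R).
Implicit Types (d e t u v x y z : R).

Lemma poissonE d u : poisson d u = pi^-1 * (d / (u ^+ 2 + d ^+ 2)).
Proof. by rewrite unlock. Qed.

Lemma cpoissonE d u : cpoisson d u = pi^-1 * (u / (u ^+ 2 + d ^+ 2)).
Proof. by rewrite unlock. Qed.

Lemma pi_neq0 : (pi : R) != 0.
Proof. by rewrite gt_eqF// pi_gt0. Qed.

Lemma poisson_den d u : 0 < d -> 0 < u ^+ 2 + d ^+ 2.
Proof. by move=> d0; rewrite ltr_wpDl ?sqr_ge0// exprn_gt0. Qed.

Lemma poisson_den_neq0 d u : 0 < d -> u ^+ 2 + d ^+ 2 != 0.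
Proof. by move=> d0; rewrite gt_eqF// poisson_den. Qed.

Lemma poisson_ge0 d u : 0 < d -> 0 <= poisson d u.
Proof.
move=> d0; rewrite poissonE mulr_ge0// ?invr_ge0 ?pi_ge0//.
by rewrite divr_ge0 ?(ltW d0)// ltW// poisson_den.
Qed.

Lemma poisson_gt0 d u : 0 < d -> 0 < poisson d u.
Proof.
move=> d0; rewrite poissonE mulr_gt0// ?invr_gt0 ?pi_gt0//.
by rewrite divr_gt0// poisson_den.
Qed.

Lemma poissonN d u : poisson d (- u) = poisson d u.
Proof. by rewrite !poissonE sqrrN. Qed.

Lemma cpoissonN d u : cpoisson d (- u) = - cpoisson d u.
Proof. by rewrite !cpoissonE sqrrN mulNr mulrN. Qed.

Lemma cpoisson_sub d x y : cpoisson d (x - y) = - cpoisson d (y - x).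
Proof. by rewrite -cpoissonN opprB. Qed.

Lemma poisson_sub d x y : poisson d (x - y) = poisson d (y - x).
Proof. by rewrite -poissonN opprB. Qed.

Lemma continuous_inv_den d (h : R -> R) : 0 < d -> continuous h ->
  continuous (fun u => pi^-1 * (h u / (u ^+ 2 + d ^+ 2)) : R).
Proof.
move=> d0 ch u; apply: cvgM; first exact: cvg_cst.
apply: cvgM; first exact: ch.
apply: cvgV; first exact: poisson_den_neq0.
by apply: cvgD; [exact: exprn_continuous|exact: cvg_cst].
Qed.

Lemma continuous_poisson d : 0 < d -> continuous (poisson d).
Proof.
move=> d0; rewrite (funext (poissonE d)).
by apply: continuous_inv_den => // u; exact: cvg_cst.
Qed.

Lemma continuous_cpoisson d : 0 < d -> continuous (cpoisson d).
Proof.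
move=> d0; rewrite (funext (cpoissonE d)).
by apply: continuous_inv_den => // u; exact: cvg_id.
Qed.

Lemma continuous_shift (h : R -> R) t : continuous h ->
  continuous (fun x => h (x - t)).
Proof.
move=> ch x; apply: (continuous_comp (f := fun x => x - t)); last exact: ch.
by apply: cvgB; [exact: cvg_id|exact: cvg_cst].
Qed.

Lemma is_derive_poisson d t x : 0 < d ->
  is_derive x (1 : R) (fun x => pi^-1 * atan ((x - t) / d)) (poisson d (x - t)).
Proof.
move=> d0; apply: is_derive_eq.
rewrite !poissonE /GRing.scale/=.
have h := poisson_den_neq0 (x - t) d0.
have h2 : 1 + ((x - t) / d) ^+ 2 != 0 by rewrite gt_eqF// ltr_wpDr// sqr_ge0.
have h3 := lt0r_neq0 d0.
move: (pi : R) pi_neq0 => P P0.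
field.
by rewrite h P0 h3.
Qed.

Lemma is_derive_cpoisson d t x : 0 < d ->
  is_derive x (1 : R) (fun x => pi^-1 * (2^-1 * ln ((x - t) ^+ 2 + d ^+ 2)))
    (cpoisson d (x - t)).
Proof.
move=> d0; have h := poisson_den (x - t) d0.
have dl := is_derive1_ln h.
apply: is_derive_eq.
rewrite !cpoissonE /GRing.scale/=.
move: (pi : R) pi_neq0 => P P0; move/lt0r_neq0 : h => h.
field.
by rewrite h P0.
Qed.

Lemma ig_poisson d t : 0 < d -> ig (fun x => poisson d (x - t)).
Proof.
move=> d0; apply: (@ig_line _ _ (fun x => pi^-1 * atan ((x - t) / d)) (pi^-1 * (pi / 2))).
- by move=> x; exact: poisson_ge0.
- by apply: continuous_shift; exact: continuous_poisson.
- by move=> x; exact: is_derive_poisson.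
- move=> x; rewrite normrM ger0_norm ?invr_ge0 ?pi_ge0//.
  rewrite ler_wpM2l ?invr_ge0 ?pi_ge0// ler_norml.
  by rewrite !ltW ?atan_gtNpi2 ?atan_ltpi2.
Qed.

Lemma J_poisson d t : 0 < d -> J (fun x => poisson d (x - t)) = 1.
Proof.
move=> d0; apply: (@J_line _ _ (fun x => pi^-1 * atan ((x - t) / d))).
- exact: ig_poisson.
- by apply: continuous_shift; exact: continuous_poisson.
- by move=> x; exact: is_derive_poisson.
- have H s : atan ((n%:R - s) / d) @[n --> \oo] --> (pi / 2 : R).
    apply: (cvg_comp (fun n => (n%:R - s) / d)); last exact: cvgy_atan.
    apply/cvgryPge => A; near=> n.
    rewrite ler_pdivlMr// lerBrDr; near: n; exact: nbhs_infty_ger.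
  rewrite (_ : (fun n : nat => _) = fun n : nat =>
      pi^-1 * (atan ((n%:R - t) / d) + atan ((n%:R - (- t)) / d))); last first.
    apply/funext => n; rewrite -mulrBr; congr (_ * (_ + _)).
    by rewrite -atanN; congr atan; rewrite -mulNr; congr (_ / _); ring.
  rewrite [X in _ --> X](_ : _ = pi^-1 * (pi / 2 + pi / 2)); last first.
    by rewrite -splitr mulVf// pi_neq0.
  by apply: cvgM; [exact: cvg_cst|apply: cvgD; exact: H].
Unshelve. all: end_near. Qed.

(** One conjugate kernel decays like 1/x and is not integrable; in a difference the leading terms
    cancel, and what remains is dominated by Poisson kernels. *)
Lemma ig_cpoissonB d e y z : 0 < d -> 0 < e ->
  ig (fun x => cpoisson e (x - z) - cpoisson d (x - y)).
Proof.
(* With X, Y the two denominators, the numerator is bounded by four terms in X and Y; the summands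
   of [K] are their coefficients relative to d Y and e X. *)
move=> d0 e0; set K := `|z - y| / (2 * d) + `|z - y| / (2 * e) + d / (2 * e) + e / (2 * d).
apply: (@ig_le _ _ (fun x => K * (poisson d (x - y) + poisson e (x - z)))).
- apply: continuous_measurable_fun => x; apply: cvgB; apply: continuous_shift; exact: continuous_cpoisson.
- by apply: igZ; apply: igD; exact: ig_poisson.
- move=> x; pose u := x - y; pose v := x - z.
  pose X := u ^+ 2 + d ^+ 2; pose Y := v ^+ 2 + e ^+ 2.
  have X0 : 0 < X by exact: poisson_den.
  have Y0 : 0 < Y by exact: poisson_den.
  have X1 := lt0r_neq0 X0; have Y1 := lt0r_neq0 Y0; 
  rewrite (_ : _ - _ = pi^-1 * ((u * v * (z - y) + v * d ^+ 2 - u * e ^+ 2) / (X * Y))); last first.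
    rewrite !cpoissonE -/u -/v -/X -/Y (_ : z - y = u - v); last by rewrite /u /v; ring.
    rewrite (_ : _ + _ - _ = v * X - u * Y); last by rewrite /X /Y; ring.
    by rewrite -mulrBr; congr (_ * _); field; rewrite X1 Y1.
  rewrite (_ : K * _ = pi^-1 * ((K * (d * Y + e * X)) / (X * Y))); last first.
    rewrite !poissonE -/u -/v -/X -/Y -mulrDr mulrCA; congr (_ * _).
    by field; rewrite X1 Y1.
  rewrite normrM ger0_norm ?invr_ge0 ?pi_ge0// ler_wpM2l ?invr_ge0 ?pi_ge0//.
  rewrite normrM (@ger0_norm _ (X * Y)^-1); last by rewrite invr_ge0 ltW// mulr_gt0.
  rewrite ler_pM2r ?invr_gt0 ?mulr_gt0//.
  have hv : `|v| <= Y / (2 * e).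
    rewrite ler_pdivlMr; last lra.
    by have := sqr_ge0 (`|v| - e); rewrite sqrrB real_normK ?num_real// /Y; lra.
  have hu : `|u| <= X / (2 * d).
    rewrite ler_pdivlMr; last lra.
    by have := sqr_ge0 (`|u| - d); rewrite sqrrB real_normK ?num_real// /X; lra.
  have huv : `|u * v| <= X / 2 + Y / 2.
    have := sqr_ge0 (`|u| - `|v|); have := sqr_ge0 d; have := sqr_ge0 e.
    by rewrite sqrrB !real_normK ?num_real// normrM /X /Y; lra.
  apply: (@le_trans _ _ ((X / 2 + Y / 2) * `|z - y| + Y / (2 * e) * d ^+ 2 + X / (2 * d) * e ^+ 2)).
    rewrite (le_trans (ler_normB _ _))// lerD//.
      rewrite (le_trans (ler_normD _ _))// lerD// normrM.
        by rewrite ler_wpM2r.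
      by rewrite (ger0_norm (sqr_ge0 _)) ler_wpM2r ?sqr_ge0.
    by rewrite normrM (ger0_norm (sqr_ge0 _)) ler_wpM2r ?sqr_ge0.
  rewrite -subr_ge0 (_ : _ - _ = `|z - y| * (e * X / (2 * d) + d * Y / (2 * e)) + d * X / 2 + e * Y / 2).
    have d1 := ltW d0; have e1 := ltW e0; have X2 := ltW X0; have Y2 := ltW Y0.
    rewrite addr_ge0 ?divr_ge0 ?mulr_ge0// addr_ge0 ?divr_ge0 ?mulr_ge0//.
    by rewrite addr_ge0// divr_ge0// mulr_ge0.
  by rewrite /K; field; rewrite (lt0r_neq0 d0) (lt0r_neq0 e0).
Qed.

(** The primitive [F] is a difference of logarithms. In the variable s = 1/x it becomes [G],
    continuous at 0, so both ends of the line have the same limit. *)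
Lemma J_cpoissonB d e y z : 0 < d -> 0 < e ->
  J (fun x => cpoisson e (x - z) - cpoisson d (x - y)) = 0.
Proof.
move=> d0 e0.
pose G (s : R) := pi^-1 * (2^-1 * (ln ((1 - s * z) ^+ 2 + (e * s) ^+ 2) -
  ln ((1 - s * y) ^+ 2 + (d * s) ^+ 2))).
pose F x := pi^-1 * (2^-1 * ln ((x - z) ^+ 2 + e ^+ 2))
  - pi^-1 * (2^-1 * ln ((x - y) ^+ 2 + d ^+ 2)) : R.
have FG x : x != 0 -> F x = G x^-1.
  move=> x0; rewrite /F /G -mulrBr -mulrBr; congr (_ * (_ * _)).
  have key (c f : R) : 0 < c -> ln ((x - f) ^+ 2 + c ^+ 2) =
      ln (x ^+ 2) + ln ((1 - x^-1 * f) ^+ 2 + (c * x^-1) ^+ 2).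
    move=> c0; rewrite -lnM ?posrE; last 2 first.
    - by rewrite lt_neqAle eq_sym sqrf_eq0 x0 sqr_ge0.
    - rewrite ltr_wpDl ?sqr_ge0// lt_neqAle eq_sym sqrf_eq0 sqr_ge0.
      by rewrite mulf_eq0 invr_eq0 negb_or x0 (lt0r_neq0 c0).
    by congr ln; field.
  by rewrite !key//; ring.
have G0 : G 0 = 0 by rewrite /G !mul0r !subr0 !mulr0 subrr !mulr0.
have cG : {for (0 : R), continuous G}.
  have key (c f : R) : {for (0 : R), continuous (fun s : R => ln ((1 - s * f) ^+ 2 + (c * s) ^+ 2))}.
    have h : 0 < (1 - 0 * f) ^+ 2 + (c * 0) ^+ 2.
      by rewrite mul0r subr0 mulr0 expr0n/= addr0 expr1n.
    have dl := is_derive1_ln h.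
    by apply/differentiable_continuous/derivable1_diffP/ex_derive.
  rewrite /prop_for/continuous_at; apply: cvgM; first exact: cvg_cst.
  apply: cvgM; first exact: cvg_cst.
  by apply: cvgB; exact: key.
have cN (s : R) : s * n%:R^-1 @[n --> \oo] --> (0 : R).
  rewrite -[X in _ --> X](mulr0 s); apply: cvgM; first exact: cvg_cst.
  apply/gtr0_cvgV0; last exact: cvgr_idn.
  by near=> n; rewrite ltr0n; near: n; exact: nbhs_infty_gt.
apply: (@J_line _ (fun x => cpoisson e (x - z) - cpoisson d (x - y)) F).
- exact: ig_cpoissonB.
- move=> x; apply: cvgB; apply: continuous_shift; exact: continuous_cpoisson.
- move=> x; have := is_derive_cpoisson z x e0; have := is_derive_cpoisson y x d0 => dd de.
  exact: is_deriveB.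
- rewrite (_ : 0 = G 0 - G 0); last by rewrite subrr.
  apply: (@cvg_trans _ (G (1 * n%:R^-1) - G (-1 * n%:R^-1) @[n --> \oo])).
    apply: near_eq_cvg; near=> n.
    have n0 : n%:R != 0 :> R by rewrite pnatr_eq0 -lt0n; near: n; exact: nbhs_infty_gt.
    by rewrite !FG ?oppr_eq0// invrN mul1r mulN1r.
  by apply: cvgB; apply: (cvg_comp _ _ (cN _)); exact: cG.
Unshelve. all: end_near. Qed.

(** Products of kernels are brought to this form by partial fractions, and their integrals are then
    read off the coefficients. *)
Lemma J_kernel_comb d e y z (a b c : R) : 0 < d -> 0 < e ->
  ig (fun x => a * poisson d (x - y) + b * poisson e (x - z)
     + c * (cpoisson e (x - z) - cpoisson d (x - y))) /\
  J (fun x => a * poisson d (x - y) + b * poisson e (x - z)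
     + c * (cpoisson e (x - z) - cpoisson d (x - y))) = a + b.
Proof.
move=> d0 e0.
have i1 := igZ a (ig_poisson y d0); have i2 := igZ b (ig_poisson z e0).
have i3 := igZ c (ig_cpoissonB y z d0 e0).
split; first by apply: igD => //; exact: igD.
rewrite JD//; last exact: igD.
rewrite JD// (JZ a (ig_poisson y d0)) (JZ b (ig_poisson z e0)).
by rewrite (JZ c (ig_cpoissonB y z d0 e0)) !J_poisson// J_cpoissonB// mulr0 !mulr1 addr0.
Qed.

(** Real part of the partial fraction of 1 / ((x - y + i d) (x - z - i e)): the two poles lie on
    opposite sides of the line, and their difference is z - y + i (d + e). *)
Lemma poisson_cpoisson_energy d e y z x : 0 < d -> 0 < e ->
  poisson d (x - y) * poisson e (x - z) +
    cpoisson d (x - y) * cpoisson e (x - z) =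
  poisson (d + e) (z - y) * poisson d (x - y) +
  poisson (d + e) (z - y) * poisson e (x - z) +
  cpoisson (d + e) (z - y) * (cpoisson e (x - z) - cpoisson d (x - y)).
Proof.
move=> d0 e0; rewrite !poissonE !cpoissonE.
have h1 := poisson_den_neq0 (x - y) d0; have h2 := poisson_den_neq0 (x - z) e0.
have h3 := poisson_den_neq0 (z - y) (addr_gt0 d0 e0).
move: (pi : R) pi_neq0 => P h4.
field.
by rewrite h1 h2 h3 h4.
Qed.

Lemma J_energy d e y z : 0 < d -> 0 < e ->
  J (fun x => poisson d (x - y) * poisson e (x - z) +
    cpoisson d (x - y) * cpoisson e (x - z)) = 2 * poisson (d + e) (z - y).
Proof.
move=> d0 e0.
under [X in J X]funext => x do rewrite poisson_cpoisson_energy//.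
rewrite (J_kernel_comb y z _ _ _ d0 e0).2; ring.
Qed.

(** Here poles on the same side are paired as well, with denominator [T]; [d != e] keeps [T]
    positive when y = z. The terms in [T] cancel in A + B. *)
Lemma J_cross d e y z : 0 < d -> 0 < e -> d != e ->
  J (fun x => cpoisson d (x - y) * poisson e (x - z)) = cpoisson (d + e) (z - y).
Proof.
move=> d0 e0 de; pose S := (z - y) ^+ 2 + (d + e) ^+ 2; pose T := (z - y) ^+ 2 + (d - e) ^+ 2.
have T0 : 0 < T by rewrite /T ltr_wpDl ?sqr_ge0// lt_neqAle sqr_ge0 eq_sym sqrf_eq0 subr_eq0 de.
pose A := 2^-1 * (cpoisson (d + e) (z - y) - pi^-1 * ((z - y) / T)).
pose B := 2^-1 * (cpoisson (d + e) (z - y) + pi^-1 * ((z - y) / T)).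
pose C := 2^-1 * (pi^-1 * ((d - e) / T) - poisson (d + e) (z - y)).
rewrite (_ : (fun x => _) = (fun x => A * poisson d (x - y) + B * poisson e (x - z)
     + C * (cpoisson e (x - z) - cpoisson d (x - y)))).
  by have [_ ->] := J_kernel_comb y z A B C d0 e0; rewrite /A /B; lra.
apply/funext => x; rewrite /A /B /C !poissonE !cpoissonE.
have h1 := poisson_den_neq0 (x - y) d0; have h2 := poisson_den_neq0 (x - z) e0.
have h3 := poisson_den_neq0 (z - y) (addr_gt0 d0 e0).
move/lt0r_neq0 : T0; rewrite /T => T0.
move: (pi : R) pi_neq0 => P h4.
field.
by rewrite h1 h2 h3 h4.
Qed.

(** The single weight [poisson 1] dominates every Poisson kernel. After clearing denominators the
    difference of the two sides is a sum of nonnegative multiples of squares. *)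
Lemma poisson_le d t x : 0 < d ->
  poisson d (x - t) <= ((1 + 2 * t ^+ 2) / d + 2 * d) * poisson 1 x.
Proof.
move=> d0; rewrite !poissonE [leRHS]mulrCA ler_wpM2l ?invr_ge0 ?pi_ge0//.
have h1 := poisson_den (x - t) d0; have h2 := poisson_den x (@ltr01 R).
rewrite div1r ler_pdivrMr// mulrAC ler_pdivlMr// expr1n.
rewrite -subr_ge0 (_ : _ - _ = d * (x - 2 * t) ^+ 2 + (1 + 2 * t ^+ 2) / d * (x - t) ^+ 2
   + 2 * d * d ^+ 2); last by field; exact: lt0r_neq0.
have d1 := ltW d0; have := sqr_ge0 t => t2.
have a1 : 0 <= d * (x - 2 * t) ^+ 2 by rewrite mulr_ge0// sqr_ge0.
have a2 : 0 <= (1 + 2 * t ^+ 2) / d * (x - t) ^+ 2.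
  by rewrite mulr_ge0 ?sqr_ge0// divr_ge0//; lra.
have a3 : 0 <= 2 * d * d ^+ 2 by rewrite mulr_ge0 ?sqr_ge0//; lra.
by rewrite addr_ge0// addr_ge0.
Qed.

(** The rate at which [cpoisson] decays: not integrable, but its square is, by [decay_sqr]. *)
Definition decay t : R := (1 + `|t|)^-1.

Lemma decay_ge0 t : 0 <= decay t.
Proof. by rewrite invr_ge0 addr_ge0. Qed.

Lemma decay_sqr t : decay t ^+ 2 <= pi * poisson 1 t.
Proof.
rewrite /decay !poissonE mulVKf ?pi_neq0// exprVn mul1r expr1n lef_pV2 ?posrE.
- by rewrite sqrrD real_normK ?num_real//; have := normr_ge0 t; lra.
- by rewrite exprn_gt0// ltr_pwDl.
- by rewrite ltr_wpDl ?sqr_ge0.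
Qed.

Lemma cpoisson_le d x t : 0 < d -> `|x| <= 1 ->
  `|cpoisson d (x - t)| <= pi^-1 * (1 + d^-1) * decay t.
Proof.
move=> d0 x1; rewrite !cpoissonE normrM ger0_norm ?invr_ge0 ?pi_ge0//.
rewrite -mulrA ler_wpM2l ?invr_ge0 ?pi_ge0//.
have h1 := poisson_den (x - t) d0; have t0 : 0 < 1 + `|t| by rewrite ltr_pwDl.
rewrite normrM normfV (ger0_norm (ltW h1)) ler_pdivrMr// mulrAC ler_pdivlMr//.
rewrite -(real_normK (num_real (x - t))).
have tu : `|t| <= `|x - t| + 1.
  by have := ler_normB x (x - t); rewrite subKr; lra.
have := normr_ge0 (x - t); move: `|x - t| tu => u tu u0.
apply: (@le_trans _ _ (u * (2 + u))); first by rewrite ler_wpM2l//; lra.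
rewrite -subr_ge0 (_ : _ - _ = d ^+ 2 + (u - d) ^+ 2 / d); last by field; exact: lt0r_neq0.
by rewrite addr_ge0 ?divr_ge0 ?sqr_ge0// ltW.
Qed.

End poisson_kernels.

(** * Lebesgue points and boundary limits of Poisson integrals *)

Section lebesgue_points.
Context {R : realType}.
Local Notation mu := (@lebesgue_measure R).
Implicit Types (G f g h : R -> R) (d e r t u x y : R).

(** The natural condition for Poisson integrals on the line to exist. Traces are obtained in this
    weighted class rather than as integrable functions on the line. *)
Definition weighted_ig G : Prop :=
  measurable_fun setT G /\ ig (fun x => G x * poisson 1 x).

Lemma measurable_poisson d : 0 < d -> measurable_fun setT (@poisson R d).
Proof. by move=> d0; apply: continuous_measurable_fun; exact: continuous_poisson. Qed.

Lemma measurable_poisson_shift d t : 0 < d ->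
  measurable_fun setT (fun x => poisson d (x - t)).
Proof.
move=> d0; apply: continuous_measurable_fun; apply: continuous_shift.
exact: continuous_poisson.
Qed.

Lemma poisson1_le1 x : poisson 1 x <= 1.
Proof.
rewrite poissonE; have h := poisson_den x (@ltr01 R).
rewrite mulrA ler_pdivrMr// mul1r mulr1 expr1n.
apply: (@le_trans _ _ 1); last by rewrite lerDr sqr_ge0.
by rewrite invf_le1 ?pi_gt0// (le_trans _ (pi_ge2 R))// ler1n.
Qed.

Lemma ig_weighted G : ig G -> weighted_ig G.
Proof.
move=> iG; have mG := ig_measurable iG; split => //.
apply: (ig_le _ (ig_norm iG)).
  by apply: measurable_funM => //; exact: measurable_poisson.
move=> x; rewrite normrM (ger0_norm (poisson_ge0 _ _))// ler_piMr//.
exact: poisson1_le1.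
Qed.

Lemma ig_poisson1 : ig (@poisson R 1).
Proof.
have := @ig_poisson R 1 0 ltr01; congr ig.
by apply/funext => x; rewrite subr0.
Qed.

Lemma poisson1_ge (N : R) x : `|x| <= N -> 1 <= pi * (1 + N ^+ 2) * poisson 1 x.
Proof.
move=> xN; have h := poisson_den x (@ltr01 R).
rewrite poissonE (_ : _ * _ = (1 + N ^+ 2) / (x ^+ 2 + 1 ^+ 2)).
  rewrite ler_pdivlMr// mul1r expr1n addrC lerD2l -real_normK ?num_real//.
  by rewrite lerXn2r ?nnegrE// (le_trans _ xN).
move/lt0r_neq0 : h; move: (pi : R) (@pi_neq0 R) => P P0 h; field.
by rewrite expr1n in h; rewrite h P0.
Qed.

Lemma weighted_ig_restrict h (A : set R) (N : R) : measurable A ->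
  (forall x, A x -> `|x| <= N) -> measurable_fun setT h ->
  ig (fun x => h x * poisson 1 x) -> ig (h \_ A).
Proof.
move=> mA AN mh ih.
apply: (ig_le _ (igZ (pi * (1 + N ^+ 2)) (ig_norm ih))).
  by apply/(measurable_restrictT _ _).1 => //; exact: measurable_funTS.
move=> x; rewrite patchE; case: ifPn => [|_].
  rewrite inE => /AN/poisson1_ge xN; rewrite normrM mulrCA (ger0_norm (poisson_ge0 _ _))//.
  by rewrite -[leLHS]mulr1 ler_wpM2l.
by rewrite normr0 mulr_ge0// mulr_ge0 ?pi_ge0// addr_ge0// sqr_ge0.
Qed.

Lemma weighted_normB G t : weighted_ig G ->
  ig (fun x => `|G x - G t| * poisson 1 x).
Proof.
move=> [mG iG]; apply: (@ig_le _ _ (fun x => `|G x * poisson 1 x| + `|G t| * poisson 1 x)).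
- apply: measurable_funM; last exact: measurable_poisson.
  by apply: measurableT_comp => //; exact: measurable_funB.
- apply: igD; first exact: ig_norm.
  exact/igZ/ig_poisson1.
- move=> x; have p0 := poisson_ge0 x (@ltr01 R).
  rewrite (normrM `|G x - G t|) (normrM (G x)) normr_id (ger0_norm p0) -mulrDl ler_wpM2r//.
  exact: ler_normB.
Qed.

Lemma weighted_ig_locally G : weighted_ig G -> locally_integrable setT G.
Proof.
move=> [mG iG]; split => //; first exact: openT.
move=> K _ cK.
have /compact_bounded[M [_ MK]] := cK.
have mK : measurable K by exact: compact_measurable.
have iK : ig (G \_ K).
  apply: (@weighted_ig_restrict _ _ (`|M| + 1)) => // x Kx; apply: MK => //.
  by rewrite (le_lt_trans (ler_norm _))// ltrDl.
move/integrableP : iK => [_]; apply: le_lt_trans.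
rewrite integral_mkcond le_eqVlt; apply/orP; left; apply/eqP.
apply: eq_integral => x _; rewrite /= !patchE.
by case: ifPn => // _; rewrite normr0.
Qed.

(** A Lebesgue point, with the vanishing of averages written as an integral of size o(r), the form
    that sums over dyadic balls. *)
Definition leb_pt G t : Prop := forall eps : R, 0 < eps ->
  exists2 r0 : R, 0 < r0 & forall r, 0 < r <= r0 ->
    J ((fun x => `|G x - G t|) \_ (ball t r)) <= eps * r.

Lemma ae_leb_pt G : weighted_ig G -> {ae mu, forall t, leb_pt G t}.
Proof.
move=> wG; have lG := weighted_ig_locally wG.
have := lebesgue_differentiation lG => hae.
apply: ae_sub hae _ => t; rewrite /lebesgue_pt => /fine_cvgP[fin].
move=> /cvgrPdist_le cv eps eps0.
(* Half of [eps], because the ball of radius r has measure 2 r. *)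
have e2 : 0 < eps / 2 by rewrite divr_gt0.
have [r0 /= r00 cvr] := cv _ e2.
exists (r0 / 2); first by rewrite divr_gt0.
move=> r /andP[rp rr0]; pose h : R -> R := fun x => `|G x - G t|.
have ih : ig (h \_ (ball t r)).
  apply: (@weighted_ig_restrict _ _ (`|t| + r)) => //.
  - exact: measurable_ball.
  - move=> x; rewrite /ball/= => tx; have := ler_normB t (t - x); rewrite subKr.
    by move=> /le_trans; apply; rewrite lerD2l ltW.
  - by apply: measurableT_comp => //; apply: measurable_funB => //; case: wG.
  - exact: weighted_normB.
have : `|0 - fine (davg G t r)| <= eps / 2.
  apply: cvr => //=; rewrite sub0r normrN gtr0_norm//.
  by rewrite (le_lt_trans rr0)// ltr_pdivrMr// ltr_pMr// ltr1n.
rewrite sub0r normrN /davg /iavg.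
rewrite (_ : integral _ _ _ = (J (h \_ (ball t r)))%:E); last first.
  rewrite EFin_J//.
  rewrite [LHS]integral_mkcond; apply: eq_integral => x _; rewrite /= !patchE.
  by case: ifPn => // _.
have mb : mu (ball t r) = (r *+ 2)%:E by rewrite lebesgue_measure_ball// ltW.
rewrite mb inver gt_eqF ?mulrn_wgt0//.
have J0 : 0 <= J (h \_ (ball t r)) by apply: J_ge0 => x; rewrite patchE; case: ifP => // _; exact: normr_ge0.
rewrite -EFinM/= ger0_norm; last by rewrite mulr_ge0// invr_ge0 mulrn_wge0 ?ltW.
rewrite ler_pdivrMl ?mulrn_wgt0// => /le_trans; apply.
by rewrite le_eqVlt; apply/orP; left; apply/eqP; rewrite -mulr_natr; field.
Qed.

Lemma ig_patch f (A : set R) : measurable A -> ig f -> ig (f \_ A).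
Proof.
move=> mA hf; apply: (ig_le _ (ig_norm hf)).
  by apply/(measurable_restrictT _ _).1 => //; apply: measurable_funTS; exact: ig_measurable.
by move=> x; rewrite patchE; case: ifP => // _; rewrite normr0.
Qed.

Lemma weighted_ig_poisson h d t : 0 < d -> measurable_fun setT h ->
  (forall x, 0 <= h x) -> ig (fun x => h x * poisson 1 x) ->
  ig (fun x => h x * poisson d (x - t)).
Proof.
move=> d0 mh h0 ih.
apply: (ig_le _ (igZ ((1 + 2 * t ^+ 2) / d + 2 * d) ih)).
  by apply: measurable_funM => //; exact: measurable_poisson_shift.
move=> x; rewrite ger0_norm; last by rewrite mulr_ge0 ?poisson_ge0.
rewrite [leRHS]mulrCA ler_wpM2l//.
exact: poisson_le.
Qed.

(** Induction over dyadic balls. On the annulus between radii 2^n d and 2^(n+1) d the kernel is at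
    most 1 / (pi 4^n d), which contributes 2 eps / (pi 2^n); the central ball contributes eps / pi,
    and the geometric sum is 5 - 4 / 2^n. *)
Lemma leb_near h t (eps r0 : R) d n : 0 < d -> 0 <= eps -> measurable_fun setT h ->
  (forall x, 0 <= h x) -> ig (fun x => h x * poisson 1 x) ->
  (forall r, 0 < r <= r0 -> J (h \_ (ball t r)) <= eps * r) ->
  2 ^+ n * d <= r0 ->
  J ((fun x => h x * poisson d (x - t)) \_ (ball t (2 ^+ n * d))) <=
    eps * (pi^-1 * (5 - 4 / 2 ^+ n)).
Proof.
move=> d0 eps0 mh h0 ih hr0.
have pi0 : 0 < pi^-1 :> R by rewrite invr_gt0 pi_gt0.
have ihp := weighted_ig_poisson t d0 mh h0 ih.
have ihr r : ig (h \_ (ball t r)).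
  apply: (@weighted_ig_restrict _ _ (`|t| + r)) => //.
  - exact: measurable_ball.
  - move=> x; rewrite /ball/= => tx; have := ler_normB t (t - x); rewrite subKr.
    by move=> /le_trans; apply; rewrite lerD2l ltW.
have pM (c r : R) : 0 <= c -> 0 < r <= r0 -> J (fun x => c * (h \_ (ball t r)) x) <= c * (eps * r).
  by move=> c0 rr; rewrite JZ// ler_wpM2l// hr0.
elim: n => [|n IH] nr0.
  rewrite expr0 mul1r in nr0 *.
  apply: le_trans (_ : _ <= J (fun x => (pi^-1 / d) * (h \_ (ball t d)) x)) _.
    apply: J_le.
    - by apply: ig_patch => //; exact: measurable_ball.
    - exact: igZ.
    - move=> x; rewrite !patchE; case: ifP => _; last by rewrite mulr0.
      rewrite [leRHS]mulrC ler_wpM2l// poissonE ler_wpM2l ?(ltW pi0)//.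
      rewrite ler_pdivrMr ?poisson_den// mulrC ler_pdivlMr// -expr2.
      by rewrite lerDr sqr_ge0.
  apply: le_trans (pM _ _ _ _) _.
  - by rewrite divr_ge0 ?ltW.
  - by rewrite d0.
  - rewrite le_eqVlt; apply/orP; left; apply/eqP; rewrite invr1.
    by move: (pi^-1 : R) => P; field; exact: lt0r_neq0.
have N0 : 0 < 2 ^+ n :> R by rewrite exprn_gt0.
have D0 : 0 < 2 ^+ n * d by rewrite mulr_gt0.
have nr0' : 2 ^+ n * d <= r0.
  rewrite (le_trans _ nr0)// ler_wpM2r//; first exact: ltW.
  by rewrite exprS ler_peMl ?ler1n// ltW.
apply: le_trans (_ : _ <= J (fun x =>
   ((fun x => h x * poisson d (x - t)) \_ (ball t (2 ^+ n * d))) x +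
   (pi^-1 * (d / (2 ^+ n * d) ^+ 2)) * (h \_ (ball t (2 ^+ n.+1 * d))) x)) _.
  apply: J_le.
  - by apply: ig_patch => //; exact: measurable_ball.
  - by apply: igD; [apply: ig_patch => //; exact: measurable_ball|exact: igZ].
  - move=> x; rewrite !patchE; case: ifPn => [xB|xB]; last first.
      by rewrite mulr0 addr0; case: ifP => // _; rewrite mulr_ge0// poisson_ge0.
    case: ifPn => [_|xN].
      rewrite lerDl mulr_ge0// mulr_ge0 ?(ltW pi0)// divr_ge0 ?sqr_ge0//.
      exact: ltW.
    rewrite add0r [leRHS]mulrC ler_wpM2l// poissonE ler_wpM2l ?(ltW pi0)//.
    rewrite ler_wpM2l ?(ltW d0)// lef_pV2 ?posrE ?poisson_den ?exprn_gt0//.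
    move: xN; rewrite notin_setE /ball/= => /negP; rewrite -leNgt distrC => xN.
    rewrite -[in leRHS](real_normK (num_real (x - t))).
    by rewrite (@le_trans _ _ (`|x - t| ^+ 2)) ?lerDl ?sqr_ge0// lerXn2r// nnegrE ltW.
rewrite JD; last 2 first.
- by apply: ig_patch => //; exact: measurable_ball.
- exact: igZ.
apply: le_trans (lerD (IH nr0') (pM _ _ _ _)) _.
- by rewrite mulr_ge0 ?(ltW pi0)// divr_ge0 ?sqr_ge0// ltW.
- by rewrite nr0 mulr_gt0// exprn_gt0.
rewrite le_eqVlt; apply/orP; left; apply/eqP; rewrite (exprS (2 : R) n).
move: (2 ^+ n) (pi^-1 : R) N0 => N P /lt0r_neq0 N0; field.
by rewrite N0 (lt0r_neq0 d0).
Qed.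

Lemma dyadic_scale d (r0 : R) : 0 < d <= r0 ->
  exists n, 2 ^+ n * d <= r0 < 2 ^+ n.+1 * d.
Proof.
move=> /andP[d0 dr0].
have ex : exists n, r0 < 2 ^+ n * d.
  exists (Num.truncn (r0 / d)).+1; rewrite -ltr_pdivrMr//.
  apply: lt_le_trans (truncnS_gt _) _.
  by rewrite -natrX ler_nat ltnW// ltn_expl.
have [[|n] hn mn] := ex_minnP ex.
  by move: hn; rewrite expr0 mul1r ltNge dr0.
exists n; rewrite hn andbT leNgt; apply/negP => /mn.
by rewrite ltnn.
Qed.

(** Away from t the kernel is at most [d] times a fixed multiple of the weight, so the far part of a
    Poisson integral vanishes with [d]. *)
Lemma poisson_far d t x (a : R) : 0 < d -> 0 < a -> a <= `|x - t| ->
  poisson d (x - t) <= d * (((1 + 2 * t ^+ 2) / a ^+ 2 + 2) * poisson 1 x).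
Proof.
move=> d0 a0 ax; set u := x - t; have u0 : 0 < u ^+ 2.
  by rewrite -real_normK ?num_real// exprn_gt0// (lt_le_trans a0).
rewrite !poissonE [leRHS]mulrA [leRHS]mulrCA ler_wpM2l ?invr_ge0 ?pi_ge0//.
rewrite expr1n div1r -mulrA ler_wpM2l ?(ltW d0)//.
apply: (@le_trans _ _ (u ^+ 2)^-1).
  by rewrite lef_pV2 ?posrE ?poisson_den// lerDl sqr_ge0.
rewrite ler_pdivlMr; last by rewrite ltr_wpDl ?sqr_ge0.
rewrite ler_pdivrMl// mulrDr (mulrC (u ^+ 2) 2).
have : 1 + 2 * t ^+ 2 <= u ^+ 2 * ((1 + 2 * t ^+ 2) / a ^+ 2).
  rewrite mulrA ler_pdivlMr ?exprn_gt0// mulrC ler_wpM2r//.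
    by have := sqr_ge0 t; lra.
  by rewrite -[leRHS]real_normK ?num_real// lerXn2r// nnegrE ltW.
move=> hh; apply: le_trans (lerD hh (lexx _)); rewrite /u -subr_ge0.
rewrite (_ : _ - _ = (x - 2 * t) ^+ 2); first exact: sqr_ge0.
ring.
Qed.

(** Split at a dyadic ball around t whose radius lies between r0 / 2 and r0: [leb_near] bounds the
    inside, [poisson_far] the outside. *)
Lemma leb_cvg h t : measurable_fun setT h ->
  (forall x, 0 <= h x) -> ig (fun x => h x * poisson 1 x) ->
  (forall eps : R, 0 < eps -> exists2 r0 : R, 0 < r0 &
     forall r, 0 < r <= r0 -> J (h \_ (ball t r)) <= eps * r) ->
  J (fun x => h x * poisson d (x - t)) @[d --> 0^'+] --> 0.
Proof.
move=> mh h0 ih leb; apply/cvgrPdist_le => e e0.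
(* The near part is at most 5 / pi times this, and 5 / pi is below 4 because pi >= 2. *)
have e8 : 0 < e / 8 by rewrite divr_gt0.
have [r0 r00 hr0] := leb _ e8.
pose C := (1 + 2 * t ^+ 2) / (r0 / 2) ^+ 2 + 2.
pose M := J (fun x => h x * poisson 1 x).
have M0 : 0 <= M by apply: J_ge0 => x; rewrite mulr_ge0// poisson_ge0.
have C0 : 0 <= C.
  by rewrite addr_ge0// divr_ge0 ?sqr_ge0// addr_ge0// mulr_ge0// sqr_ge0.
have K0 : 0 < C * M + 1 by rewrite ltr_wpDl// mulr_ge0.
near=> d.
have d0 : 0 < d by [].
have dr0 : d <= r0 by near: d; exact: nbhs_right_le.
have dCM : d * (C * M) <= e / 2.
  have : d <= e / 2 / (C * M + 1).
    by near: d; apply: nbhs_right_le; rewrite !divr_gt0.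
  rewrite ler_pdivlMr// => /(le_trans _); apply.
  by rewrite ler_wpM2l ?(ltW d0)// lerDl.
have [n /andP[n1 n2]] := @dyadic_scale d r0 (introT andP (conj d0 dr0)).
have ihp := weighted_ig_poisson t d0 mh h0 ih.
have mB : measurable (ball t (2 ^+ n * d)) by exact: measurable_ball.
rewrite sub0r normrN ger0_norm; last by apply: J_ge0 => x; rewrite mulr_ge0// poisson_ge0.
apply: (@le_trans _ _ (J (fun x =>
   ((fun x => h x * poisson d (x - t)) \_ (ball t (2 ^+ n * d))) x +
   d * C * (h x * poisson 1 x)))).
  apply: J_le => //.
    by apply: igD; [exact: ig_patch|exact: igZ].
  move=> x; rewrite patchE; case: ifPn => xB.
    by rewrite lerDl mulr_ge0 ?mulr_ge0 ?poisson_ge0// ltW.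
  rewrite add0r mulrCA ler_wpM2l// -mulrA; apply: poisson_far => //.
    by rewrite divr_gt0.
  move: xB; rewrite notin_setE /ball/= => /negP; rewrite -leNgt distrC.
  apply: le_trans; rewrite ler_pdivrMr// mulrC mulrA -exprS.
  exact: ltW.
rewrite JD; [|exact: ig_patch|exact: igZ].
rewrite JZ// -/M (splitr e) lerD//; last by rewrite -mulrA.
apply: le_trans (leb_near d0 (ltW e8) mh h0 ih hr0 n1) _.
have P0 := @pi_gt0 R.
rewrite (_ : e / 2 = e / 8 * 4); last by field.
rewrite ler_wpM2l ?(ltW e8)// mulrC ler_pdivrMr//.
apply: (@le_trans _ _ 5); first by rewrite lerBlDr lerDl divr_ge0// exprn_ge0.
by have := @pi_ge2 R; lra.
Unshelve. all: end_near. Qed.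

Lemma leb_pt_cvg G t : weighted_ig G -> leb_pt G t ->
  J (fun x => `|G x - G t| * poisson d (x - t)) @[d --> 0^'+] --> 0.
Proof.
move=> wG lG; apply: leb_cvg => //.
- by apply: measurableT_comp => //; apply: measurable_funB => //; case: wG.
- exact: weighted_normB.
Qed.

Lemma weighted_ig_kernel G d t (k : R -> R) : 0 < d -> weighted_ig G ->
  measurable_fun setT k -> (forall x, `|k x| <= poisson d (x - t)) ->
  ig (fun x => G x * k x).
Proof.
move=> d0 [mG iG] mk kp.
apply: (ig_le _ (igZ ((1 + 2 * t ^+ 2) / d + 2 * d) (ig_norm iG))).
  exact: measurable_funM.
move=> x; rewrite normrM (normrM (G x)) (ger0_norm (poisson_ge0 _ _))// mulrCA.
by rewrite ler_wpM2l// (le_trans (kp x))// poisson_le.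
Qed.

Lemma poisson_cvg G t : weighted_ig G -> leb_pt G t ->
  J (fun x => G x * poisson d (x - t)) @[d --> 0^'+] --> G t.
Proof.
move=> wG lG; have cv := leb_pt_cvg wG lG.
apply/cvgrPdist_le => e e0; move/cvgrPdist_le : cv => /(_ _ e0) cv.
near=> d; have d0 : 0 < d by [].
have : `|0 - J (fun x => `|G x - G t| * poisson d (x - t))| <= e by near: d.
have ip : ig (fun x => poisson d (x - t)) by exact: ig_poisson.
rewrite sub0r normrN; apply: le_trans; rewrite distrC.
rewrite [in X in X <= _](_ : _ - _ = J (fun x => (G x - G t) * poisson d (x - t))).
  apply: le_trans (ler_norm _); apply: J_normle.
  - rewrite (_ : (fun x => _) = fun x => G x * poisson d (x - t) - G t * poisson d (x - t)); last first.
      by apply/funext => x; rewrite mulrBl.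
    apply: igB; last exact: igZ.
    apply: (weighted_ig_kernel d0 wG (t := t)); first exact: measurable_poisson_shift.
    by move=> x; rewrite ger0_norm// poisson_ge0.
  - apply: weighted_ig_poisson => //; last exact: weighted_normB.
    by apply: measurableT_comp => //; apply: measurable_funB => //; case: wG.
  - by move=> x; rewrite normrM (ger0_norm (poisson_ge0 _ _)).
rewrite -[X in _ - X]mulr1 -(J_poisson t d0) -JZ// -JB; last exact: igZ.
  by congr J; apply/funext => x; rewrite mulrBl.
apply: (weighted_ig_kernel d0 wG (t := t)); first exact: measurable_poisson_shift.
by move=> x; rewrite ger0_norm// poisson_ge0.
Unshelve. all: end_near. Qed.

Lemma J_odd (k : R -> R) t : ig k -> (forall x, k (2 * t - x) = - k x) -> J k = 0.
Proof.
move=> ik kN; have [_] := J_reflect t ik.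
rewrite (_ : (fun x => k _) = fun x => - k x); last exact/funext.
by rewrite JN// => h; lra.
Qed.

(** An odd kernel integrates to 0, so the constant [G t] may be subtracted from G; the Lebesgue
    point condition then suffices. *)
Lemma odd_kernel_cvg G t (k : R -> R -> R) : weighted_ig G -> leb_pt G t ->
  (forall d, 0 < d -> measurable_fun setT (k d)) ->
  (forall d u, 0 < d -> `|k d u| <= poisson d u) ->
  (forall d u, k d (- u) = - k d u) ->
  J (fun x => G x * k d (x - t)) @[d --> 0^'+] --> 0.
Proof.
move=> wG lG mk kp kN; have cv := leb_pt_cvg wG lG.
apply/cvgrPdist_le => e e0; move/cvgrPdist_le : cv => /(_ _ e0) cv.
near=> d; have d0 : 0 < d by [].
have : `|0 - J (fun x => `|G x - G t| * poisson d (x - t))| <= e by near: d.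
have mkt : measurable_fun setT (fun x => k d (x - t)).
  by apply: (measurableT_comp (mk _ d0)); exact: measurable_funB.
have ik : ig (fun x => k d (x - t)).
  by apply: (ig_le mkt (ig_poisson t d0)) => x; exact: kp.
have iGk : ig (fun x => G x * k d (x - t)).
  by apply: (weighted_ig_kernel d0 wG mkt (t := t)) => x; exact: kp.
rewrite !sub0r !normrN; apply: le_trans.
rewrite (_ : J (fun x => G x * _) = J (fun x => (G x - G t) * k d (x - t))).
  apply: le_trans (ler_norm _); apply: J_normle.
  - rewrite (_ : (fun x => _) = fun x => G x * k d (x - t) - G t * k d (x - t)); last first.
      by apply/funext => x; rewrite mulrBl.
    by apply: igB => //; exact: igZ.
  - apply: weighted_ig_poisson => //; last exact: weighted_normB.
    by apply: measurableT_comp => //; apply: measurable_funB => //; case: wG.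
  - by move=> x; rewrite normrM ler_wpM2l// kp.
have Jk : J (fun x => k d (x - t)) = 0.
  by apply: (@J_odd _ t) => // x; rewrite -kN; congr k; lra.
rewrite -[LHS]subr0 -(mulr0 (G t)) -Jk -JZ// -JB//; last exact: igZ.
by congr J; apply/funext => x; rewrite mulrBl.
Unshelve. all: end_near. Qed.

End lebesgue_points.

(** * Poisson integrals of bounded functions and the energy identity *)

Section smooth_transforms.
Context {R : realType}.
Local Notation mu := (@lebesgue_measure R).
Implicit Types (f g h : R -> R) (d e r s t u x y z : R) (K : R -> R -> R).

(** Bound and vanishing are required at every point, not almost everywhere; [bdd_representative]
    supplies such functions. *)
Definition bdd_supp f : Prop := [/\ measurable_fun setT f,
  (exists M, forall x, `|f x| <= M) & forall x, 1 <= `|x| -> f x = 0].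

Definition poisson_int d f t : R := J (fun x => f x * poisson d (x - t)).
Definition cpoisson_int d f t : R := J (fun x => f x * cpoisson d (x - t)).

Lemma measurable_cpoisson d : 0 < d -> measurable_fun setT (@cpoisson R d).
Proof. by move=> d0; apply: continuous_measurable_fun; exact: continuous_cpoisson. Qed.

Lemma J_poisson1 : J (@poisson R 1) = 1.
Proof.
have := J_poisson 0 (@ltr01 R); congr (J _ = 1).
by apply/funext => x; rewrite subr0.
Qed.

Lemma bdd_supp_le f : bdd_supp f ->
  exists2 C : R, 0 <= C & forall x, `|f x| <= C * poisson 1 x.
Proof.
move=> [_ [M fM] f0]; exists (`|M| * (pi * (1 + 1 ^+ 2))).
  by rewrite mulr_ge0// mulr_ge0 ?pi_ge0// addr_ge0// sqr_ge0.
move=> x; have [x1|x1] := leP 1 `|x|.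
  rewrite f0// normr0; apply: mulr_ge0; last exact: poisson_ge0.
  by rewrite mulr_ge0// mulr_ge0 ?pi_ge0// addr_ge0// sqr_ge0.
rewrite -mulrA (le_trans (fM x))// (le_trans (ler_norm _))//.
by rewrite ler_peMr// poisson1_ge// ltW.
Qed.

Lemma bdd_supp_igM f g (C : R) : bdd_supp f -> measurable_fun setT g ->
  (forall x, `|x| < 1 -> `|g x| <= C) -> ig (fun x => f x * g x).
Proof.
move=> bf mg gC; have [mf [M fM] f0] := bf.
have [B B0 fB] := bdd_supp_le bf.
apply: (ig_le _ (igZ (`|C| * B) ig_poisson1)); first exact: measurable_funM.
move=> x; have [x1|x1] := leP 1 `|x|.
  by rewrite f0// mul0r normr0 mulr_ge0 ?poisson_ge0// mulr_ge0.
rewrite normrM mulrC -mulrA ler_pM//.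
by rewrite (le_trans (gC x x1))// ler_norm.
Qed.

Lemma bdd_supp_ig f : bdd_supp f -> ig f.
Proof.
move=> bf; rewrite (_ : f = fun x => f x * 1); last by apply/funext => x; rewrite mulr1.
by apply: (@bdd_supp_igM f (fun=> 1) 1 bf) => // x _; rewrite normr1.
Qed.

(** The bound is asked for |x| <= 1 only, since x is always integrated against a function supported
    there. *)
Definition decaying_kernel K : Prop :=
  measurable_fun setT (fun z : R * R => K z.1 z.2) /\
  exists C : R, forall x t, `|x| <= 1 -> `|K x t| <= C * decay t.

Definition decaying g : Prop :=
  measurable_fun setT g /\ exists C : R, forall t, `|g t| <= C * decay t.

Lemma decay_mul (a b C B t : R) : `|a| <= C * decay t -> `|b| <= B * decay t ->
  `|a * b| <= `|C| * `|B| * pi * poisson 1 t.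
Proof.
move=> aC bB; rewrite normrM.
apply: (@le_trans _ _ ((`|C| * decay t) * (`|B| * decay t))).
  apply: ler_pM => //; [apply: le_trans aC _|apply: le_trans bB _];
  by rewrite ler_wpM2r ?decay_ge0 ?ler_norm.
rewrite mulrACA -[leRHS]mulrA ler_wpM2l ?mulr_ge0// -expr2; exact: decay_sqr.
Qed.

Lemma decaying_igM g h : decaying g -> decaying h -> ig (fun t => g t * h t).
Proof.
move=> [mg [C gC]] [mh [B hB]].
apply: (ig_le _ (igZ (`|C| * `|B| * pi) ig_poisson1)); first exact: measurable_funM.
move=> t; exact: decay_mul.
Qed.

Lemma decaying_section K x : `|x| <= 1 -> decaying_kernel K -> decaying (K x).
Proof.
move=> x1 [mK [C KC]]; split; last by exists C => t; exact: KC.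
exact: (measurableT_comp mK (pair1_measurable x)).
Qed.

Lemma measurable_decay : measurable_fun setT (@decay R).
Proof.
apply: continuous_measurable_fun => t; apply: cvgV.
  by rewrite gt_eqF// ltr_pwDl.
by apply: cvgD; [exact: cvg_cst|exact: norm_continuous].
Qed.

Lemma decaying_int_ig K f t : bdd_supp f -> decaying_kernel K ->
  ig (fun x => f x * K x t).
Proof.
move=> bf [mK [C KC]]; apply: (bdd_supp_igM (C := C * decay t) bf).
  exact: (measurableT_comp mK (pair2_measurable t)).
by move=> x x1; apply: KC; exact: ltW.
Qed.

(** A product of two decaying factors is dominated by [poisson 1 t], so the double integrand lies
    under [|f x|] times an integrable function of t. *)
Lemma decaying_Fubini K f : bdd_supp f -> decaying_kernel K ->
  decaying (fun t => J (fun x => f x * K x t)) /\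
  forall g, decaying g ->
    [/\ ig (fun x => f x * J (fun t => K x t * g t)) &
        J (fun t => J (fun x => f x * K x t) * g t) =
        J (fun x => f x * J (fun t => K x t * g t))].
Proof.
move=> bf dK; have [mK [C KC]] := dK; have [mf [M fM] f0] := bf.
have M0 : 0 <= M by apply: le_trans (fM 0).
have ia : ig (fun x => `|f x|) by exact: ig_norm (bdd_supp_ig bf).
have main g : decaying g ->
    [/\ measurable_fun setT (fun x => f x * J (fun t => K x t * g t)),
        measurable_fun setT (fun t => J (fun x => f x * K x t) * g t) &
        J (fun t => J (fun x => f x * K x t) * g t) =
        J (fun x => f x * J (fun t => K x t * g t))].
  move=> dg; have [mg [B gB]] := dg.
  have mF : measurable_fun setT (fun z : R * R => f z.1 * (K z.1 z.2 * g z.2)).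
    apply: measurable_funM; first exact: (measurableT_comp mf measurable_fst).
    apply: measurable_funM => //; exact: (measurableT_comp mg measurable_snd).
  have FB x t : `|f x * (K x t * g t)| <= `|f x| * (`|C| * `|B| * pi * poisson 1 t).
    rewrite normrM; have [x1|x1] := leP 1 `|x|; first by rewrite f0// normr0 !mul0r.
    by rewrite ler_wpM2l// decay_mul// KC// ltW.
  have [m1 m2 E] := Fubini_J mF ia (igZ (`|C| * `|B| * pi) ig_poisson1) FB.
  have E1 x : J (fun t => f x * (K x t * g t)) = f x * J (fun t => K x t * g t).
    have [x1|x1] := leP 1 `|x|.
      by rewrite f0// mul0r -[RHS]J0; congr J; apply/funext => t; rewrite mul0r.
    by rewrite (JZ (f x) (decaying_igM (decaying_section (ltW x1) dK) dg)).
  have E2 t : J (fun x => f x * (K x t * g t)) = J (fun x => f x * K x t) * g t.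
    rewrite mulrC -JZ; last exact: decaying_int_ig.
    by congr J; apply/funext => x; rewrite mulrA mulrC.
  split.
  - by move: m1; under eq_fun do rewrite E1.
  - by move: m2; under eq_fun do rewrite E2.
  - by move: E; under [X in J X = _ -> _]eq_fun do rewrite E1; under [X in _ = J X -> _]eq_fun do rewrite E2.
split.
  have dd : decaying (@decay R).
    by split; [exact: measurable_decay|exists 1 => t; rewrite mul1r ger0_norm ?decay_ge0].
  split.
    (* Measurability of the transform is the case [g = decay] of [main], divided by the positive
       function [decay]. *)
    have [_ m2 _] := main _ dd.
    rewrite (_ : (fun t => _) = fun t => (J (fun x => f x * K x t) * decay t) * (1 + `|t|)).
      apply: measurable_funM => //; apply: measurable_funD => //; exact: measurableT_comp.
    apply/funext => t; rewrite /decay mulfVK// gt_eqF// ltr_pwDl//.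
  exists (`|C| * J (fun x => `|f x|)) => t.
  rewrite mulrAC -JZ//; apply: J_normle; [exact: decaying_int_ig|exact: igZ|].
  move=> x; rewrite normrM; have [x1|x1] := leP 1 `|x|.
    by rewrite f0// normr0 mul0r mulr0.
  rewrite mulrC ler_wpM2r//; apply: le_trans (KC x t (ltW x1)) _.
  by rewrite ler_wpM2r ?decay_ge0 ?ler_norm.
move=> g dg; have [m1 _ E] := main _ dg; split => //.
have [mg [B gB]] := dg.
apply: (ig_le m1 (igZ (`|C| * `|B| * pi) ia)) => x.
rewrite normrM; have [x1|x1] := leP 1 `|x|; first by rewrite f0// normr0 mul0r mulr0.
rewrite mulrC ler_wpM2r//.
have iKg : ig (fun t => K x t * g t).
  by apply: decaying_igM => //; apply: decaying_section => //; exact: ltW.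
apply: le_trans (J_normle iKg (igZ (`|C| * `|B| * pi) ig_poisson1) _) _.
  by move=> t; rewrite decay_mul// KC// ltW.
rewrite JZ; last exact: ig_poisson1.
by rewrite J_poisson1 mulr1.
Qed.

Lemma poisson1_decay t : poisson 1 t <= decay t.
Proof.
rewrite poissonE /decay expr1n.
have t0 : 0 < 1 + `|t| by rewrite ltr_pwDl.
have t1 : 0 < t ^+ 2 + 1 by rewrite ltr_wpDl// sqr_ge0.
rewrite mul1r -invfM lef_pV2 ?posrE ?mulr_gt0 ?pi_gt0//.
apply: (@le_trans _ _ (2 * (t ^+ 2 + 1))); last by rewrite ler_wpM2r ?(ltW t1)// pi_ge2.
have := sqr_ge0 t; have := sqr_ge0 (`|t| - 1); rewrite sqrrB real_normK ?num_real//; lra.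
Qed.

Lemma decaying_poisson d s : 0 < d -> decaying (fun t => poisson d (t - s)).
Proof.
move=> d0; split; first exact: measurable_poisson_shift.
exists ((1 + 2 * s ^+ 2) / d + 2 * d) => t.
rewrite ger0_norm ?poisson_ge0//; apply: le_trans (poisson_le _ _ d0) _.
rewrite ler_wpM2l ?poisson1_decay//; apply: addr_ge0.
  by apply: divr_ge0; [have := sqr_ge0 s; lra|exact: ltW].
by apply: mulr_ge0 => //; exact: ltW.
Qed.

Lemma decaying_poisson_kernel d : 0 < d -> decaying_kernel (fun x t => poisson d (x - t)).
Proof.
move=> d0; split.
  apply: (measurableT_comp (measurable_poisson d0)).
  by apply: measurable_funB; [exact: measurable_fst|exact: measurable_snd].
exists ((1 + 2 * 1 ^+ 2) / d + 2 * d) => x t x1; rewrite ger0_norm ?poisson_ge0//.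
rewrite poisson_sub; apply: le_trans (poisson_le _ _ d0) _.
have B0 s : 0 <= (1 + 2 * s ^+ 2) / d + 2 * d.
  apply: addr_ge0; last by apply: mulr_ge0 => //; exact: ltW.
  by apply: divr_ge0; [have := sqr_ge0 s; lra|exact: ltW].
apply: ler_pM => //.
- exact: poisson_ge0.
- rewrite lerD2r ler_wpM2r ?invr_ge0 ?(ltW d0)// lerD2l ler_wpM2l//.
  by rewrite -[leLHS]real_normK ?num_real// lerXn2r// nnegrE.
- exact: poisson1_decay.
Qed.

Lemma decaying_cpoisson_kernel d : 0 < d -> decaying_kernel (fun x t => cpoisson d (x - t)).
Proof.
move=> d0; split.
  apply: (measurableT_comp (measurable_cpoisson d0)).
  by apply: measurable_funB; [exact: measurable_fst|exact: measurable_snd].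
by exists (pi^-1 * (1 + d^-1)) => x t x1; exact: cpoisson_le.
Qed.

Lemma decaying_poisson_int d f : 0 < d -> bdd_supp f -> decaying (poisson_int d f).
Proof. by move=> d0 bf; have [] := decaying_Fubini bf (decaying_poisson_kernel d0). Qed.

Lemma decaying_cpoisson_int d f : 0 < d -> bdd_supp f -> decaying (cpoisson_int d f).
Proof. by move=> d0 bf; have [] := decaying_Fubini bf (decaying_cpoisson_kernel d0). Qed.

(** Fubini is applied twice. The inner integrals are controlled for |y| < 1 only, which explains the
    disjunction; elsewhere [f y = 0]. *)
Lemma decaying_energy K L f g : bdd_supp f -> bdd_supp g ->
  decaying_kernel K -> decaying_kernel L ->
  (forall y, ig (fun z => g z * J (fun t => K y t * L z t)) \/ 1 <= `|y|) /\
  ig (fun y => f y * J (fun z => g z * J (fun t => K y t * L z t))) /\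
  J (fun t => J (fun x => f x * K x t) * J (fun x => g x * L x t)) =
  J (fun y => f y * J (fun z => g z * J (fun t => K y t * L z t))).
Proof.
move=> bf bg dK dL.
have [dg Lg] := decaying_Fubini bg dL; have [_ Kf] := decaying_Fubini bf dK.
have [iK ->] := Kf _ dg.
have E : (fun x => f x * J (fun t => K x t * J (fun x => g x * L x t))) =
   (fun y => f y * J (fun z => g z * J (fun t => K y t * L z t))).
  apply/funext => y; have [y1|y1] := leP 1 `|y|; first by case: bf => _ _ ->//; rewrite !mul0r.
  have [_ EL] := Lg _ (decaying_section (ltW y1) dK).
  congr (_ * _); transitivity (J (fun t => J (fun x => g x * L x t) * K y t)).
    by congr J; apply/funext => t; rewrite mulrC.
  rewrite EL; congr J; apply/funext => z; congr (_ * J _).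
  by apply/funext => t; rewrite mulrC.
rewrite -E; split => // y; have [y1|y1] := leP 1 `|y|; [by right|left].
have [iL _] := Lg _ (decaying_section (ltW y1) dK).
move: iL; congr ig; apply/funext => z; congr (_ * J _).
by apply/funext => t; rewrite mulrC.
Qed.

(** [J_energy] placed under the double integral against f(y) f(z); the oddness signs of the two
    conjugate kernels cancel in their product. *)
Lemma J_energy_int d e f : 0 < d -> 0 < e -> bdd_supp f ->
  J (fun t => poisson_int d f t * poisson_int e f t) +
  J (fun t => cpoisson_int d f t * cpoisson_int e f t) =
  2 * J (fun x => f x * poisson_int (d + e) f x).
Proof.
move=> d0 e0 bf.
have [Y1 [I1 ->]] := decaying_energy bf bf (decaying_poisson_kernel d0) (decaying_poisson_kernel e0).
have [Y2 [I2 ->]] := decaying_energy bf bf (decaying_cpoisson_kernel d0) (decaying_cpoisson_kernel e0).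
have de0 : 0 < d + e by rewrite addr_gt0.
rewrite -JD// -JZ; last first.
  have [mP [C PC]] := decaying_poisson_int de0 bf.
  apply: (bdd_supp_igM (C := `|C|) bf mP) => x _; apply: le_trans (PC x) _.
  apply: (@le_trans _ _ (`|C| * decay x)); first by rewrite ler_wpM2r ?decay_ge0 ?ler_norm.
  by rewrite ler_piMr// /decay invf_le1 ?lerDl// ltr_pwDl.
congr J; apply/funext => y.
have [y1|y1] := leP 1 `|y|; first by case: bf => _ _ ->//; rewrite !mul0r mulr0 addr0.
rewrite -mulrDr mulrCA; congr (_ * _).
case: (Y1 y) => [Y1y|]; last by rewrite leNgt y1.
case: (Y2 y) => [Y2y|]; last by rewrite leNgt y1.
rewrite -JD// -JZ; last exact: decaying_int_ig bf (decaying_poisson_kernel de0).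
congr J; apply/funext => z.
have [z1|z1] := leP 1 `|z|; first by case: bf => _ _ ->//; rewrite !mul0r mulr0 addr0.
rewrite -mulrDr mulrCA; congr (_ * _).
rewrite -JD; last 2 first.
- exact: (decaying_igM (decaying_section (ltW y1) (decaying_poisson_kernel d0))
    (decaying_section (ltW z1) (decaying_poisson_kernel e0))).
- exact: (decaying_igM (decaying_section (ltW y1) (decaying_cpoisson_kernel d0))
    (decaying_section (ltW z1) (decaying_cpoisson_kernel e0))).
rewrite -(J_energy y z d0 e0); congr J; apply/funext => t.
by rewrite (poisson_sub d y) (poisson_sub e z) (cpoisson_sub d y) (cpoisson_sub e z) mulrNN.
Qed.

(** Expanding the squares, the right side is the sum of the squared distances of the Q's and of the
    P's; the latter is dropped as nonnegative. *)
Lemma J_energy_diff d e f : 0 < d -> 0 < e -> bdd_supp f ->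
  ig (fun t => (cpoisson_int d f t - cpoisson_int e f t) ^+ 2) /\
  J (fun t => (cpoisson_int d f t - cpoisson_int e f t) ^+ 2) <=
  2 * (J (fun x => f x * poisson_int (d + d) f x) +
       J (fun x => f x * poisson_int (e + e) f x) -
       2 * J (fun x => f x * poisson_int (d + e) f x)).
Proof.
move=> d0 e0 bf.
have Dd := decaying_cpoisson_int d0 bf; have De := decaying_cpoisson_int e0 bf.
have Pd := decaying_poisson_int d0 bf; have Pe := decaying_poisson_int e0 bf.
have key A B : decaying A -> decaying B -> ig (fun t => (A t - B t) ^+ 2) /\
   J (fun t => (A t - B t) ^+ 2) = J (fun t => A t * A t) + J (fun t => B t * B t)
     - 2 * J (fun t => A t * B t).
  move=> dA dB; have -> : (fun t => (A t - B t) ^+ 2) =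
     (fun t => (A t * A t + B t * B t) - 2 * (A t * B t)) by apply/funext => t; ring.
  have i1 := decaying_igM dA dA; have i2 := decaying_igM dB dB.
  have i3 := igZ 2 (decaying_igM dA dB).
  split; first by apply: igB => //; exact: igD.
  rewrite JB//; last exact: igD.
  by rewrite JD// JZ//; exact: decaying_igM.
have [i1 E1] := key _ _ Dd De; have [i2 E2] := key _ _ Pd Pe.
split => //.
have := J_energy_int d0 d0 bf; have := J_energy_int e0 e0 bf.
have := J_energy_int d0 e0 bf.
have : 0 <= J (fun t => (poisson_int d f t - poisson_int e f t) ^+ 2).
  by apply: J_ge0 => t; exact: sqr_ge0.
rewrite E1 E2.
move: (J _) (J _) (J _) (J _) (J _) (J _) (J _) (J _) (J _) => *; lra.
Qed.

(** [J_cross] under the integral. It will identify Q_e f with the Poisson integral of a limit of the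
    functions Q_d f. *)
Lemma cpoisson_int_semigroup d e f s : 0 < d -> 0 < e -> d != e -> bdd_supp f ->
  J (fun t => cpoisson_int d f t * poisson e (t - s)) = cpoisson_int (d + e) f s.
Proof.
move=> d0 e0 de bf.
have [_ Kf] := decaying_Fubini bf (decaying_cpoisson_kernel d0).
have dp := decaying_poisson s e0.
have [_ ->] := Kf _ dp; congr J; apply/funext => x.
have [x1|x1] := leP 1 `|x|; first by case: bf => _ _ ->//; rewrite !mul0r.
congr (_ * _).
have := J_cross x s d0 e0 de; rewrite cpoisson_sub => /(congr1 -%R); rewrite opprK => <-.
have := decaying_igM (decaying_section (ltW x1) (decaying_cpoisson_kernel d0)) dp => iq.
rewrite [in RHS](_ : (fun _ => _) = fun t => - (cpoisson d (x - t) * poisson e (t - s))).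
  by rewrite JN// opprK.
by apply/funext => t; rewrite cpoisson_sub mulNr.
Qed.

End smooth_transforms.

(** * Almost everywhere limits of conjugate Poisson integrals along a sequence *)

Section traces.
Context {R : realType}.
Local Notation mu := (@lebesgue_measure R).
Implicit Types (f g h G H : R -> R) (d e r s t u x y z : R).

Lemma poisson_int_le d f (M : R) t : 0 < d -> measurable_fun setT f -> (forall x, `|f x| <= M) ->
  `|poisson_int d f t| <= M.
Proof.
move=> d0 mf fM.
have ip := ig_poisson t d0.
have iM : ig (fun x => M * poisson d (x - t)) by exact: igZ.
have fp x : `|f x * poisson d (x - t)| <= M * poisson d (x - t).
  by rewrite normrM (ger0_norm (poisson_ge0 _ _))// ler_wpM2r// poisson_ge0.
rewrite -[leRHS]mulr1 -(J_poisson t d0) -JZ//; apply: J_normle => //.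
apply: (ig_le _ iM) => //; apply: measurable_funM => //.
exact: measurable_poisson_shift.
Qed.

Lemma ae_poisson_int_cvg f : bdd_supp f ->
  {ae mu, forall t, poisson_int d f t @[d --> 0^'+] --> f t}.
Proof.
move=> bf; have wf := ig_weighted (bdd_supp_ig bf).
by apply: ae_sub (ae_leb_pt wf) _ => t; exact: poisson_cvg.
Qed.

Lemma energy_cvg f : bdd_supp f ->
  J (fun x => f x * poisson_int s f x) @[s --> 0^'+] --> J (fun x => f x * f x).
Proof.
move=> bf; have [mf [M fM] f0] := bf.
apply/cvg_at_rightP => u [u0 cu].
have M0 : 0 <= M by apply: le_trans (fM 0).
have [_] : ig (fun x => f x * f x) /\
    J (fun x => f x * poisson_int (u n) f x) @[n --> \oo] --> J (fun x => f x * f x).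
  apply: (J_dominated (g := fun x => M * `|f x|)).
  - move=> n; apply: measurable_funM => //.
    by have [] := decaying_poisson_int (u0 n) bf.
  - exact: measurable_funM.
  - by apply/igZ/ig_norm/bdd_supp_ig.
  - apply: ae_sub (ae_poisson_int_cvg bf) _ => x cx.
    apply: cvgM; first exact: cvg_cst.
    by move/cvg_at_rightP : cx; apply.
  - by move=> n x; rewrite normrM mulrC ler_wpM2r// poisson_int_le.
exact.
Qed.

(** The range reaches 2 d_n because the energy estimate for d_n and d_(n+1) involves the parameters
    d_n + d_n, d_n + d_(n+1) and d_(n+1) + d_(n+1). An accuracy 4^-n in energy becomes 2^-n in
    weighted L^1. *)
Definition good_seq f (d : nat -> R) : Prop :=
  forall n s, 0 < s <= 2 * d n ->
    `|J (fun x => f x * poisson_int s f x) - J (fun x => f x * f x)| <= (4 ^+ n)^-1.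

(** One sequence serves two functions, because duality needs both limits along the same
    parameters. *)
Lemma exists_good_seq f h : bdd_supp f -> bdd_supp h ->
  exists d : nat -> R, [/\ forall n, 0 < d n, forall n, d n.+1 <= d n,
    d n @[n --> \oo] --> 0, good_seq f d & good_seq h d].
Proof.
move=> bf bh.
have step k : bdd_supp k -> forall n : nat, exists s0 : R, 0 < s0 /\ forall s, 0 < s <= s0 ->
    `|J (fun x => k x * poisson_int s k x) - J (fun x => k x * k x)| <= (4 ^+ n)^-1.
  move=> bk n; have := energy_cvg bk => /cvgrPdist_le /(_ (4 ^+ n)^-1).
  rewrite invr_gt0 exprn_gt0// => /(_ erefl)[r /= r0 H].
  exists (r / 2); split; first by rewrite divr_gt0.
  move=> s /andP[s0 sr]; rewrite distrC; apply: H => //=.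
  by rewrite sub0r normrN gtr0_norm// (le_lt_trans sr)// ltr_pdivrMr// ltr_pMr// ltr1n.
have [sf Hf] := choice (step _ bf); have [sh Hh] := choice (step _ bh).
(* The minimum with the previous term gives monotonicity, the one with 1 / (n + 1) the limit 0, and
   the halved thresholds make 2 d_n admissible. *)
pose d := fix d (n : nat) : R := if n is m.+1 then
   Num.min (d m) (Num.min (n.+1%:R^-1) (Num.min (sf n / 2) (sh n / 2)))
  else Num.min 1 (Num.min (sf 0%N / 2) (sh 0%N / 2)).
have d0 n : 0 < d n.
  elim: n => [|n IH] /=; rewrite !lt_min ?IH ?ltr01 ?invr_gt0 ?ltr0n/=.
    by apply/andP; split; apply: divr_gt0 => //; [have [] := Hf 0%N|have [] := Hh 0%N].
  by apply/andP; split; apply: divr_gt0 => //; [have [] := Hf n.+1|have [] := Hh n.+1].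
have dS n : d n.+1 <= d n by rewrite /= ge_min lexx.
have df n : 2 * d n <= sf n.
  by rewrite mulrC -ler_pdivlMr//; case: n => [|n] /=; rewrite !ge_min lexx !orbT.
have dh n : 2 * d n <= sh n.
  by rewrite mulrC -ler_pdivlMr//; case: n => [|n] /=; rewrite !ge_min lexx !orbT.
exists d; split => //.
- apply: (@squeeze_cvgr _ _ _ _ (fun=> 0) (fun n => n.+1%:R^-1)); last 2 first.
  + exact: cvg_cst.
  + exact: cvg_harmonic.
  apply: nearW => -[|n]; rewrite (ltW (d0 _))/=.
    by rewrite ge_min invr1 lexx.
  by rewrite !ge_min lexx !orbT.
- move=> n s /andP[s0 sd]; apply: (Hf n).2; rewrite s0/=.
  exact: le_trans sd _.
- move=> n s /andP[s0 sd]; apply: (Hh n).2; rewrite s0/=.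
  exact: le_trans sd _.
Qed.

Lemma good_seq_diff f (d : nat -> R) : bdd_supp f -> (forall n, 0 < d n) ->
  (forall n, d n.+1 <= d n) -> good_seq f d -> forall n,
  ig (fun t => `|cpoisson_int (d n) f t - cpoisson_int (d n.+1) f t| * poisson 1 t) /\
  J (fun t => `|cpoisson_int (d n) f t - cpoisson_int (d n.+1) f t| * poisson 1 t)
    <= 5 * (2 ^+ n)^-1.
Proof.
move=> bf d0 dS gd n.
have [i1 E1] := J_energy_diff (d0 n) (d0 n.+1) bf.
pose u t := cpoisson_int (d n) f t - cpoisson_int (d n.+1) f t.
have mu_ : measurable_fun setT u.
  by apply: measurable_funB; [have [] := decaying_cpoisson_int (d0 n) bf|
                              have [] := decaying_cpoisson_int (d0 n.+1) bf].
have N0 : 0 < 2 ^+ n :> R by rewrite exprn_gt0.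
have i2 : ig (fun t => 2 ^+ n / 2 * u t ^+ 2 + (2 ^+ n)^-1 / 2 * poisson 1 t).
  by apply: igD; apply: igZ => //; exact: ig_poisson1.
(* The arithmetic-geometric mean inequality weighted by 2^n, together with p^2 <= p for p =
   [poisson 1 t]. *)
have le t : `|u t| * poisson 1 t <= 2 ^+ n / 2 * u t ^+ 2 + (2 ^+ n)^-1 / 2 * poisson 1 t.
  rewrite -(real_normK (num_real (u t))); have p0 := poisson_ge0 t (@ltr01 R).
  have p1 := poisson1_le1 t; move: `|u t| (poisson 1 t) (2 ^+ n) p0 p1 N0 => a p N p0 p1 N0.
  apply: (@le_trans _ _ (N / 2 * a ^+ 2 + N^-1 / 2 * p ^+ 2)).
    rewrite -subr_ge0 (_ : _ - _ = N / 2 * (a - N^-1 * p) ^+ 2); last by field; exact: lt0r_neq0.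
    by rewrite mulr_ge0 ?sqr_ge0// divr_ge0// ltW.
  by rewrite lerD2l ler_wpM2l ?divr_ge0 ?invr_ge0 ?(ltW N0)// expr2 ler_piMl.
have i3 : ig (fun t => `|u t| * poisson 1 t).
  apply: (ig_le _ i2).
    apply: measurable_funM; first exact: measurableT_comp.
    exact: measurable_poisson.
  by move=> t; rewrite ger0_norm// mulr_ge0// poisson_ge0.
split => //; apply: le_trans (J_le i3 i2 le) _.
rewrite JD; [|exact: igZ|by apply: igZ; exact: ig_poisson1].
rewrite !JZ//; last exact: ig_poisson1.
rewrite J_poisson1 mulr1.
(* The factor 8 is twice the total weight 1 + 1 + 2 of the three energies, each within 4^-n of the
   limit. Then 2^n / 2 * 8 / 4^n + 2^-n / 2 is at most 5 / 2^n. *)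
have EN : J (fun t => u t ^+ 2) <= 8 * (4 ^+ n)^-1.
  have dn := d0 n; have dn1 := d0 n.+1; have dSn := dS n.
  apply: le_trans E1 _.
  have := gd n (d n + d n); have := gd n (d n.+1 + d n.+1); have := gd n (d n + d n.+1).
  rewrite !addr_gt0//=.
  have b1 : d n + d n.+1 <= 2 * d n by lra.
  have b2 : d n.+1 + d n.+1 <= 2 * d n by lra.
  have b3 : d n + d n <= 2 * d n by lra.
  move=> /(_ b1) + /(_ b2) + /(_ b3).
  move: (J (fun x => f x * poisson_int (d n + d n) f x))
    (J (fun x => f x * poisson_int (d n.+1 + d n.+1) f x))
    (J (fun x => f x * poisson_int (d n + d n.+1) f x))
    (J (fun x => f x * f x)) ((4 ^+ n)^-1) => a b c l q.
  by rewrite !ler_norml => /andP[h1 h2] /andP[h3 h4] /andP[h5 h6]; lra.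
rewrite (_ : 4 ^+ n = 2 ^+ n * 2 ^+ n) in EN; last by rewrite -exprMn -natrM.
move: (J (fun t => u t ^+ 2)) (2 ^+ n) N0 EN => E N N0 EN.
apply: (@le_trans _ _ (N / 2 * (8 * (N * N)^-1) + N^-1 / 2)).
  by rewrite lerD2r ler_wpM2l// divr_ge0// ltW.
rewrite (_ : _ + _ = (4 + 2^-1) * N^-1); last by field; exact: lt0r_neq0.
rewrite ler_wpM2r ?invr_ge0 ?(ltW N0)//; lra.
Qed.

Definition is_trace f G : Prop := weighted_ig G /\
  {ae mu, forall t, cpoisson_int d f t @[d --> 0^'+] --> G t}.

Lemma series_norm_cvg (q : nat -> R) (l : R) :
  (\sum_(k < n) `|q k - q k.+1|) @[n --> \oo] --> l -> cvgn q.
Proof.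
move=> cl.
have : cvgn [normed series (telescope q)].
  apply/cvg_ex; exists l; move: cl; apply: cvg_trans; apply: near_eq_cvg.
  near=> n.
  rewrite /normed_series_of /series /= big_mkord.
  by apply: eq_bigr => k _; rewrite /telescope/= distrC.
move=> /normed_cvg; rewrite telescopeK => /cvg_ex[/= m cm].
have cq : (q n - q 0%N) + q 0%N @[n --> \oo] --> m + q 0%N.
  by apply: cvgD => //; exact: cvg_cst.
apply/cvg_ex; exists (m + q 0%N); move: cq; apply: cvg_trans; apply: near_eq_cvg.
by near=> n; rewrite subrK.
Unshelve. all: end_near. Qed.

(** Monotone convergence for the first term plus the sum of the absolute differences: the finite
    limit [h] dominates the whole sequence and forces it to converge absolutely as a telescoping
    series. *)
Lemma good_seq_limit f (d : nat -> R) : bdd_supp f -> (forall n, 0 < d n) ->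
  (forall n, d n.+1 <= d n) -> good_seq f d ->
  exists G h, [/\ weighted_ig G, ig h,
    {ae mu, forall t, cpoisson_int (d n) f t @[n --> \oo] --> G t} &
    {ae mu, forall t, forall n, `|cpoisson_int (d n) f t| * poisson 1 t <= h t}].
Proof.
move=> bf d0 dS gd; pose Q n := cpoisson_int (d n) f.
have mQ n : measurable_fun setT (Q n) by have [] := decaying_cpoisson_int (d0 n) bf.
have iQ0 : ig (fun t => `|Q 0%N t| * poisson 1 t).
  have wQ : ig (fun t => Q 0%N t * poisson 1 t).
    apply: decaying_igM; first exact: decaying_cpoisson_int.
    split; first exact: measurable_poisson.
    by exists 1 => t; rewrite mul1r ger0_norm ?poisson_ge0// poisson1_decay.
  apply: (ig_le _ (ig_norm wQ)).
    by apply: measurable_funM; [exact: measurableT_comp|exact: measurable_poisson].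
  by move=> t; rewrite normrM normr_id normrM.
have gD := good_seq_diff bf d0 dS gd.
pose u n t := `|Q 0%N t| * poisson 1 t + \sum_(k < n) `|Q k t - Q k.+1 t| * poisson 1 t.
have iu n : ig (u n) /\ J (u n) <= J (fun t => `|Q 0%N t| * poisson 1 t) + 10 * (1 - (2 ^+ n)^-1).
  elim: n => [|n [IH1 IH2]].
    rewrite /u expr0 invr1 subrr mulr0 addr0.
    rewrite (_ : (fun t => _ + _) = fun t => `|Q 0%N t| * poisson 1 t); first by split.
    by apply/funext => t; rewrite big_ord0 addr0.
  have [i1 J1] := gD n.
  have uS : u n.+1 = fun t => u n t + `|Q n t - Q n.+1 t| * poisson 1 t.
    by apply/funext => t; rewrite /u big_ord_recr/= addrA.
  rewrite uS; split; first exact: igD.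
  rewrite JD//; apply: le_trans (lerD IH2 J1) _.
  rewrite -addrA lerD2l exprS.
  have : 0 < 2 ^+ n :> R by rewrite exprn_gt0.
  move: (2 ^+ n) => N N0; rewrite le_eqVlt; apply/orP; left; apply/eqP; field.
  exact: lt0r_neq0.
have p0 t : 0 <= poisson 1 t by exact: poisson_ge0.
have [n|n t|t|n|h ih ch] := @Beppo_Levi _ u (J (fun t => `|Q 0%N t| * poisson 1 t) + 10).
- by have [] := iu n.
- by rewrite addr_ge0 ?mulr_ge0//; apply: sumr_ge0 => k _; rewrite mulr_ge0.
- apply/nondecreasing_seqP => n; rewrite /u big_ord_recr/= addrA lerDl.
  by rewrite mulr_ge0.
- have [_ /le_trans] := iu n; apply; rewrite lerD2l -[leRHS]mulr1 ler_wpM2l//.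
have domi : {ae mu, forall t, forall n, `|Q n t| * poisson 1 t <= h t}.
  apply: ae_sub ch _ => t ct n.
  have un : `|Q n t| * poisson 1 t <= u n t.
    elim: n => [|n IH]; first by rewrite /u big_ord0 addr0.
    rewrite /u big_ord_recr/= addrA -/(u n t); apply: le_trans (lerD IH (lexx _)).
    rewrite -mulrDl ler_wpM2r// -[X in `|X| <= _](subKr (Q n t)).
    exact: ler_normB.
  apply: le_trans un _; rewrite -(cvg_lim _ ct)//.
  apply: nondecreasing_cvgn_le; last by apply/cvg_ex; exists (h t).
  by apply/nondecreasing_seqP => m; rewrite /u big_ord_recr/= addrA lerDl mulr_ge0.
have cQ : {ae mu, forall t, cvgn (Q^~ t)}.
  apply: ae_sub ch _ => t ct; have pt := poisson_gt0 t (@ltr01 R).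
  apply: (@series_norm_cvg _ ((h t - `|Q 0%N t| * poisson 1 t) / poisson 1 t)).
  rewrite (_ : (fun n => _) = fun n => (u n t - `|Q 0%N t| * poisson 1 t) / poisson 1 t).
    by apply: cvgM; [apply: cvgB => //; exact: cvg_cst|exact: cvg_cst].
  apply/funext => n; rewrite /u addrC addKr -mulr_suml mulfK//.
  exact: lt0r_neq0.
(* The upper limit is defined at every point and measurable, and agrees with the limit where that
   exists. *)
pose G t := fine (limn_esup (fun n => (Q n t)%:E)).
have mG : measurable_fun setT G.
  apply: measurableT_comp => //; apply: measurable_fun_limn_esup => n.
  exact/measurable_EFinP.
have cG : {ae mu, forall t, Q n t @[n --> \oo] --> G t}.
  apply: ae_sub cQ _ => t /cvg_ex[/= l cl].
  have cE : (Q n t)%:E @[n --> \oo] --> l%:E by apply: cvg_EFin => //; exact: nearW.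
  by rewrite /G (cvg_limn_einf_sup cE).2.
exists G, h; split => //; split => //.
have mp := measurable_poisson (@ltr01 R).
have [] // := @J_dominated_ae _ (fun n t => Q n t * poisson 1 t) (fun t => G t * poisson 1 t) h.
- by move=> n; exact: measurable_funM.
- exact: measurable_funM.
- by apply: ae_sub cG _ => t ct; apply: cvgM => //; exact: cvg_cst.
- by apply: ae_sub domi _ => t dt n; rewrite normrM (ger0_norm (p0 t)).
Qed.

End traces.

(** * Traces as full limits, their duality, and truncated Hilbert integrals *)

Section hilbert_traces.
Context {R : realType}.
Local Notation mu := (@lebesgue_measure R).
Implicit Types (f g h F G H : R -> R) (d e r s t u x y z : R).

Lemma cpoisson_bound d u : 0 < d -> `|cpoisson d u| <= d^-1.
Proof.
move=> d0; rewrite cpoissonE normrM ger0_norm ?invr_ge0 ?pi_ge0//.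
have h := poisson_den u d0.
rewrite normrM normfV (ger0_norm (ltW h)) mulrA ler_pdivrMr// ler_pdivlMl//.
rewrite mulrCA ler_pdivrMl ?pi_gt0//.
apply: (@le_trans _ _ (2 * (u ^+ 2 + d ^+ 2))); last first.
  by rewrite ler_wpM2r ?(ltW h)// pi_ge2.
rewrite -(real_normK (num_real u)).
have := sqr_ge0 (`|u| - d); have := sqr_ge0 d; have := sqr_ge0 `|u|.
rewrite sqrrB; lra.
Qed.

Lemma ig_bounded_kernel F (k : R -> R) (C : R) t : ig F -> measurable_fun setT k ->
  (forall u, `|k u| <= C) -> ig (fun x => F x * k (x - t)).
Proof.
move=> iF mk kC; apply: (ig_le _ (igZ C (ig_norm iF))).
  apply: measurable_funM; first exact: ig_measurable.
  by apply: (measurableT_comp mk); exact: measurable_funB.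
by move=> x; rewrite normrM mulrC ler_wpM2r.
Qed.

Lemma cpoisson_int_continuous f e s (u : nat -> R) : bdd_supp f -> 0 < e ->
  (forall n, 0 < u n) -> u n @[n --> \oo] --> 0 ->
  cpoisson_int (u n + e) f s @[n --> \oo] --> cpoisson_int e f s.
Proof.
move=> bf e0 u0 cu; have iF := bdd_supp_ig bf.
have ue n : 0 < u n + e by rewrite addr_gt0.
have mk n : measurable_fun setT (fun x => f x * cpoisson (u n + e) (x - s)).
  apply: ig_measurable; apply: (ig_bounded_kernel _ iF) => //; first exact: measurable_cpoisson.
  by move=> v; exact: cpoisson_bound.
have [|||||_ //] := @J_dominated _ (fun n x => f x * cpoisson (u n + e) (x - s))
    (fun x => f x * cpoisson e (x - s)) (fun x => e^-1 * `|f x|).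
- exact: mk.
- apply: ig_measurable; apply: (ig_bounded_kernel _ iF) => //; first exact: measurable_cpoisson.
  by move=> v; exact: cpoisson_bound.
- by apply: igZ; exact: ig_norm.
- apply: aeW => x; apply: cvgM; first exact: cvg_cst.
  under eq_fun do rewrite cpoissonE; rewrite cpoissonE.
  apply: cvgM; first exact: cvg_cst.
  apply: cvgM; first exact: cvg_cst.
  apply: cvgV; first exact: poisson_den_neq0.
  apply: cvgD; first exact: cvg_cst.
  have ce : u n + e @[n --> \oo] --> e.
    by rewrite -[X in _ --> X]add0r; apply: cvgD => //; exact: cvg_cst.
  under eq_fun do rewrite expr2; rewrite expr2; exact: cvgM.
- move=> n x; rewrite normrM mulrC ler_wpM2r//.
  apply: le_trans (cpoisson_bound _ (ue n)) _.
  by rewrite lef_pV2 ?posrE// lerDr ltW.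
Qed.

(** Letting n grow in the semigroup identity gives Q_e f = P_e G for every e > 0, and P_e G
    converges to G at Lebesgue points as e -> 0. *)
Lemma limit_is_trace f (d : nat -> R) G h : bdd_supp f -> (forall n, 0 < d n) ->
  d n @[n --> \oo] --> 0 -> weighted_ig G -> ig h ->
  {ae mu, forall t, cpoisson_int (d n) f t @[n --> \oo] --> G t} ->
  {ae mu, forall t, forall n, `|cpoisson_int (d n) f t| * poisson 1 t <= h t} ->
  is_trace f G.
Proof.
move=> bf d0 cd wG ih cG domi; split => //.
have E e s : 0 < e -> cpoisson_int e f s = J (fun t => G t * poisson e (t - s)).
  move=> e0; pose C := (1 + 2 * s ^+ 2) / e + 2 * e.
  have C0 : 0 <= C.
    apply: addr_ge0; last by apply: mulr_ge0 => //; exact: ltW.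
    by apply: divr_ge0; [have := sqr_ge0 s; lra|exact: ltW].
  have mp := measurable_poisson_shift s e0.
  have [|||||_ cv] := @J_dominated_ae _ (fun n t => cpoisson_int (d n) f t * poisson e (t - s))
    (fun t => G t * poisson e (t - s)) (fun t => C * h t).
  - by move=> n; apply: measurable_funM => //; have [] := decaying_cpoisson_int (d0 n) bf.
  - by apply: measurable_funM => //; case: wG.
  - exact: igZ.
  - by apply: ae_sub cG _ => t ct; apply: cvgM => //; exact: cvg_cst.
  - apply: ae_sub domi _ => t dt n.
    rewrite normrM (ger0_norm (poisson_ge0 _ e0)).
    apply: le_trans (ler_wpM2l C0 (dt n)); rewrite mulrCA ler_wpM2l//.
    exact: poisson_le.
  have cv2 := cpoisson_int_continuous (s := s) bf e0 d0 cd.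
  apply: (cvg_unique _ cv2) => //; move: cv; apply: cvg_trans; apply: near_eq_cvg.
  near=> n; rewrite cpoisson_int_semigroup//.
  (* The semigroup identity needs d_n != e, which holds for large n as d_n tends to 0. *)
  rewrite lt_eqF//; near: n.
  by move/cvgrPdist_lt : cd => /(_ _ e0); apply: filterS => n; rewrite sub0r normrN gtr0_norm.
apply: ae_sub (ae_leb_pt wG) _ => t /(poisson_cvg wG).
apply: cvg_trans; apply: near_eq_cvg; near=> e; rewrite E//.
Unshelve. all: end_near. Qed.

Lemma exists_trace f : bdd_supp f -> exists G, is_trace f G.
Proof.
move=> bf; have [d [d0 dS cd gd _]] := exists_good_seq bf bf.
have [G [h [wG ih cG domi]]] := good_seq_limit bf d0 dS gd.
by exists G; exact: limit_is_trace cG domi.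
Qed.

Lemma trace_ae_eq f G H : is_trace f G -> is_trace f H ->
  {ae mu, forall t, G t = H t}.
Proof.
move=> [_ cG] [_ cH]; apply: ae_sub (ae_and cG cH) _ => t [ct dt].
exact: (cvg_unique _ ct dt).
Qed.

Lemma weighted_ig_bdd_supp G h : weighted_ig G -> bdd_supp h -> ig (fun x => G x * h x).
Proof.
move=> [mG iG] bh; have [C C0 hC] := bdd_supp_le bh; have [mh _ _] := bh.
apply: (ig_le _ (igZ C (ig_norm iG))); first exact: measurable_funM.
move=> x; rewrite normrM normrM (ger0_norm (poisson_ge0 _ _))// mulrCA.
by rewrite ler_wpM2l.
Qed.

Lemma cpoisson_int_dual d f h : 0 < d -> bdd_supp f -> bdd_supp h ->
  J (fun t => cpoisson_int d f t * h t) = - J (fun x => f x * cpoisson_int d h x).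
Proof.
move=> d0 bf bh; have [mh [M hM] h0] := bh.
have [_ Kf] := decaying_Fubini bf (decaying_cpoisson_kernel d0).
have dh : decaying h.
  split => //; have [C C0 hC] := bdd_supp_le bh.
  by exists C => t; apply: le_trans (hC t) _; rewrite ler_wpM2l// poisson1_decay.
have [i1 ->] := Kf _ dh.
have E x : f x * J (fun t => cpoisson d (x - t) * h t) = - (f x * cpoisson_int d h x).
  rewrite /cpoisson_int -mulrN; congr (_ * _); rewrite -JN.
    by congr J; apply/funext => t; rewrite cpoisson_sub mulrC mulrN.
  apply: (ig_bounded_kernel (C := d^-1)); first exact: bdd_supp_ig.
    exact: measurable_cpoisson.
  by move=> u; exact: cpoisson_bound.
rewrite -JN; last first.
  have := igN i1; congr ig; apply/funext => x; by rewrite E opprK.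
by congr J; apply/funext => x; rewrite E.
Qed.

(** For each d this is Fubini and the oddness of the kernel ([cpoisson_int_dual]). Dominated
    convergence along a common good sequence passes to the limit, and traces are unique almost
    everywhere. *)
Lemma trace_dual f h G H : bdd_supp f -> bdd_supp h -> is_trace f G -> is_trace h H ->
  J (fun t => G t * h t) = - J (fun x => f x * H x).
Proof.
move=> bf bh tG tH.
have [d [d0 dS cd gf gh]] := exists_good_seq bf bh.
have [G' [k [wG' ik cG' domG]]] := good_seq_limit bf d0 dS gf.
have [H' [l [wH' il cH' domH]]] := good_seq_limit bh d0 dS gh.
have tG' := limit_is_trace bf d0 cd wG' ik cG' domG.
have tH' := limit_is_trace bh d0 cd wH' il cH' domH.
have main a A b q : bdd_supp a -> bdd_supp b -> weighted_ig A -> ig q ->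
    {ae mu, forall t, cpoisson_int (d n) a t @[n --> \oo] --> A t} ->
    {ae mu, forall t, forall n, `|cpoisson_int (d n) a t| * poisson 1 t <= q t} ->
    J (fun t => cpoisson_int (d n) a t * b t) @[n --> \oo] --> J (fun t => A t * b t).
  move=> ba bb wA iq cA dA; have [C C0 bC] := bdd_supp_le bb; have [mb _ _] := bb.
  have [|||||_ //] := @J_dominated_ae _ (fun n t => cpoisson_int (d n) a t * b t)
    (fun t => A t * b t) (fun t => C * q t).
  - by move=> n; apply: measurable_funM => //; have [] := decaying_cpoisson_int (d0 n) ba.
  - by apply: measurable_funM => //; case: wA.
  - exact: igZ.
  - by apply: ae_sub cA _ => t ct; apply: cvgM => //; exact: cvg_cst.
  - apply: ae_sub dA _ => t dt n; rewrite normrM.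
    by apply: le_trans (ler_wpM2l C0 (dt n)); rewrite mulrCA ler_wpM2l.
have cG := main _ _ _ _ bf bh wG' ik cG' domG.
have cH := main _ _ _ _ bh bf wH' il cH' domH.
have cG2 : J (fun t => cpoisson_int (d n) f t * h t) @[n --> \oo] --> - J (fun t => H' t * f t).
  have cN : - J (fun t => cpoisson_int (d n) h t * f t) @[n --> \oo] --> - J (fun t => H' t * f t).
    exact: cvgN.
  move: cN; apply: cvg_trans; apply: near_eq_cvg; near=> n.
  rewrite [RHS]cpoisson_int_dual//; congr (- J _).
  by apply/funext => t; rewrite mulrC.
have E : J (fun t => G' t * h t) = - J (fun t => H' t * f t).
  exact: (cvg_unique (@Rhausdorff R) cG cG2).
have JG : J (fun t => G t * h t) = J (fun t => G' t * h t).
  apply: J_ae.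
  - by apply: ig_measurable; apply: weighted_ig_bdd_supp => //; case: tG.
  - by apply: ig_measurable; apply: weighted_ig_bdd_supp => //; case: tG'.
  - by apply: ae_sub (trace_ae_eq tG tG') _ => t ->.
have JH : J (fun t => f t * H t) = J (fun t => H' t * f t).
  rewrite (_ : (fun t => f t * H t) = fun t => H t * f t); last by apply/funext => t; rewrite mulrC.
  apply: J_ae.
  - by apply: ig_measurable; apply: weighted_ig_bdd_supp => //; case: tH.
  - by apply: ig_measurable; apply: weighted_ig_bdd_supp => //; case: tH'.
  - by apply: ae_sub (trace_ae_eq tH tH') _ => t ->.
by rewrite JG JH E.
Unshelve. all: end_near. Qed.

Definition trunc_kernel d u : R := if d < `|u| then pi^-1 / u else 0.

Lemma trunc_kernelN d u : trunc_kernel d (- u) = - trunc_kernel d u.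
Proof. by rewrite /trunc_kernel normrN; case: ifP => _; rewrite ?oppr0// invrN mulrN. Qed.

Lemma measurable_inv : measurable_fun setT (fun u : R => u^-1).
Proof.
rewrite (_ : setT = [set 0 : R] `|` ~` [set 0]); last by rewrite setUv.
have m0 : measurable [set (0 : R)] by exact: measurable_set1.
apply/(measurable_funU _ m0 (measurableC m0)); split; first exact: measurable_fun_set1.
apply: open_continuous_measurable_fun.
  by apply: closed_openC; exact/accessible_closed_set1/hausdorff_accessible/Rhausdorff.
by move=> u /set_mem u0; apply: inv_continuous; apply/eqP.
Qed.

Lemma measurable_trunc_kernel d : measurable_fun setT (trunc_kernel d).
Proof.
apply: measurable_fun_if => //.
- apply: measurable_fun_ltr => //; exact: measurableT_comp.
- apply: measurable_funTS; apply: measurable_funM => //; exact: measurable_inv.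
Qed.

Lemma trunc_kernel_bound d u : 0 < d -> `|trunc_kernel d u| <= d^-1.
Proof.
move=> d0; rewrite /trunc_kernel; case: ifPn => [du|_]; last by rewrite normr0 invr_ge0 ltW.
rewrite normrM (normfV u) (@ger0_norm _ pi^-1) ?invr_ge0 ?pi_ge0//.
have u0 : 0 < `|u| by apply: lt_trans du.
apply: (@le_trans _ _ (1 / `|u|)).
  rewrite ler_wpM2r ?invr_ge0// invf_le1 ?pi_gt0//; have := @pi_ge2 R; lra.
by rewrite div1r lef_pV2 ?posrE// ltW.
Qed.

(** For |u| > d the difference is d^2 / (pi u (u^2 + d^2)), for |u| <= d it is the conjugate kernel
    up to sign; each is at most the Poisson kernel, as [odd_kernel_cvg] demands. *)
Lemma trunc_kernel_near d u : 0 < d -> `|trunc_kernel d u - cpoisson d u| <= poisson d u.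
Proof.
move=> d0; rewrite /trunc_kernel poissonE cpoissonE; have h := poisson_den u d0.
case: ifPn => du.
  have u0 : 0 < `|u| by apply: lt_trans du.
  have un : u != 0 by rewrite -normr_gt0.
  rewrite -mulrBr normrM ger0_norm ?invr_ge0 ?pi_ge0// ler_wpM2l ?invr_ge0 ?pi_ge0//.
  rewrite (_ : u^-1 - _ = d ^+ 2 / (u * (u ^+ 2 + d ^+ 2))); last by field; rewrite un lt0r_neq0.
  rewrite normrM normfV (normrM u) (ger0_norm (sqr_ge0 d)) (ger0_norm (ltW h)) invfM mulrA.
  by rewrite ler_wpM2r ?invr_ge0 ?(ltW h)// ler_pdivrMr// expr2 ler_wpM2l// ltW.
rewrite sub0r normrN normrM ger0_norm ?invr_ge0 ?pi_ge0// ler_wpM2l ?invr_ge0 ?pi_ge0//.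
rewrite normrM normfV (ger0_norm (ltW h)) ler_wpM2r ?invr_ge0 ?(ltW h)//.
by rewrite leNgt.
Qed.

Lemma trunc_kernel_cvg F t (l : R) : ig F -> leb_pt F t ->
  J (fun x => F x * cpoisson d (x - t)) @[d --> 0^'+] --> l ->
  J (fun x => F x * trunc_kernel d (x - t)) @[d --> 0^'+] --> l.
Proof.
move=> iF lF cl.
have c0 : J (fun x => F x * (trunc_kernel d (x - t) - cpoisson d (x - t))) @[d --> 0^'+] --> 0.
  apply: (@odd_kernel_cvg _ F t (fun d u => trunc_kernel d u - cpoisson d u) (ig_weighted iF) lF).
  - by move=> d d0; apply: measurable_funB; [exact: measurable_trunc_kernel|exact: measurable_cpoisson].
  - by move=> d u d0; exact: trunc_kernel_near.
  - by move=> d u; rewrite trunc_kernelN cpoissonN; ring.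
have cD : J (fun x => F x * cpoisson d (x - t)) +
    J (fun x => F x * (trunc_kernel d (x - t) - cpoisson d (x - t))) @[d --> 0^'+] --> l.
  by rewrite -[X in _ --> X]addr0; exact: cvgD.
move: cD; apply: cvg_trans; apply: near_eq_cvg.
near=> d; have d0 : 0 < d by [].
have i1 : ig (fun x => F x * trunc_kernel d (x - t)).
  apply: (ig_bounded_kernel (C := d^-1)) => //; first exact: measurable_trunc_kernel.
  by move=> u; exact: trunc_kernel_bound.
have i2 : ig (fun x => F x * cpoisson d (x - t)).
  apply: (ig_bounded_kernel (C := d^-1)) => //; first exact: measurable_cpoisson.
  by move=> u; exact: cpoisson_bound.
rewrite [X in _ + J X](_ : _ = fun x => F x * trunc_kernel d (x - t) - F x * cpoisson d (x - t)).
  by rewrite JB// addrC subrK.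
by apply/funext => x; rewrite mulrBr.
Unshelve. all: end_near. Qed.

End hilbert_traces.

(** * The weight [w], its explicit transform, and transforms of its multiples *)

Section weight.
Context {R : realType}.
Local Notation mu := (@lebesgue_measure R).
Local Notation w := (@w R).
Implicit Types (x y t d e : R).

Lemma w_ge0 x : 0 <= w x.
Proof. exact: sqrtr_ge0. Qed.

Lemma w_sqr x : `|x| <= 1 -> w x ^+ 2 = 1 - x ^+ 2.
Proof.
move=> x1; rewrite /Defs.w sqr_sqrtr// subr_ge0 -real_normK ?num_real//.
by rewrite expr_le1.
Qed.

(** [Num.sqrt] is 0 on negative numbers, so [w] is itself a bounded function supported in
    [-1, 1]. *)
Lemma w_out x : 1 <= `|x| -> w x = 0.
Proof.
move=> x1; rewrite /Defs.w ler0_sqrtr// subr_le0 -real_normK ?num_real//.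
by rewrite expr_ge1.
Qed.

Lemma w_gt0 x : `|x| < 1 -> 0 < w x.
Proof.
move=> x1; rewrite /Defs.w sqrtr_gt0 subr_gt0 -real_normK ?num_real//.
by rewrite expr_lt1.
Qed.

Lemma w_le1 x : w x <= 1.
Proof.
rewrite -[leRHS]sqrtr1 /Defs.w ler_wsqrtr// gerBl; exact: sqr_ge0.
Qed.

Lemma w_normr x : `|w x| <= 1.
Proof. by rewrite ger0_norm ?w_ge0 ?w_le1. Qed.

Lemma continuous_w : continuous w.
Proof.
move=> x; apply: (continuous_comp (f := fun x => 1 - x ^+ 2)); last exact: sqrt_continuous.
by apply: cvgB; [exact: cvg_cst|exact: exprn_continuous].
Qed.

Lemma measurable_w : measurable_fun setT w.
Proof. by apply: continuous_measurable_fun; exact: continuous_w. Qed.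

Lemma bdd_supp_w : bdd_supp w.
Proof.
split; [exact: measurable_w|exists 1; exact: w_normr|exact: w_out].
Qed.

Lemma is_derive_w x : `|x| < 1 -> is_derive x (1 : R) w (- x / w x).
Proof.
move=> x1; have w0 := w_gt0 x1.
have x2 : 0 < 1 - x ^+ 2 by rewrite -(w_sqr (ltW x1)) exprn_gt0.
have ds := is_derive1_sqrt x2.
apply: is_derive_eq.
rewrite /GRing.scale/= -/(w x); field; exact: lt0r_neq0.
Qed.

(** The half-angle formula for the arcsine: it is continuous up to the endpoints, since 1 + w never
    vanishes. *)
Definition arcsine x : R := 2 * atan (x / (1 + w x)).

Lemma arcsine_den x : 0 < 1 + w x.
Proof. by rewrite ltr_wpDr// w_ge0. Qed.

Lemma is_derive_arcsine x : `|x| < 1 -> is_derive x (1 : R) arcsine (w x)^-1.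
Proof.
move=> x1; have w0 := w_gt0 x1; have dw := is_derive_w x1.
have wd := arcsine_den x; have wn := lt0r_neq0 wd.
apply: is_derive_eq.
rewrite /GRing.scale/=.
have h : 1 + (x / (1 + w x)) ^+ 2 = 2 / (1 + w x).
  rewrite expr_div_n (_ : x ^+ 2 = 1 - w x ^+ 2); last by rewrite w_sqr ?ltW//; ring.
  by field.
rewrite h; have x2 : x * x = 1 - w x ^+ 2 by rewrite w_sqr ?ltW//; ring.
move: (w x) w0 wn x2 => v /lt0r_neq0 v0 wn x2.
field: x2; by rewrite v0 wn.
Qed.

Lemma continuous_arcsine : continuous arcsine.
Proof.
move=> x; apply: cvgM; first exact: cvg_cst.
apply: (continuous_comp (f := fun x => x / (1 + w x))); last exact: continuous_atan.
apply: cvgM; first exact: cvg_id.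
apply: cvgV; first exact/lt0r_neq0/arcsine_den.
by apply: cvgD; [exact: cvg_cst|exact: continuous_w].
Qed.

Lemma arcsine1 : arcsine 1 = pi / 2.
Proof. rewrite /arcsine w_out ?normr1// addr0 divr1 atan1; by field. Qed.

Lemma arcsineN1 : arcsine (- 1) = - (pi / 2).
Proof. rewrite /arcsine w_out ?normrN1// addr0 divr1 atanN atan1; by field. Qed.

Lemma J_w : J w = pi / 2.
Proof.
have E : w = w \_ `[- 1, 1].
  apply/funext => x; rewrite patchE; case: ifPn => //.
  rewrite notin_setE/= in_itv/= -ler_norml => /negP; rewrite -ltNge => x1.
  by rewrite w_out// ltW.
rewrite E; apply: etrans (@FTC_J _ w (fun x => 2^-1 * (x * w x + arcsine x)) (- 1) 1 _ _ _ _) _.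
- by lra.
- by apply: continuous_subspaceT; exact: continuous_w.
- apply: continuous_subspaceT => x; apply: cvgM; first exact: cvg_cst.
  apply: cvgD; last exact: continuous_arcsine.
  by apply: cvgM; [exact: cvg_id|exact: continuous_w].
- move=> x; rewrite -ltr_norml => x1.
  have dw := is_derive_w x1; have da := is_derive_arcsine x1.
  apply: is_derive_eq; rewrite /GRing.scale/=.
  have w0 := lt0r_neq0 (w_gt0 x1).
  have x2 : x * x = 1 - w x ^+ 2 by rewrite w_sqr ?ltW//; ring.
  by field: x2.
- by rewrite !w_out ?normr1 ?normrN1// arcsine1 arcsineN1; field.
Qed.

Section primitive.
Variable y : R.
Hypothesis y1 : `|y| < 1.

Let N x := 1 - x * y + w x * w y.

(** A primitive of w(x) / (x - y) on either side of y. Half the logarithm of the square stands for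
    log |x - y|, and [N] stays positive on [-1, 1] as |y| < 1. *)
Definition w_primitive x : R :=
  w x - y * arcsine x - w y * (ln (N x) - 2^-1 * ln ((x - y) ^+ 2)).

Let N_gt0 x : `|x| <= 1 -> 0 < N x.
Proof.
move=> x1; rewrite /N ltr_wpDr ?mulr_ge0 ?w_ge0// subr_gt0.
apply: le_lt_trans (ler_norm _) _; rewrite normrM.
by apply: le_lt_trans y1; rewrite ler_piMl.
Qed.

Lemma is_derive_w_primitive x : `|x| < 1 -> x != y ->
  is_derive x (1 : R) w_primitive (w x / (x - y)).
Proof.
move=> x1 xy; have dw := is_derive_w x1; have da := is_derive_arcsine x1.
have Nx := N_gt0 (ltW x1); have xy0 : x - y != 0 by rewrite subr_eq0.
have xy2 : 0 < (x - y) ^+ 2 by rewrite lt_neqAle sqr_ge0 eq_sym sqrf_eq0 xy0.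
have dl1 := is_derive1_ln Nx; have dl2 := is_derive1_ln xy2.
rewrite /w_primitive /N in dl1 *.
apply: is_derive_eq; rewrite /GRing.scale/=.
have w0 := lt0r_neq0 (w_gt0 x1); move/lt0r_neq0 : Nx; rewrite /N => Nx.
have x2 : x ^+ 2 = 1 - w x ^+ 2 by rewrite w_sqr ?ltW//; ring.
have y2 : y ^+ 2 = 1 - w y ^+ 2 by rewrite w_sqr ?ltW//; ring.
move: (w x) (w y) w0 Nx x2 y2 => a b a0 Nx x2 y2.
field: x2 y2.
by rewrite xy0 a0 Nx.
Qed.

Lemma continuous_w_primitive x : `|x| <= 1 -> x != y -> {for x, continuous w_primitive}.
Proof.
move=> x1 xy; have Nx := N_gt0 x1; have xy0 : x - y != 0 by rewrite subr_eq0.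
have xy2 : 0 < (x - y) ^+ 2 by rewrite lt_neqAle sqr_ge0 eq_sym sqrf_eq0 xy0.
apply: cvgB.
  apply: cvgB; first exact: continuous_w.
  by apply: cvgM; [exact: cvg_cst|exact: continuous_arcsine].
apply: cvgM; first exact: cvg_cst.
apply: cvgB.
  apply: (continuous_comp (f := N)); last exact: continuous_ln.
  apply: cvgD.
    apply: cvgB; first exact: cvg_cst.
    by apply: cvgM; [exact: cvg_id|exact: cvg_cst].
  by apply: cvgM; [exact: continuous_w|exact: cvg_cst].
apply: cvgM; first exact: cvg_cst.
apply: (continuous_comp (f := fun x => (x - y) ^+ 2)); last exact: continuous_ln.
by apply/differentiable_continuous/derivable1_diffP.
Qed.

Lemma w_primitive1 : w_primitive 1 = - (y * (pi / 2)).
Proof.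
rewrite /w_primitive /N arcsine1 w_out ?normr1// mul0r addr0 mul1r sub0r.
have y1' : 0 < 1 - y by move: y1; rewrite ltr_norml; lra.
by rewrite expr2 lnM ?posrE//; field.
Qed.

Lemma w_primitiveN1 : w_primitive (- 1) = y * (pi / 2).
Proof.
rewrite /w_primitive /N arcsineN1 w_out ?normrN1// mul0r addr0 mulN1r sub0r opprK.
have y1' : 0 < 1 + y by move: y1; rewrite ltr_norml; lra.
rewrite (_ : (- 1 - y) ^+ 2 = (1 + y) * (1 + y)); last by ring.
by rewrite lnM ?posrE//; field.
Qed.

(** The singular term log |x - y| is even about y and cancels; the remainder [C] is continuous at
    y. *)
Lemma w_primitive_sym_cvg :
  w_primitive (y - e) - w_primitive (y + e) @[e --> 0^'+] --> 0.
Proof.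
pose C x := w x - y * arcsine x - w y * ln (N x).
have cC : {for y, continuous C}.
  apply: cvgB.
    apply: cvgB; first exact: continuous_w.
    by apply: cvgM; [exact: cvg_cst|exact: continuous_arcsine].
  apply: cvgM; first exact: cvg_cst.
  apply: (continuous_comp (f := N)); last by apply: continuous_ln; apply: N_gt0; exact: ltW.
  apply: cvgD.
    apply: cvgB; first exact: cvg_cst.
    by apply: cvgM; [exact: cvg_id|exact: cvg_cst].
  by apply: cvgM; [exact: continuous_w|exact: cvg_cst].
have E e : w_primitive (y - e) - w_primitive (y + e) = C (y + - e) - C (y + e).
  rewrite /w_primitive /C (_ : y - e - y = - e); last by ring.
  rewrite (_ : y + e - y = e); last by ring.
  by rewrite sqrrN; ring.
have cs (s : R) : y + s * e @[e --> 0^'+] --> y.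
  rewrite [X in _ --> X](_ : y = y + s * 0); last by rewrite mulr0 addr0.
  apply: cvgD; first exact: cvg_cst.
  apply: cvgM; first exact: cvg_cst.
  by apply: cvg_at_right_filter; exact: cvg_id.
have cCs s : C (y + s * e) @[e --> 0^'+] --> C y.
  by apply: (cvg_comp _ _ (cs s)); exact: cC.
have cc : C (y + -1 * e) - C (y + 1 * e) @[e --> 0^'+] --> C y - C y.
  by apply: cvgB; exact: cCs.
rewrite subrr in cc; move: cc; apply: cvg_trans; apply: near_eq_cvg; near=> e.
by rewrite E mulN1r mul1r.
Unshelve. all: end_near. Qed.

End primitive.

Lemma ae_neq (a : R) : {ae mu, forall x, x != a}.
Proof.
exists [set a]; split => //; first exact: lebesgue_measure_set1.
by move=> x /= /negP/negPn/eqP.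
Qed.

Lemma patch_itvE (f : R -> R) (a b x : R) :
  (f \_ `[a, b]) x = if a <= x <= b then f x else 0.
Proof. by rewrite patchE mem_setE in_itv. Qed.

Lemma J_w_trunc y e : `|y| < 1 -> 0 < e -> - 1 < y - e -> y + e < 1 ->
  J (fun x => w x * trunc_kernel e (x - y)) =
  pi^-1 * (w_primitive y (y - e) - w_primitive y (y + e) - y * pi).
Proof.
move=> y1 e0 ye1 ye2; pose phi x := w x / (x - y).
have cphi x : x != y -> {for x, continuous phi}.
  move=> xy; apply: cvgM; first exact: continuous_w.
  apply: cvgV; first by rewrite subr_eq0.
  by apply: cvgB; [exact: cvg_id|exact: cvg_cst].
have side a b : a < b -> - 1 <= a -> b <= 1 -> (forall x, a <= x <= b -> x != y) ->
    ig (phi \_ `[a, b]) /\ J (phi \_ `[a, b]) = w_primitive y b - w_primitive y a.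
  move=> ab a1 b1 aby.
  have cf : {within `[a, b], continuous phi}.
    apply: continuous_in_subspaceT => x; rewrite inE/= in_itv/= => xab.
    by apply: cphi; exact: aby.
  split; first exact: ig_itv.
  apply: FTC_J => //.
    apply: continuous_in_subspaceT => x; rewrite inE/= in_itv/= => xab.
    apply: continuous_w_primitive => //; last exact: aby.
    by rewrite ler_norml; move: xab => /andP[? ?]; apply/andP; split; lra.
  move=> x xab; apply: is_derive_w_primitive => //.
    by rewrite ltr_norml; move: xab => /andP[? ?]; apply/andP; split; lra.
  by apply: aby; move: xab => /andP[? ?]; apply/andP; split; lra.
have [||||i1 J1] := side (- 1) (y - e); [lra|lra|lra| |].
  by move=> x /andP[? ?]; apply/eqP => E; lra.
have [||||i2 J2] := side (y + e) 1; [lra|lra|lra| |].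
  by move=> x /andP[? ?]; apply/eqP => E; lra.
have iw : ig (fun x => w x * trunc_kernel e (x - y)).
  apply: (ig_bounded_kernel (C := e^-1)); first exact: bdd_supp_ig bdd_supp_w.
    exact: measurable_trunc_kernel.
  by move=> u; exact: trunc_kernel_bound.
transitivity (J (fun x => pi^-1 * ((phi \_ `[- 1, y - e]) x + (phi \_ `[y + e, 1]) x))).
  apply: J_ae; [exact: ig_measurable|exact: ig_measurable (igZ _ (igD i1 i2))|].
  (* At distance exactly e the truncated kernel is 0 while the closed intervals contain the point,
     so y - e and y + e are left out. *)
  apply: ae_sub (ae_and (ae_neq (y - e)) (ae_neq (y + e))) _ => x [/eqP xe1 /eqP xe2].
  rewrite !patch_itvE /phi.
  have [x1|x1] := leP 1 `|x|.
    by rewrite w_out// !mul0r; do 2 case: ifP => _; rewrite ?addr0 ?mulr0.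
  move: x1; rewrite ltr_norml => /andP[x1 x2].
  rewrite (ltW x1) (ltW x2) andbT /= /trunc_kernel.
  have [xy|xy] := leP x (y - e).
    rewrite (_ : y + e <= x = false); last by apply/negbTE; rewrite -ltNge; lra.
    rewrite ltr0_norm; last by lra.
    by rewrite ifT ?addr0; [ring|lra].
  have [yx|yx] := leP (y + e) x.
    rewrite gtr0_norm; last by lra.
    by rewrite ifT ?add0r; [ring|lra].
  rewrite ifF ?addr0 ?mulr0//; apply/negbTE; rewrite -leNgt ler_norml.
  by apply/andP; split; lra.
rewrite JZ; last exact: igD.
rewrite JD// J1 J2 w_primitive1// w_primitiveN1//; congr (_ * _); by field.
Qed.

(** The singular ends cancel in the limit, and the values - y pi / 2 at 1 and y pi / 2 at -1
    remain. *)
Lemma w_trunc_cvg y : `|y| < 1 ->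
  J (fun x => w x * trunc_kernel e (x - y)) @[e --> 0^'+] --> - y.
Proof.
move=> y1.
have c : pi^-1 * (w_primitive y (y - e) - w_primitive y (y + e) - y * pi) @[e --> 0^'+]
   --> pi^-1 * (0 - y * pi).
  apply: cvgM; first exact: cvg_cst.
  by apply: cvgB; [exact: w_primitive_sym_cvg|exact: cvg_cst].
rewrite [X in _ --> X](_ : - y = pi^-1 * (0 - y * pi)); last first.
  by rewrite sub0r mulrN mulrCA mulVf ?pi_neq0// mulr1.
move: c; apply: cvg_trans; apply: near_eq_cvg; have y2 : 0 < 1 - `|y| by rewrite subr_gt0.
near=> e.
have ey : e < 1 - `|y| by near: e; exact: nbhs_right_lt.
have := ler_norm y; have := ler_norm (- y); rewrite normrN => h1 h2.
by rewrite J_w_trunc//; lra.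
Unshelve. all: end_near. Qed.

Lemma trace_trunc_cvg h H : bdd_supp h -> is_trace h H ->
  {ae mu, forall y, J (fun x => h x * trunc_kernel e (x - y)) @[e --> 0^'+] --> H y}.
Proof.
move=> bh [wH cH]; have ih := bdd_supp_ig bh.
apply: ae_sub (ae_and cH (ae_leb_pt (ig_weighted ih))) _ => y [cy ly].
exact: trunc_kernel_cvg.
Qed.

Lemma bdd_suppM_w (r : R -> R) (C : R) : measurable_fun setT r ->
  (forall x, `|x| < 1 -> `|r x| <= C) -> bdd_supp (fun x => w x * r x).
Proof.
move=> mr rC; split.
- by apply: measurable_funM => //; exact: measurable_w.
- exists `|C| => x; have [x1|x1] := leP 1 `|x|; first by rewrite w_out// mul0r normr0.
  rewrite normrM (le_trans (ler_wpM2r _ (w_normr x)))// mul1r.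
  exact: le_trans (rC _ x1) (ler_norm _).
- by move=> x /w_out ->; rewrite mul0r.
Qed.

(* The divided difference [s] of [r] turns the transform of [w r] at [y] into
   [r y] times that of [w]. *)
Lemma trace_weight_mul (r : R -> R) (s : R -> R -> R) (C : R) H :
  measurable_fun setT r -> (forall x, `|x| < 1 -> `|r x| <= C) ->
  (forall y, `|y| < 1 -> measurable_fun setT (s y) /\
     exists D : R, forall x, `|x| < 1 -> `|s y x| <= D) ->
  (forall x y, `|x| < 1 -> `|y| < 1 -> x != y ->
     r x * (pi^-1 / (x - y)) = r y * (pi^-1 / (x - y)) + s y x) ->
  is_trace (fun x => w x * r x) H ->
  {ae mu, forall y, `|y| < 1 -> H y = - y * r y + J (fun x => w x * s y x)}.
Proof.
move=> mr rC hs E tH; have bh := bdd_suppM_w mr rC.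
apply: ae_sub (trace_trunc_cvg bh tH) _ => y cy y1.
have [ms [D sD]] := hs y y1.
have is_ : ig (fun x => w x * s y x) by exact: (bdd_supp_igM bdd_supp_w ms sD).
(* The regular part is truncated like the kernel so that the splitting is exact for each e;
   dominated convergence then removes the cut. *)
pose cut e x := if e < `|x - y| then w x * s y x else 0.
have mcut e : measurable_fun setT (cut e).
  apply: measurable_fun_ifT => //; last exact: ig_measurable.
  apply: measurable_fun_ltr => //; apply: measurableT_comp => //.
  exact: measurable_funB.
have cutle e x : `|cut e x| <= `|w x * s y x|.
  by rewrite /cut; case: ifP => // _; rewrite normr0.
have ccut : J (cut e) @[e --> 0^'+] --> J (fun x => w x * s y x).
  apply/cvg_at_rightP => u [u0 cu].
  have [|||||_ //] := @J_dominated _ (fun n => cut (u n)) (fun x => w x * s y x)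
    (fun x => `|w x * s y x|).
  - by move=> n; exact: mcut.
  - exact: ig_measurable.
  - exact: ig_norm.
  - apply: ae_sub (ae_neq y) _ => x xy; apply: cvg_near_cst.
    have xy0 : 0 < `|x - y| by rewrite normr_gt0 subr_eq0.
    move/cvgrPdist_lt : cu => /(_ _ xy0); apply: filterS => n.
    by rewrite sub0r normrN gtr0_norm// /cut => ->.
  - by move=> n x; exact: cutle.
have cr : r y * J (fun x => w x * trunc_kernel e (x - y)) + J (cut e) @[e --> 0^'+]
    --> r y * - y + J (fun x => w x * s y x).
  by apply: cvgD => //; apply: cvgM; [exact: cvg_cst|exact: w_trunc_cvg].
rewrite (_ : - y * r y = r y * - y); last by rewrite mulrC.
apply: (cvg_unique (@Rhausdorff R) cy); move: cr; apply: cvg_trans; apply: near_eq_cvg.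
near=> e; have e0 : 0 < e by [].
have iw : ig (fun x => w x * trunc_kernel e (x - y)).
  apply: (ig_bounded_kernel (C := e^-1)); first exact: bdd_supp_ig bdd_supp_w.
    exact: measurable_trunc_kernel.
  by move=> u; exact: trunc_kernel_bound.
have ic : ig (cut e) by apply: (ig_le (mcut e) (ig_norm is_)) => x; exact: cutle.
rewrite -JZ// -JD//; last exact: igZ.
congr J; apply/funext => x; rewrite /cut /trunc_kernel.
have [x1|x1] := leP 1 `|x|; first by rewrite w_out// !mul0r mulr0 if_same addr0.
case: ifPn => [exy|_]; last by rewrite !mulr0 addr0.
have xy : x != y by rewrite -subr_eq0 -normr_gt0 (lt_trans e0).
by rewrite -mulrA E// mulrDr mulrCA.
Unshelve. all: end_near. Qed.

End weight.

(** * The inversion formula for real functions *)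

Section airfoil_real.
Context {R : realType}.
Local Notation mu := (@lebesgue_measure R).
Local Notation w := (@w R).
Implicit Types (f g h G H W : R -> R) (a x y t d e : R).

Lemma trace_w W : is_trace w W -> {ae mu, forall y, `|y| < 1 -> W y = - y}.
Proof.
move=> tW.
have tW1 : is_trace (fun x => w x * 1) W.
  by rewrite (_ : (fun x => _) = w)//; apply/funext => x; rewrite mulr1.
have E : {ae mu, forall y, `|y| < 1 -> W y = - y * 1 + J (fun x => w x * 0)}.
  apply: (@trace_weight_mul R (fun=> 1) (fun _ _ => 0) 1 W _ _ _ _ tW1) => //.
  - by move=> x _; rewrite normr1.
  - by move=> y _; split => //; exists 0 => x _; rewrite normr0.
  - by move=> x y _ _ _; rewrite addr0.
apply: ae_sub E _ => y Ey y1; rewrite Ey// mulr1.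
by under [X in J X]eq_fun do rewrite mulr0; rewrite J0 addr0.
Qed.

Lemma is_trace_w : exists W, [/\ is_trace w W & {ae mu, forall y, `|y| < 1 -> W y = - y}].
Proof.
have [W tW] := exists_trace (@bdd_supp_w R).
by exists W; split => //; exact: trace_w.
Qed.

Lemma measurable_cpoisson_shift e t : 0 < e ->
  measurable_fun setT (fun x => cpoisson e (x - t)).
Proof.
move=> e0; apply: continuous_measurable_fun; apply: continuous_shift.
exact: continuous_cpoisson.
Qed.

Lemma bdd_supp_neq0 f x : bdd_supp f -> f x != 0 -> `|x| < 1.
Proof. by move=> [_ _ f0]; apply: contraNT; rewrite -leNgt => /f0 ->. Qed.

Lemma J_bdd_supp_ae f H (K : R -> R) : bdd_supp f -> weighted_ig H ->
  measurable_fun setT (fun x => f x * K x) ->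
  {ae mu, forall y, `|y| < 1 -> H y = K y} ->
  J (fun x => f x * H x) = J (fun x => f x * K x).
Proof.
move=> bf wH mK HK; apply: J_ae => //.
  by apply: measurable_funM; [case: bf|case: wH].
apply: ae_sub HK _ => y E; have [->|fy] := eqVneq (f y) 0; first by rewrite !mul0r.
by rewrite E//; exact: bdd_supp_neq0 fy.
Qed.

(** Duality with the test function w(x) q_e(x - t); the left side is Q_e(w G)(t), here expressed
    through Poisson integrals of f and w alone. *)
Lemma cpoisson_int_mul_w f G e t : bdd_supp f -> is_trace f G -> 0 < e ->
  J (fun x => (G x * w x) * cpoisson e (x - t)) =
  pi^-1 * J f + (t + cpoisson_int e w t) * cpoisson_int e f t
  - (e + poisson_int e w t) * poisson_int e f t.
Proof.
move=> bf tG e0; have bw := @bdd_supp_w R.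
pose r x := cpoisson e (x - t).
(* The divided difference of [r] over pi. For the complex kernel c = q + i p it is - c(x) c(y),
   whose real part is p p - q q. *)
pose s y x := poisson e (x - t) * poisson e (y - t) - cpoisson e (x - t) * cpoisson e (y - t).
have mp := measurable_poisson_shift t e0; have mq := measurable_cpoisson_shift t e0.
have rC x : `|x| < 1 -> `|r x| <= e^-1 by move=> _; exact: cpoisson_bound.
have pC x : `|poisson e (x - t)| <= e^-1.
  rewrite ger0_norm ?poisson_ge0// poissonE.
  have h := poisson_den (x - t) e0.
  rewrite mulrA ler_pdivrMr// ler_pdivlMl// mulrCA ler_pdivrMl ?pi_gt0//.
  apply: (@le_trans _ _ (1 * ((x - t) ^+ 2 + e ^+ 2))).
    by rewrite mul1r -expr2 lerDr sqr_ge0.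
  by rewrite ler_wpM2r ?(ltW h)//; have := @pi_ge2 R; lra.
have bh := bdd_suppM_w mq rC.
have [H tH] := exists_trace bh.
have is_ y : ig (fun x => w x * s y x) /\ J (fun x => w x * s y x) =
   poisson e (y - t) * poisson_int e w t - cpoisson e (y - t) * cpoisson_int e w t.
  have i1 : ig (fun x => w x * poisson e (x - t)).
    by apply: (bdd_supp_igM bw mp (C := e^-1)) => x _; exact: pC.
  have i2 : ig (fun x => w x * cpoisson e (x - t)) by exact: (bdd_supp_igM bw mq rC).
  rewrite (_ : (fun x => w x * s y x) = fun x =>
     poisson e (y - t) * (w x * poisson e (x - t)) - cpoisson e (y - t) * (w x * cpoisson e (x - t))).
    split; first by apply: igB; exact: igZ.
    by rewrite JB; [rewrite !JZ|exact: igZ|exact: igZ].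
  by apply/funext => x; rewrite /s; ring.
have HE : {ae mu, forall y, `|y| < 1 -> H y = - (y * r y + r y * cpoisson_int e w t
    - poisson e (y - t) * poisson_int e w t)}.
  have E : {ae mu, forall y, `|y| < 1 -> H y = - y * r y + J (fun x => w x * s y x)}.
   apply: (@trace_weight_mul R r s e^-1 H _ _ _ _ tH).
  - exact: mq.
  - exact: rC.
  - move=> y _; split.
      by apply: measurable_funB; apply: measurable_funM.
    exists (e^-1 * e^-1 + e^-1 * e^-1) => x x1.
    rewrite (le_trans (ler_normB _ _))// !normrM.
    by rewrite lerD// ler_pM// ?pC//; exact: cpoisson_bound.
  - move=> x y _ _ xy; rewrite /r /s !poissonE !cpoissonE.
    have h1 := poisson_den_neq0 (x - t) e0; have h2 := poisson_den_neq0 (y - t) e0.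
    have h3 : x - y != 0 by rewrite subr_eq0.
    move: (pi^-1 : R) => P; field.
    by rewrite h1 h2 h3.
  apply: ae_sub E _ => y Ey y1; rewrite Ey//.
  have [_ ->] := is_ y; rewrite /r; ring.
have D := trace_dual bf bh tG tH.
transitivity (J (fun x => G x * (w x * r x))).
  by congr J; apply/funext => x; rewrite mulrA.
have fq : ig (fun x => f x * cpoisson e (x - t)) by exact: (bdd_supp_igM bf mq rC).
have fp : ig (fun x => f x * poisson e (x - t)).
  by apply: (bdd_supp_igM bf mp (C := e^-1)) => x _; exact: pC.
have fi := bdd_supp_ig bf.
pose K y := - (y * r y + r y * cpoisson_int e w t - poisson e (y - t) * poisson_int e w t).
have fK : (fun x => f x * K x) = fun x => -
   ((pi^-1 * f x + (t + cpoisson_int e w t) * (f x * cpoisson e (x - t)))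
  - (e + poisson_int e w t) * (f x * poisson e (x - t))).
  apply/funext => x; rewrite /K /r.
  (* Write x = (x - t) + t and u^2 = (u^2 + e^2) - e^2; this is where the integral of f comes
     from. *)
  have -> : x * cpoisson e (x - t) = pi^-1 - e * poisson e (x - t) + t * cpoisson e (x - t).
    rewrite poissonE cpoissonE; have h1 := poisson_den_neq0 (x - t) e0.
    by move: (pi^-1 : R) => P; field.
  ring.
have iK : ig (fun x => f x * K x).
  by rewrite fK; apply: igN; apply: igB; [apply: igD; exact: igZ|exact: igZ].
rewrite D (J_bdd_supp_ae bf _ (ig_measurable iK) HE); last by case: tH.
rewrite fK JN ?opprK; last by apply: igB; [apply: igD; exact: igZ|exact: igZ].
rewrite JB; [|by apply: igD; exact: igZ|exact: igZ].
by rewrite JD ?JZ//; exact: igZ.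
Qed.

(** The trace of w is - t, so the factor t + Q_e w(t) tends to 0 and the term containing G(t) drops
    out. *)
Lemma mul_w_trunc_cvg f G : bdd_supp f -> is_trace f G ->
  {ae mu, forall t, `|t| < 1 ->
    J (fun x => (G x * w x) * trunc_kernel e (x - t)) @[e --> 0^'+] -->
    pi^-1 * J f - w t * f t}.
Proof.
move=> bf tG; have bw := @bdd_supp_w R.
have [W [tW EW]] := is_trace_w.
have iGw : ig (fun x => G x * w x) by apply: weighted_ig_bdd_supp => //; case: tG.
have [wG cG] := tG; have [wW cW] := tW.
have l1 := ae_leb_pt (ig_weighted iGw).
have l2 := ae_leb_pt (ig_weighted (bdd_supp_ig bf)).
have l3 := ae_leb_pt (ig_weighted (bdd_supp_ig bw)).
apply: ae_sub (ae_and (ae_and l1 (ae_and l2 l3)) (ae_and (ae_and cG cW) EW)) _ => t.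
move=> [[L1 [L2 L3]] [[CG CW] E1]] t1; apply: trunc_kernel_cvg => //.
have c2 := poisson_cvg (ig_weighted (bdd_supp_ig bf)) L2.
have c3 := poisson_cvg (ig_weighted (bdd_supp_ig bw)) L3.
rewrite E1// in CW.
have ce : e @[e --> (0 : R)^'+] --> (0 : R) by apply: cvg_at_right_filter; exact: cvg_id.
have : pi^-1 * J f + (t + cpoisson_int e w t) * cpoisson_int e f t
  - (e + poisson_int e w t) * poisson_int e f t @[e --> 0^'+] -->
  pi^-1 * J f + (t + - t) * G t - (0 + w t) * f t.
  apply: cvgB.
    apply: cvgD; first exact: cvg_cst.
    by apply: cvgM => //; apply: cvgD => //; exact: cvg_cst.
  by apply: cvgM => //; exact: cvgD.
rewrite subrr mul0r addr0 add0r.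
apply: cvg_trans; apply: near_eq_cvg; near=> e.
by rewrite (cpoisson_int_mul_w _ bf tG).
Unshelve. all: end_near. Qed.

Definition w_cauchy a : R := pi^-1 * J (fun x => w x / (x - a)).

Lemma cauchy_bound a x : 1 < `|a| -> `|x| < 1 -> `|(x - a)^-1| <= (`|a| - 1)^-1.
Proof.
move=> a1 x1; rewrite normfV lef_pV2 ?posrE; last 2 first.
- by rewrite normr_gt0 subr_eq0; apply/eqP => E; move: a1 x1; rewrite E; lra.
- by rewrite subr_gt0.
by have := lerB_dist a x; rewrite distrC; move: x1; lra.
Qed.

Lemma measurable_cauchy a : measurable_fun setT (fun x => (x - a)^-1).
Proof. by apply: (measurableT_comp (@measurable_inv R)); exact: measurable_funB. Qed.

(** Duality with w(x) / (x - a), bounded because a lies outside [-1, 1]; the divided difference of 1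
    / (x - a) is - 1 / ((x - a) (y - a)). *)
Lemma J_mul_w_cauchy f G a : bdd_supp f -> is_trace f G -> 1 < `|a| ->
  J (fun x => G x * (w x / (x - a))) =
  J f + (a + w_cauchy a) * J (fun x => f x / (x - a)).
Proof.
move=> bf tG a1; have bw := @bdd_supp_w R.
pose r x := (x - a)^-1; pose s y x := - (pi^-1 * r x * r y).
have mr : measurable_fun setT r by exact: measurable_cauchy.
pose C := (`|a| - 1)^-1.
have rC x : `|x| < 1 -> `|r x| <= C by exact: cauchy_bound.
have xa x : `|x| < 1 -> x - a != 0.
  by move=> x1; rewrite subr_eq0; apply/eqP => E; move: a1 x1; rewrite E; lra.
have bh := bdd_suppM_w mr rC.
have [H tH] := exists_trace bh.
have iw : ig (fun x => w x * r x) by exact: (bdd_supp_igM bw mr rC).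
have HE : {ae mu, forall y, `|y| < 1 -> H y = - (y * r y + w_cauchy a * r y)}.
  have E : {ae mu, forall y, `|y| < 1 -> H y = - y * r y + J (fun x => w x * s y x)}.
   apply: (@trace_weight_mul R r s C H _ _ _ _ tH).
  - exact: mr.
  - exact: rC.
  - move=> y _; split.
      by apply: measurable_funN; apply: measurable_funM => //; apply: measurable_funM.
    exists (pi^-1 * C * `|r y|) => x x1.
    rewrite normrN normrM normrM (@ger0_norm _ pi^-1) ?invr_ge0 ?pi_ge0//.
    by rewrite ler_wpM2r// ler_wpM2l ?invr_ge0 ?pi_ge0// rC.
  - move=> x y /xa x0 /xa y0 xy; rewrite /r /s /r.
    have h3 : x - y != 0 by rewrite subr_eq0.
    move: (pi^-1 : R) => P; field.
    by rewrite x0 y0 h3.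
  apply: ae_sub E _ => y Ey y1; rewrite Ey//.
  rewrite (_ : (fun x => w x * s y x) = fun x => - (pi^-1 * r y) * (w x * r x)).
    by rewrite JZ// /w_cauchy -/r; ring.
  by apply/funext => x; rewrite /s; ring.
have fi := bdd_supp_ig bf.
have fr : ig (fun x => f x * r x) by exact: (bdd_supp_igM bf mr rC).
pose K y := - (y * r y + w_cauchy a * r y).
have fK : (fun x => f x * K x) = fun x => - (f x + (a + w_cauchy a) * (f x * r x)).
  apply/funext => x; have [->|fx] := eqVneq (f x) 0; first by rewrite !mul0r mulr0 addr0 oppr0.
  have x0 := xa _ (bdd_supp_neq0 bf fx); rewrite /K /r; by field.
have iK : ig (fun x => f x * K x) by rewrite fK; apply: igN; apply: igD => //; exact: igZ.
have D := trace_dual bf bh tG tH.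
rewrite D (J_bdd_supp_ae bf _ (ig_measurable iK) HE); last by case: tH.
rewrite fK JN ?opprK; last by apply: igD => //; exact: igZ.
by rewrite JD ?JZ//; exact: igZ.
Qed.

(** Applying [J_mul_w_cauchy] to f = w, whose trace is - x, gives a quadratic equation for
    [w_cauchy a], so the integral need not be computed. *)
Lemma w_cauchy_sqr a : 1 < `|a| -> (a + w_cauchy a) ^+ 2 = a ^+ 2 - 1.
Proof.
move=> a1; have bw := @bdd_supp_w R; have [W [tW EW]] := is_trace_w.
have := J_mul_w_cauchy bw tW a1.
have mr := measurable_cauchy a.
have rC x : `|x| < 1 -> `|(x - a)^-1| <= (`|a| - 1)^-1 by exact: cauchy_bound.
have bh := bdd_suppM_w mr rC; have ih := bdd_supp_ig bh.
pose K x := - w x - a * (w x / (x - a)).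
have iw := bdd_supp_ig bw.
have E : J (fun x => W x * (w x / (x - a))) = J K.
  apply: J_ae.
  - by apply: ig_measurable; apply: weighted_ig_bdd_supp => //; case: tW.
  - by apply: ig_measurable; apply: igB; [exact: igN|exact: igZ].
  apply: ae_sub EW _ => x Ex; rewrite /K; have [x1|x1] := leP 1 `|x|.
    by rewrite w_out// !(mul0r, mulr0, oppr0, addr0).
  have x0 : x - a != 0 by rewrite subr_eq0; apply/eqP => xa; move: a1 x1; rewrite xa; lra.
  by rewrite Ex//; field.
rewrite E /K JB; [|exact: igN|exact: igZ].
rewrite JN// JZ// J_w /w_cauchy.
have p0 := @pi_gt0 R; move: (J _) => q; move: (pi : R) p0 => P p0 E2.
have : (a + P^-1 * q) ^+ 2 - (a ^+ 2 - 1) = 0; last by move/eqP; rewrite subr_eq0 => /eqP.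
rewrite (_ : _ - _ = - P^-1 * ((- (P / 2) - a * q) - (P / 2 + (a + P^-1 * q) * q))).
  by rewrite E2 subrr mulr0.
by field; exact: lt0r_neq0.
Qed.

Section edge.
Variable sg : R.
Hypothesis sg1 : sg * sg = 1.

(** The poles [a n] tend to the endpoint [sg], which is 1 or -1, from outside the interval. *)
Let b (n : nat) : R := 1 + n.+1%:R^-1.
Let a (n : nat) : R := sg * b n.

Let b_bounds n : 1 < b n <= 2.
Proof.
rewrite /b ltrDl invr_gt0 ltr0n/= (_ : 2 = 1 + 1 :> R) ?lerD2l; last by lra.
by rewrite invf_le1 ?ler1n// ltr0n.
Qed.

Let norm_sg : `|sg| = 1.
Proof.
by apply/eqP; rewrite -sqrp_eq1// expr2 -normrM sg1 normr1.
Qed.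

Let norm_a n : `|a n| = b n.
Proof.
rewrite /a normrM norm_sg mul1r ger0_norm//.
by have /andP[h _] := b_bounds n; rewrite ltW// (lt_trans _ h).
Qed.

Let a_gt1 n : 1 < `|a n|.
Proof. by rewrite norm_a; have /andP[] := b_bounds n. Qed.

Let b_cvg : b n @[n --> \oo] --> (1 : R).
Proof.
rewrite -[X in _ --> X]addr0; apply: cvgD; first exact: cvg_cst.
exact: cvg_harmonic.
Qed.

Let a_cvg : a n @[n --> \oo] --> sg.
Proof.
by rewrite -[X in _ --> X]mulr1; apply: cvgM; [exact: cvg_cst|exact: b_cvg].
Qed.

Let sg_lt1 x : `|x| < 1 -> - 1 < sg * x < 1.
Proof. by rewrite -ltr_norml normrM norm_sg mul1r. Qed.

Let w_sg x : `|x| < 1 -> (1 - sg * x) * (1 + sg * x) = w x ^+ 2.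
Proof.
move=> x1; rewrite w_sqr ?ltW// -subr_sqr expr1n exprMn; congr (1 - _).
by rewrite expr2 sg1 mul1r.
Qed.

Let dist_a x n : `|x - a n| = `|b n - sg * x|.
Proof.
rewrite -[RHS]mul1r -norm_sg -normrM mulrBr mulrA sg1 mul1r distrC.
by rewrite /a.
Qed.

Let dist_a_gt x n : `|x| < 1 -> 1 - sg * x < `|x - a n|.
Proof.
move=> x1; rewrite dist_a; apply: lt_le_trans (ler_norm _).
by rewrite ltrD2r; have /andP[] := b_bounds n.
Qed.

(** Uniform in n: |x - a_n| exceeds 1 - sg x, while w^2 = (1 - sg x) (1 + sg x) is at most twice
    that. *)
Lemma w_edge_bound x n : `|w x / (x - a n)| <= 2 * (w x)^-1.
Proof.
have [x1|x1] := leP 1 `|x|; first by rewrite w_out// mul0r normr0 invr0 mulr0.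
have w0 := w_gt0 x1; have := dist_a_gt n x1; have /andP[s1 s2] := sg_lt1 x1.
move=> da; have d0 : 0 < `|x - a n| by apply: lt_trans da; lra.
rewrite normrM normfV (gtr0_norm w0) ler_pdivrMr// mulrAC ler_pdivlMr// -expr2 -(w_sg x1).
rewrite mulrC ler_pM//; lra.
Qed.

(** Compare squares, with z = sg x and numerator b^2 - 1. From b - z = (b - 1) + (1 - z) one gets (b
    - z)^2 >= (b - 1) (1 - z), and b + 1 <= 3 bounds the quotient by 3 / (1 - z). *)
Lemma w_cauchy_edge_bound x n : `|x| < 1 ->
  `|(a n + w_cauchy (a n)) / (x - a n)| <= 3 * (w x)^-1.
Proof.
move=> x1; have w0 := w_gt0 x1; have /andP[s1 s2] := sg_lt1 x1.
have /andP[b1 b2] := b_bounds n.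
have bz : 0 < b n - sg * x by lra.
have w2 : 0 < 1 - sg * x by lra.
rewrite -ler_sqr ?nnegrE//; last by rewrite mulr_ge0// invr_ge0 ltW.
rewrite real_normK ?num_real// !exprMn !exprVn -(w_sg x1) (w_cauchy_sqr (a_gt1 n)).
rewrite -(real_normK (num_real (x - a n))) dist_a (gtr0_norm bz).
rewrite (_ : a n ^+ 2 = b n ^+ 2); last by rewrite /a exprMn expr2 sg1 mul1r.
apply: (@le_trans _ _ (3 / (1 - sg * x))).
  rewrite ler_pdivrMr ?exprn_gt0// mulrAC ler_pdivlMr//.
  have : 0 <= (b n - sg * x) ^+ 2 - (b n - 1) * (1 - sg * x).
    move: (b n) (sg * x) b1 b2 s1 s2 bz w2 => p q *; nra.
  have : 0 <= (b n - 1) * (1 - sg * x) * (2 - b n).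
    by rewrite mulr_ge0 ?mulr_ge0//; lra.
  move: (b n) (sg * x) b1 b2 s1 s2 bz w2 => p q *; nra.
rewrite ler_pdivrMr// mulrAC ler_pdivlMr; last by rewrite mulr_gt0//; lra.
move: (sg * x) s1 s2 w2 => q *; nra.
Qed.

(** Let a_n tend to [sg] in [J_mul_w_cauchy]. The left side is dominated by 2 |G / w|. On the right
    the factor a_n + [w_cauchy (a n)] tends to 0; it is kept inside the integral, where its product
    with f / (x - a_n) is dominated by a multiple of 1 / w. *)
Lemma J_mul_w_edge f G : bdd_supp f -> is_trace f G ->
  ig (fun x => (w x)^-1) -> ig (fun x => G x / w x) ->
  J (fun x => G x * (w x / (x - sg))) = J f.
Proof.
move=> bf tG iw ik; have [mf [M fM] f0] := bf; have [[mG _] _] := tG.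
have M0 : 0 <= M by apply: le_trans (fM 0).
have mw := @measurable_w R.
have xsg x : `|x| < 1 -> x - sg != 0.
  move=> x1; rewrite subr_eq0; apply/eqP => E; move: x1; rewrite E norm_sg; lra.
have [|||||_ cL] := @J_dominated _ (fun n x => G x * (w x / (x - a n)))
    (fun x => G x * (w x / (x - sg))) (fun x => 2 * `|G x / w x|).
- by move=> n; do 2 apply: measurable_funM => //; exact: measurable_cauchy.
- by do 2 apply: measurable_funM => //; exact: measurable_cauchy.
- by apply: igZ; exact: ig_norm.
- apply: aeW => x; apply: cvgM; first exact: cvg_cst.
  have [x1|x1] := leP 1 `|x|.
    by rewrite w_out// mul0r; under eq_fun do rewrite mul0r; exact: cvg_cst.
  apply: cvgM; first exact: cvg_cst.
  apply: cvgV; first exact: xsg.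
  by apply: cvgB; [exact: cvg_cst|exact: a_cvg].
- move=> n x; rewrite (normrM (G x)) (normrM (G x)) mulrCA ler_wpM2l// normfV (ger0_norm (w_ge0 _)).
  exact: w_edge_bound.
have mr n := measurable_cauchy (a n).
have ac : a n + w_cauchy (a n) @[n --> \oo] --> (0 : R).
  apply/norm_cvg0P.
  have E n : `|a n + w_cauchy (a n)| = Num.sqrt (a n * a n - 1).
    by rewrite -expr2 -(w_cauchy_sqr (a_gt1 n)) sqrtr_sqr.
  under eq_fun do rewrite E.
  rewrite -(@sqrtr0 R) -(subrr (1 : R)) -{1}sg1.
  apply: (cvg_comp (fun n => a n * a n - 1)); last exact: sqrt_continuous.
  by apply: cvgB; [apply: cvgM; exact: a_cvg|exact: cvg_cst].
have [|||||_ cR] := @J_dominated _ (fun n x => (a n + w_cauchy (a n)) * (f x / (x - a n)))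
    (fun x => 0) (fun x => M * 3 * (w x)^-1).
- by move=> n; apply: measurable_funM => //; apply: measurable_funM.
- by [].
- exact: igZ.
- apply: aeW => x; have [x1|x1] := leP 1 `|x|.
    by rewrite f0//; under eq_fun do rewrite mul0r mulr0; exact: cvg_cst.
  rewrite -(mul0r (f x / (x - sg))); apply: cvgM => //.
  apply: cvgM; first exact: cvg_cst.
  apply: cvgV; first exact: xsg.
  by apply: cvgB; [exact: cvg_cst|exact: a_cvg].
- move=> n x; have [x1|x1] := leP 1 `|x|.
    by rewrite f0// mul0r mulr0 normr0 w_out// invr0 mulr0.
  rewrite mulrCA normrM -mulrA ler_pM//; exact: w_cauchy_edge_bound.
have cR' : J f + (a n + w_cauchy (a n)) * J (fun x => f x / (x - a n)) @[n --> \oo] --> J f + 0.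
  apply: cvgD; first exact: cvg_cst.
  rewrite J0 in cR; move: cR; apply: cvg_trans; apply: near_eq_cvg; near=> n.
  rewrite JZ//; apply: (bdd_supp_igM bf (mr n) (C := (`|a n| - 1)^-1)) => x x1.
  by apply: cauchy_bound.
rewrite -[RHS]addr0; apply: (cvg_unique (@Rhausdorff R) cL); move: cR'.
apply: cvg_trans; apply: near_eq_cvg; near=> n.
by rewrite (J_mul_w_cauchy bf tG).
Unshelve. all: end_near. Qed.

End edge.

(* The two edge identities, since w^2 / (x -+ 1) = - (x +- 1). *)
Lemma J_div_w_moments f G : bdd_supp f -> is_trace f G ->
  ig (fun x => (w x)^-1) -> ig (fun x => G x / w x) ->
  [/\ ig (fun x => x * (G x / w x)), J (fun x => G x / w x) = 0 &
      J (fun x => x * (G x / w x)) = - J f].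
Proof.
move=> bf tG iw ik; have mk := ig_measurable ik.
have ixk : ig (fun x => x * (G x / w x)).
  apply: (ig_le _ (ig_norm ik)); first exact: measurable_funM.
  move=> x; rewrite normrM; have [x1|x1] := leP 1 `|x|.
    by rewrite w_out// invr0 mulr0 normr0 mulr0.
  by rewrite ler_piMl// ltW.
have E (s : R) : s * s = 1 -> J f = - (J (fun x => x * (G x / w x)) + s * J (fun x => G x / w x)).
  move=> s1; rewrite -(J_mul_w_edge s1 bf tG iw ik) -JZ// -JD//; last exact: igZ.
  rewrite -JN; last by apply: igD => //; exact: igZ.
  congr J; apply/funext => x; have [x1|x1] := leP 1 `|x|.
    by rewrite w_out// invr0 !(mul0r, mulr0, oppr0, addr0).
  have w0 := lt0r_neq0 (w_gt0 x1).
  have xs : x - s != 0.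
    rewrite subr_eq0; apply/eqP => xs; move: s1; rewrite -xs => x2.
    have : `|x| * `|x| = 1 by rewrite -normrM x2 normr1.
    by have := normr_ge0 x; nra.
  rewrite -mulrDl [RHS](_ : _ = G x * (w x ^+ 2 * (w x)^-1 / (x - s))); last first.
    by rewrite w_sqr ?ltW// -s1; field; rewrite w0 xs.
  by rewrite expr2 mulfK.
have := E 1; have := E (- 1); rewrite mulrNN !mulr1 mulN1r mul1r.
move=> /(_ erefl) + /(_ erefl); move: (J f) (J _) (J _) => p q r h1 h2.
by split => //; lra.
Qed.

(** Dividing w(x)^2 = w(t)^2 - (x - t) (x + t) by w(x) (x - t) expresses G / w through w G and the
    regular function (x + t) G / w. By the moments the latter integrates to - J f, which cancels the
    constant in T(w G). *)
Lemma div_w_trunc_cvg f G : bdd_supp f -> is_trace f G ->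
  ig (fun x => (w x)^-1) -> ig (fun x => G x / w x) ->
  {ae mu, forall t, `|t| < 1 ->
    J (fun x => (G x / w x) * trunc_kernel e (x - t)) @[e --> 0^'+] --> - (f t / w t)}.
Proof.
move=> bf tG iw ik; have [ixk k0 k1] := J_div_w_moments bf tG iw ik.
pose k x := G x / w x; have mk := ig_measurable ik.
apply: ae_sub (mul_w_trunc_cvg bf tG) _ => t ct t1.
have w0 := w_gt0 t1; have wn := lt0r_neq0 w0.
(* The regular part, truncated at the same distance so that the integrands agree for each e. *)
pose cut e x := if e < `|x - t| then pi^-1 * (x * k x + t * k x) else 0.
have il : ig (fun x => pi^-1 * (x * k x + t * k x)) by apply: igZ; apply: igD => //; exact: igZ.
have mcut e : measurable_fun setT (cut e).
  apply: measurable_fun_ifT => //; last exact: ig_measurable.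
  apply: measurable_fun_ltr => //; apply: measurableT_comp => //.
  exact: measurable_funB.
have cutle e x : `|cut e x| <= `|pi^-1 * (x * k x + t * k x)|.
  by rewrite /cut; case: ifP => // _; rewrite normr0.
have ccut : J (cut e) @[e --> 0^'+] --> - (pi^-1 * J f).
  have -> : - (pi^-1 * J f) = J (fun x => pi^-1 * (x * k x + t * k x)).
    rewrite JZ; last by apply: igD => //; exact: igZ.
    by rewrite JD ?JZ// ?k0 ?k1 ?mulr0 ?addr0 ?mulrN//; exact: igZ.
  apply/cvg_at_rightP => u [u0 cu].
  have [|||||_ //] := @J_dominated _ (fun n => cut (u n)) (fun x => pi^-1 * (x * k x + t * k x))
    (fun x => `|pi^-1 * (x * k x + t * k x)|).
  - by move=> n; exact: mcut.
  - exact: ig_measurable.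
  - exact: ig_norm.
  - apply: ae_sub (ae_neq t) _ => x xt; apply: cvg_near_cst.
    have xt0 : 0 < `|x - t| by rewrite normr_gt0 subr_eq0.
    move/cvgrPdist_lt : cu => /(_ _ xt0); apply: filterS => n.
    by rewrite sub0r normrN gtr0_norm// /cut => ->.
  - by move=> n x; exact: cutle.
have c : (w t ^+ 2)^-1 * (J (fun x => (G x * w x) * trunc_kernel e (x - t)) + J (cut e)) @[e --> 0^'+]
   --> (w t ^+ 2)^-1 * ((pi^-1 * J f - w t * f t) + - (pi^-1 * J f)).
  by apply: cvgM; [exact: cvg_cst|apply: cvgD => //; exact: ct].
have -> : - (f t / w t) = (w t ^+ 2)^-1 * ((pi^-1 * J f - w t * f t) + - (pi^-1 * J f)).
  by move: (pi^-1 * J f) => q; field.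
move: c; apply: cvg_trans; apply: near_eq_cvg; near=> e; have e0 : 0 < e by [].
have iker h : ig h -> ig (fun x => h x * trunc_kernel e (x - t)).
  move=> ih; apply: (ig_bounded_kernel (C := e^-1)) => //; first exact: measurable_trunc_kernel.
  by move=> u; exact: trunc_kernel_bound.
have icut : ig (cut e) by apply: (ig_le (mcut e) (ig_norm il)) => x; exact: cutle.
have iGw : ig (fun x => G x * w x).
  by apply: weighted_ig_bdd_supp; [case: tG|exact: bdd_supp_w].
rewrite -JD//; last exact: iker.
rewrite -JZ; last by apply: igD => //; exact: iker.
congr J; apply/funext => x; rewrite /cut /trunc_kernel /k.
case: ifPn => [ext|_]; last by rewrite !mulr0 addr0 mulr0.
have xt : x - t != 0 by rewrite -normr_gt0 (lt_trans e0).
have [x1|x1] := leP 1 `|x|; first by rewrite (w_out x1) invr0 !(mul0r, mulr0, addr0).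
have wx := lt0r_neq0 (w_gt0 x1).
have x2 : x ^+ 2 = 1 - w x ^+ 2 by rewrite w_sqr ?ltW//; ring.
have t2 : t ^+ 2 = 1 - w t ^+ 2 by rewrite w_sqr ?ltW//; ring.
move: (w x) (w t) (pi^-1 : R) wx wn x2 t2 => u v P wx wn x2 t2.
field: x2 t2.
by rewrite ?wx ?wn ?xt.
Unshelve. all: end_near. Qed.

End airfoil_real.

(** * Integrability of G / w for functions of exponential class *)

(** Meant for the rearrangement, whose measurability is not established: the bound is read off the
    integral as a supremum over simple functions. *)
Lemma integral_ge_cst d (T : measurableType d) (R : realType)
  (mu : {measure set T -> \bar R}) (A : set T) (F : T -> \bar R) (l t : R) :
  measurable A -> mu A = t%:E -> 0 <= l ->
  (forall x, 0 <= F x)%E -> (forall x, A x -> l%:E <= F x)%E ->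
  ((l * t)%:E <= \int[mu]_(x in A) F x)%E.
Proof.
move=> mA At l0 F0 lF; rewrite EFinM -At integral_mkcond ge0_integralTE; last first.
  by move=> x; apply: erestrict_ge0.
rewrite -(integral_cst mu mA) integral_mkcond.
pose h := scale_nnsfun (indic_nnsfun R mA) l0.
apply: ereal_sup_ubound; exists h.
  move=> x; rewrite /= mindicE patchE; case: ifPn => xA.
    by rewrite mulr1; apply: lF; rewrite inE in xA.
  by rewrite mulr0.
rewrite -integralT_nnsfun; apply: eq_integral => x _.
by rewrite /= mindicE patchE; case: ifPn => _; rewrite ?mulr1 ?mulr0.
Qed.

Lemma measurable_superlevel d (T : measurableType d) (R : realType) (D : set T)
  (h : T -> R) (l : R) : measurable D -> measurable_fun D h ->
  measurable (D `&` [set x | l < h x]).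
Proof.
move=> mD mh; rewrite (_ : [set _ | _] = h @^-1` `]l, +oo[); last first.
  by apply/seteqP; split => x /=; rewrite in_itv/= andbT.
exact: mh.
Qed.

Section exponential_class.
Context {R : realType}.
Local Notation mu := (@lebesgue_measure R).
Local Notation w := (@w R).
Implicit Types (f g h a b : R -> R) (A : set R) (K l t : R).

Lemma J_indic A K : measurable A -> (mu A <= K%:E)%E ->
  ig (\1_A : R -> R) /\ J (\1_A : R -> R) <= K.
Proof.
move=> mA AK.
have iA : ig (\1_A : R -> R).
  apply/integrableP; split; first by apply/measurable_EFinP.
  apply: le_lt_trans (le_lt_trans AK (ltry K)).
  rewrite (_ : \int[mu]_x _ = \int[mu]_x (\1_A x)%:E)%E; last first.
    by apply: eq_integral => x _ /=; rewrite ger0_norm.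
  by rewrite integral_indic// setIT.
by split => //; rewrite -lee_fin EFin_J// integral_indic// setIT.
Qed.

(** Raising the truncation level from 16^n to 16^(n+1) adds at most 16^(n+1) K / 64^n = 16 K / 4^n
    to the integral, and these increments sum to less than 32 K. *)
Lemma ig_level_sets h K : measurable_fun setT h -> (forall x, 0 <= h x) ->
  (forall x, 1 <= `|x| -> h x = 0) ->
  (forall k, (mu [set x | (16 ^+ k < h x)%R] <= (K / 64 ^+ k)%:E)%E) -> ig h.
Proof.
move=> mh h0 hout hK; pose u n x := Order.min (h x) (16 ^+ n).
have g0 n : 0 < 16 ^+ n :> R by rewrite exprn_gt0.
have mu_ n : measurable_fun setT (u n) by exact: measurable_minr.
have u0 n x : 0 <= u n x by rewrite /u le_min h0 ltW.
have bu n : bdd_supp (u n).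
  split => //; first by exists (16 ^+ n) => x; rewrite ger0_norm// ge_min lexx orbT.
  by move=> x x1; rewrite /u hout// min_l// ltW.
have iu n : ig (u n) by exact: bdd_supp_ig.
have K0 : 0 <= K.
  have := hK 0%N; rewrite expr0 divr1 -lee_fin; exact: le_trans.
have mA n : measurable [set x | 16 ^+ n < h x].
  by rewrite -[X in measurable X]setTI; exact: measurable_superlevel.
have ndu x : nondecreasing_seq (u^~ x).
  move=> m n mn; rewrite /u le_min !ge_min lexx/=; apply/orP; right.
  by rewrite ler_weXn2l// ler1n.
have step n : J (u n.+1) <= J (u n) + 16 * K / 4 ^+ n.
  rewrite -lerBlDl -JB//.
  have [iA JA] := J_indic (mA n) (hK n).
  have le x : u n.+1 x - u n x <= 16 ^+ n.+1 * \1_[set x | 16 ^+ n < h x] x.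
    rewrite indicE /=; have [hx|hx] := ltP (16 ^+ n) (h x).
      rewrite mem_set// mulr1 lerBlDr (le_trans (_ : _ <= 16 ^+ n.+1)) ?lerDl//.
      by rewrite ge_min lexx orbT.
    rewrite memNset/= ?mulr0; last by apply/negP; rewrite -leNgt.
    by rewrite /u !min_l ?subrr// (le_trans hx)// ler_weXn2l// ?ler1n.
  apply: le_trans (J_le _ _ le) _; [exact: igB|exact: igZ|].
  rewrite JZ//; apply: le_trans (ler_wpM2l _ JA) _; first exact: ltW.
  rewrite exprS (_ : 64 = 16 * 4); last by rewrite -natrM.
  rewrite exprMn.
  have p : (4 : R) ^+ n != 0 by rewrite expf_neq0.
  have q := lt0r_neq0 (g0 n).
  by rewrite le_eqVlt; apply/orP; left; apply/eqP; field; rewrite p q.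
have [v iv cv] : exists2 v, ig v & {ae mu, forall x, u^~ x @ \oo --> v x}.
  apply: (@Beppo_Levi _ u (J (u 0%N) + 32 * K)) => // n.
  suff : J (u n) <= J (u 0%N) + 32 * K * (1 - (4 ^+ n)^-1).
    move/le_trans; apply; rewrite lerD2l ler_piMr ?mulr_ge0//.
  elim: n => [|n IH]; first by rewrite expr0 invr1 subrr mulr0 addr0.
  apply: le_trans (step n) _; rewrite exprS invfM.
  have : 0 <= K * (4 ^+ n)^-1 by rewrite mulr_ge0// invr_ge0 exprn_ge0.
  move: (4 ^+ n)^-1 IH => q IH Kq; nra.
apply: (ig_ae mh iv); apply: ae_sub cv _ => x cvx.
apply: (cvg_unique (@Rhausdorff R) cvx).
apply: cvg_near_cst.
near=> n; apply/eqP; rewrite /u min_l//.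
have : h x <= n%:R by near: n; exact: nbhs_infty_ger.
by move/le_trans; apply; rewrite -natrX ler_nat ltnW// ltn_expl.
Unshelve. all: end_near. Qed.

(** The set is w^2 < 64^-k, which lies within distance 64^-k of the two endpoints. *)
Lemma w_inv_level k :
  (mu [set x | (8 ^+ k < (w x)^-1)%R] <= (2 / 64 ^+ k)%:E)%E.
Proof.
pose d : R := (64 ^+ k)^-1.
have d0 : 0 < d by rewrite invr_gt0 exprn_gt0.
have d1 : d <= 1 by rewrite invf_le1 ?exprn_gt0// exprn_ege1// ler1n.
have meas : measurable [set x | 8 ^+ k < (w x)^-1].
  rewrite -[X in measurable X]setTI; apply: measurable_superlevel => //.
  exact: (measurableT_comp measurable_inv measurable_w).
have sub : [set x | 8 ^+ k < (w x)^-1] `<=` `]-1, -1 + d[ `|` `]1 - d, 1[.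
  move=> x /= wx.
  have wi0 : 0 < (w x)^-1 by apply: lt_trans wx; rewrite exprn_gt0.
  have w0 : 0 < w x by rewrite -invr_gt0.
  have x1 : `|x| < 1.
    by rewrite ltNge; apply/negP => x1; rewrite (w_out x1) ltxx in w0.
  have wd : w x ^+ 2 < d.
    rewrite /d (_ : 64 = 8 ^+ 2); last by rewrite -natrX.
    rewrite -exprM mulnC exprM -[ltLHS]invrK ltf_pV2 ?posrE ?invr_gt0 ?exprn_gt0//.
    by rewrite -exprVn ltrXn2r//= exprn_ge0.
  rewrite (w_sqr (ltW x1)) in wd.
  rewrite !in_itv/=.
  move: x1; rewrite ltr_norml => /andP[x1 x2].
  have [x0|x0] := leP 0 x; [right|left]; apply/andP; split => //; nra.
have m1 : mu `]-1, -1 + d[ = d%:E.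
  rewrite lebesgue_measure_itv/= lte_fin ltrDl d0 -EFinB; congr EFin; ring.
have m2 : mu `]1 - d, 1[ = d%:E.
  rewrite lebesgue_measure_itv/= lte_fin gtrBl d0 -EFinB; congr EFin; ring.
apply: (@le_trans _ _ (mu (`]-1, -1 + d[ `|` `]1 - d, 1[)%classic)).
  by apply: le_measure => //; rewrite inE//; exact: measurableU.
apply: le_trans (measureU2 _ _ _) _ => //.
rewrite (_ : 2 / 64 ^+ k = d + d); last by rewrite mulr_natl mulr2n.
rewrite EFinD; apply: leeD.
  by rewrite -m1.
by rewrite -m2.
Qed.

(** Since 16 = 2 * 8, a quotient above 16^k forces a > 2^k or 1 / w > 8^k, and both sets have
    measure of order 64^-k. *)
Lemma ig_div_w a K : measurable_fun setT a -> (forall x, 0 <= a x) ->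
  (forall k, (mu [set x | (2 ^+ k < a x)%R] <= (K / 64 ^+ k)%:E)%E) ->
  ig (fun x => a x / w x).
Proof.
move=> ma a0 aK.
have mwi : measurable_fun setT (fun x => (w x)^-1).
  exact: (measurableT_comp measurable_inv measurable_w).
have msup (b : R -> R) l : measurable_fun setT b -> measurable [set x | l < b x].
  by move=> mb; rewrite -[X in measurable X]setTI; exact: measurable_superlevel.
have maw : measurable_fun setT (fun x => a x / w x) by exact: measurable_funM.
apply: (ig_level_sets (K := K + 2)) => //.
- by move=> x; rewrite mulr_ge0// invr_ge0 w_ge0.
- by move=> x x1; rewrite (w_out x1) invr0 mulr0.
move=> k; rewrite mulrDl EFinD.
apply: (@le_trans _ _ (mu ([set x | (2 ^+ k < a x)%R] `|` [set x | (8 ^+ k < (w x)^-1)%R]))).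
  apply: le_measure; rewrite ?inE.
  - exact: msup.
  - by apply: measurableU; exact: msup.
  move=> x /=; apply: contraPP => /not_orP[/negP]; rewrite -leNgt => h1 /negP.
  rewrite -leNgt => h2; apply/negP; rewrite -leNgt.
  rewrite (_ : 16 = 2 * 8); last by rewrite -natrM.
  by rewrite exprMn ler_pM// invr_ge0 w_ge0.
apply: le_trans (measureU2 _ _ _) _; [exact: msup|exact: msup|].
by apply: leeD; [exact: aK|exact: w_inv_level].
Qed.

Lemma ig_w_inv : ig (fun x => (w x)^-1).
Proof.
have := @ig_div_w (fun=> 1) 0.
under [in X in _ -> _ -> _ -> X]eq_fun do rewrite mul1r.
apply => // k; rewrite mul0r.
rewrite (_ : [set _ | _] = set0) ?measure0//.
by rewrite -subset0 => x /=; rewrite ltNge exprn_ege1// ler1n.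
Qed.

(** With j = k / 2 rounded down, 2^k >= (j + 1)^2 and k + 1 <= 2 (j + 1), so it is enough that j + 1
    exceeds twice a bound of |D|. *)
Lemma linear_lt_exp2 (D : R) : exists k0, forall k, (k0 <= k)%N ->
  D * k.+1%:R < 2 ^+ k.
Proof.
pose N := Num.trunc `|D|; exists (4 * N.+1)%N => k Nk.
apply: (@le_lt_trans _ _ (N.+1%:R * k.+1%:R)).
  rewrite ler_wpM2r// (le_trans (ler_norm D))// ltW//.
  by have /truncn_itv/andP[] := normr_ge0 D.
rewrite -natrM -natrX ltr_nat.
have hk : (k.+1 <= 2 * (k./2).+1)%N by lia.
have h2 : ((k./2).+1 * (k./2).+1 <= 2 ^ k)%N.
  apply: (@leq_trans (2 ^ (k./2 + k./2))%N).
    by rewrite expnD leq_mul// ltn_expl.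
  by rewrite leq_pexp2l//; lia.
apply: leq_trans h2.
have hN : (2 * N.+1 < (k./2).+1)%N by lia.
nia.
Qed.

Lemma measurable_normc (g : R -> R[i]) (A : set R) : measurable A ->
  measurable_fun A (fun x => complex.Re (g x)) ->
  measurable_fun A (fun x => complex.Im (g x)) ->
  measurable_fun A (fun x => Normc.normc (g x)).
Proof.
move=> mA mre mim.
rewrite (_ : (fun x => _) =
    fun x => Num.sqrt (complex.Re (g x) ^+ 2 + complex.Im (g x) ^+ 2)); last first.
  by apply/funext => x; case: (g x).
apply: (@measurableT_comp _ _ _ _ _ _ (@Num.sqrt R)).
  by apply: continuous_measurable_fun; exact: sqrt_continuous.
by apply: measurable_funD; exact: measurable_funX.
Qed.

(** Otherwise the rearrangement is at least l on all of ]0, t[, and the quotient in the norm at t is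
    at least l / ln (2 e / t), which exceeds C. *)
Lemma distribution_le (g : R -> R[i]) (C l t : R) : L0 g -> (Lexp_norm g <= C%:E)%E ->
  0 < t < 2 -> 0 <= l -> C * ln (2 * expR 1 / t) < l ->
  (distribution_function g l <= t%:E)%E.
Proof.
move=> [mre mim] gC /andP[t0 t2] l0 Cl; rewrite leNgt; apply/negP => tl.
have mI : measurable (@I11 R) by exact: measurable_itv.
have mg := measurable_normc mI mre mim.
have msup k : measurable (I11 `&` [set x | k < Normc.normc (g x)]).
  exact: measurable_superlevel.
have fl s : `]0%R, t[%classic s -> (l%:E <= rearrangement g s)%E.
  rewrite /= in_itv/= => /andP[s0 st].
  apply: le_ereal_inf_tmp => _ [k [k0 ks] <-]; rewrite lee_fin leNgt; apply/negP => kl.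
  have : (t%:E < s%:E)%E.
    apply: lt_le_trans tl _; apply: le_trans ks.
    apply: le_measure => [||x [x1 lx]]; [by rewrite inE; exact: msup..|].
    by split => //=; exact: lt_trans kl lx.
  by rewrite lte_fin ltNge ltW.
have f0 s : (0 <= rearrangement g s)%E.
  by apply: le_ereal_inf_tmp => _ [k [k0 ks] <-]; rewrite lee_fin.
have L0 : 0 < ln (2 * expR 1 / t).
  apply: ln_gt0; rewrite ltr_pdivlMr// mul1r (lt_le_trans t2)//.
  by rewrite ler_peMr// ltW// expR_gt1.
have mt : mu `]0, t[ = t%:E by rewrite lebesgue_measure_itv/= lte_fin t0 sube0.
have lI := integral_ge_cst (mu := mu) (measurable_itv `]0, t[) mt l0 f0 fl.
have : (\int[mu]_(s in `]0%R, t[) rearrangement g s * ((t * ln (2 * expR 1 / t))^-1)%:E <= C%:E)%E.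
  apply: le_trans gC; apply: ereal_sup_ubound; exists t => //=.
  by rewrite t0.
apply/negP; rewrite -ltNge.
apply: (@lt_le_trans _ _ ((l * t)%:E * ((t * ln (2 * expR 1 / t))^-1)%:E)%E).
  rewrite -EFinM lte_fin -ltr_pdivrMr ?invr_gt0 ?mulr_gt0// invrK mulrCA mulrC.
  by rewrite ltr_pM2r.
by rewrite lee_wpmul2r// lee_fin invr_ge0 mulr_ge0 ?ltW.
Qed.

Lemma Lexp_level (g : R -> R[i]) : Lexp g -> exists K, forall k,
  (distribution_function g (2 ^+ k) <= (K / 64 ^+ k)%:E)%E.
Proof.
move=> [g0 gfin].
have [C C0 gC] : exists2 C, 0 <= C & (Lexp_norm g <= C%:E)%E.
  case: (Lexp_norm g) gfin => [r _|//|_]; last by exists 0; rewrite ?leNye.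
  by exists `|r| => //; rewrite lee_fin ler_norm.
have [k0 hk0] := linear_lt_exp2 (C * (2 * expR 1 + 64)).
(* For k < k0 the total measure 2 is bound enough; for k >= k0 take t = 64^-k, where the logarithm
   grows linearly in k and 2^k wins. *)
exists (2 * 64 ^+ k0) => k.
have [k0k|kk0] := leqP k0 k.
  apply: (@le_trans _ _ ((64 ^+ k)^-1)%:E).
    apply: (distribution_le g0 gC); last 2 first.
    - by rewrite exprn_ge0.
    - rewrite invrK; apply: le_lt_trans (hk0 k k0k).
      rewrite -[leRHS]mulrA ler_wpM2l// lnM ?posrE ?mulr_gt0 ?expR_gt0 ?exprn_gt0//.
      (* Used with p = ln (2 e), a = 2 e and q = ln 64, each logarithm lying below its argument. *)
      have aux (p q a : R) : 0 < a -> p < a -> q < 64 -> p + q *+ k <= (a + 64) * k.+1%:R.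
        by rewrite -mulr_natr -natr1; have : 0 <= k%:R :> R by []; nra.
      have e0 : 0 < 2 * expR (1 : R) by rewrite mulr_gt0// expR_gt0.
      by rewrite lnXn//; apply: aux => //; exact: ln_sublinear.
    - rewrite invr_gt0 exprn_gt0//=; apply: (@le_lt_trans _ _ 1); last by rewrite ltr1n.
      by rewrite invf_le1 ?exprn_gt0// exprn_ege1// ler1n.
  rewrite lee_fin ler_peMl ?invr_ge0 ?exprn_ge0//.
  by rewrite mulr_ege1 ?exprn_ege1 ?ler1n.
apply: (@le_trans _ _ (mu I11)).
  have mI : measurable (@I11 R) by exact: measurable_itv.
  apply: le_measure => [||x []//]; rewrite inE//.
  by case: g0 => mre mim; apply: measurable_superlevel => //; exact: measurable_normc.
rewrite (_ : mu I11 = 2%:E); last first.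
  by rewrite /I11 lebesgue_measure_itv/= lte_fin gtrN ?ltr01// -EFinB; congr EFin; lra.
rewrite lee_fin -mulrA ler_peMr// ler_pdivlMr ?exprn_gt0// mul1r.
by rewrite ler_weXn2l// ?ler1n// ltnW.
Qed.

Lemma Lexp_ig_div_w (g : R -> R[i]) (G : R -> R) : Lexp g -> measurable_fun setT G ->
  {ae mu, forall x, `|x| < 1 -> `|G x| <= Normc.normc (g x)} -> ig (fun x => G x / w x).
Proof.
move=> Lg mG Gg.
have [K gK] := Lexp_level Lg.
case: (Lg) => -[mre mim] _.
have mI : measurable (@I11 R) by exact: measurable_itv.
pose a := (fun x => Normc.normc (g x)) \_ I11.
have ma : measurable_fun setT a.
  by apply/(measurable_restrictT _ mI); exact: measurable_normc.
have n0 x : 0 <= Normc.normc (g x) by case: (g x) => u v; exact: sqrtr_ge0.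
have a0 x : 0 <= a x by rewrite /a patchE; case: ifP.
have ia : ig (fun x => a x / w x).
  apply: (@ig_div_w a K) => // k.
  rewrite (_ : [set _ | _] = I11 `&` [set x | 2 ^+ k < Normc.normc (g x)]); first exact: gK.
  apply/seteqP; split => x; rewrite /a /= patchE.
    by case: ifPn => [|_]; [rewrite inE|rewrite ltNge exprn_ge0].
  by move=> [x1 lx]; rewrite mem_set.
have w0i x : 0 <= (w x)^-1 by rewrite invr_ge0 w_ge0.
have mwi : measurable_fun setT (fun x => (w x)^-1).
  exact: (measurableT_comp measurable_inv measurable_w).
(* |G| lies below [a] only almost everywhere; the minimum does so at every point, as [ig_le]
   demands, and equals |G| almost everywhere on the interval. *)
have iGa : ig (fun x => Order.min `|G x| (a x) / w x).
  apply: ig_le ia _.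
    apply: measurable_funM => //; apply: measurable_minr => //.
    exact: measurableT_comp.
  move=> x; rewrite ger0_norm; last by rewrite mulr_ge0// le_min normr_ge0 a0.
  by rewrite ler_wpM2r// ge_min lexx orbT.
have iG : ig (fun x => `|G x| / w x).
  apply: (ig_ae _ iGa).
    by apply: measurable_funM => //; exact: measurableT_comp.
  apply: ae_sub Gg _ => x Ggx; have [x1|x1] := ltP `|x| 1; last first.
    by rewrite (w_out x1) invr0 !mulr0.
  rewrite min_l// /a patchE mem_set ?Ggx//=.
  by rewrite /I11/= in_itv/= -ltr_norml.
apply: ig_le iG _; first exact: measurable_funM.
by move=> x; rewrite normrM (ger0_norm (w0i x)).
Qed.

End exponential_class.

(** * Complex functions and the operators of the statement *)

Section airfoil_equation.
Context {R : realType}.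
Local Notation mu := (@lebesgue_measure R).
Local Notation w := (@w R).
Local Notation I11 := (@I11 R).
Implicit Types (f g F : R -> R[i]) (h G H : R -> R) (e t x : R).

Lemma I11E x : I11 x <-> `|x| < 1.
Proof. by rewrite /I11/= in_itv/= -ltr_norml. Qed.

Lemma complex_cvg (a b : R -> R) (l m : R) :
  a e @[e --> 0^'+] --> l -> b e @[e --> 0^'+] --> m ->
  ((a e +i* b e)%C : R[i]^o) @[e --> 0^'+] --> ((l +i* m)%C : R[i]^o).
Proof.
move=> al bm; apply/cvgrPdist_lt => -[p q]; rewrite ltcE/= => /andP[/eqP -> p0].
have p2 : 0 < p / 2 by rewrite divr_gt0.
near=> e.
have la : `|l - a e| < p / 2 by near: e; move/cvgrPdist_lt : al; apply.
have mb : `|m - b e| < p / 2 by near: e; move/cvgrPdist_lt : bm; apply.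
rewrite -[ltLHS]/((Normc.normc ((l - a e) +i* (m - b e))%C)%:C)%C ltcR /=.
apply: (@le_lt_trans _ _ (`|l - a e| + `|m - b e|)); last by rewrite [ltRHS]splitr ltrD.
rewrite -[leRHS]ger0_norm ?addr_ge0// -sqrtr_sqr ler_wsqrtr// [leRHS]sqrrD.
rewrite -(real_normK (num_real (l - a e))) -(real_normK (num_real (m - b e))).
by rewrite addrAC lerDl mulrn_wge0// mulr_ge0.
Unshelve. all: end_near. Qed.

Lemma Re_div_real (z : R[i]) x : complex.Re (z / x%:C%C) = complex.Re z / x.
Proof.
by case: z => a b; rewrite -fmorphV/= mulr0 subr0.
Qed.

Lemma Im_div_real (z : R[i]) x : complex.Im (z / x%:C%C) = complex.Im z / x.
Proof.
by case: z => a b; rewrite -fmorphV/= mulr0 add0r.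
Qed.

Lemma truncated_part h t e : `|t| < 1 -> 0 < e -> ig (h \_ I11) ->
  pi^-1 * (\int[mu]_(x in `]-1, t - e[) (h x / (x - t)) +
           \int[mu]_(x in `]t + e, 1[) (h x / (x - t))) =
  J (fun x => (h \_ I11) x * trunc_kernel e (x - t)).
Proof.
move=> t1 e0 ih; pose k x := (h \_ I11) x * trunc_kernel e (x - t).
have ik : ig k.
  apply: (ig_bounded_kernel (C := e^-1)) => //; first exact: measurable_trunc_kernel.
  by move=> u; exact: trunc_kernel_bound.
have piR : (pi : R) != 0 by exact: pi_neq0.
have part (A : set R) : measurable A -> (forall x, A x -> `|x| < 1 /\ e < `|x - t|) ->
  \int[mu]_(x in A) (h x / (x - t)) = pi * J (k \_ A).
  move=> mA sA; rewrite Rintegral_mkcond -JZ; last exact: ig_patch.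
  rewrite -JE; congr J; apply/funext => x; rewrite !patchE.
  case: ifPn => [|_]; last by rewrite mulr0.
  rewrite inE => /sA [x1 xt]; rewrite /k patchE mem_set; last exact/I11E.
  by rewrite /trunc_kernel xt mulrCA mulVKf.
move: t1; rewrite ltr_norml => /andP[t1 t2].
rewrite !part//; last 2 first.
- move=> x /=; rewrite in_itv/= => /andP[xt x1].
  by split; [rewrite ltr_norml; apply/andP; split; lra|rewrite ltr_normr; apply/orP; left; lra].
- move=> x /=; rewrite in_itv/= => /andP[xt x1].
  by split; [rewrite ltr_norml; apply/andP; split; lra|rewrite ltr_normr; apply/orP; right; lra].
rewrite -mulrDr mulKf// -JD; [|exact: ig_patch..].
(* The default value [point] of a restriction is 0 here. *)
congr J; apply/funext => x; rewrite !(patchE k) !mem_setE !in_itv/= [point]/(0 : R).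
have [x1|x1] := ltP `|x| 1; last first.
  rewrite /k patchE memNset; last by move/I11E; rewrite ltNge x1.
  by rewrite mul0r !if_same addr0.
move: (x1); rewrite ltr_norml => /andP[x2 x3]; rewrite x2 x3 andbT/= /k /trunc_kernel.
rewrite ltr_normr.
have -> : (t + e < x) = (e < x - t) by apply/idP/idP => ?; lra.
have -> : (x < t - e) = (e < - (x - t)) by apply/idP/idP => ?; lra.
by case: ltP => h1; case: ltP => h2; rewrite /= ?mulr0 ?addr0 ?add0r//; exfalso; lra.
Qed.

(** [hilbert] is a [lim], so its value is known once both parts of the truncated integrals are shown
    to converge. *)
Lemma hilbert_parts F t (a b : R) : `|t| < 1 ->
  ig ((fun x => complex.Re (F x)) \_ I11) -> ig ((fun x => complex.Im (F x)) \_ I11) ->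
  J (fun x => ((fun x => complex.Re (F x)) \_ I11) x * trunc_kernel e (x - t))
    @[e --> 0^'+] --> a ->
  J (fun x => ((fun x => complex.Im (F x)) \_ I11) x * trunc_kernel e (x - t))
    @[e --> 0^'+] --> b ->
  hilbert F t = (a +i* b)%C.
Proof.
move=> t1 ire iim ca cb; apply: (@cvg_lim R[i]^o); first exact: norm_hausdorff.
have := complex_cvg ca cb; apply: cvg_trans; apply: near_eq_cvg; near=> e.
have e0 : 0 < e by [].
rewrite -!truncated_part// /truncated_hilbert /Cintegral.
have ReE : (fun x => complex.Re (F x / (x - t)%:C%C)) = fun x => complex.Re (F x) / (x - t).
  by apply/funext => x; exact: Re_div_real.
have ImE : (fun x => complex.Im (F x / (x - t)%:C%C)) = fun x => complex.Im (F x) / (x - t).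
  by apply/funext => x; exact: Im_div_real.
by rewrite ReE ImE; apply/eqP; rewrite eq_complex/= !mul0r subr0 addr0 !eqxx.
Unshelve. all: end_near. Qed.

Lemma Re_le_normc (z : R[i]) : `|complex.Re z| <= Normc.normc z.
Proof.
by case: z => a b /=; rewrite -sqrtr_sqr ler_wsqrtr// lerDl sqr_ge0.
Qed.

Lemma Im_le_normc (z : R[i]) : `|complex.Im z| <= Normc.normc z.
Proof.
by case: z => a b /=; rewrite -sqrtr_sqr ler_wsqrtr// lerDr sqr_ge0.
Qed.

Lemma bdd_representative h (M : R) : measurable_fun I11 h ->
  {ae mu, forall x, `|x| < 1 -> `|h x| <= M} ->
  exists2 k, bdd_supp k & {ae mu, forall x, `|x| < 1 -> h x = k x}.
Proof.
move=> mh hM; have mI : measurable I11 by exact: measurable_itv.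
pose k x := Order.max (- `|M|) (Order.min (h x) `|M|).
exists (k \_ I11); first split.
- apply/(measurable_restrictT _ mI); apply: measurable_maxr => //.
  exact: measurable_minr.
- exists `|M| => x; rewrite patchE; case: ifP => _; last by rewrite normr0.
  by rewrite ler_norml le_max lexx/= ge_max ge_min lexx orbT andbT ge0_cp.
- by move=> x x1; rewrite patchE memNset//; move/I11E; rewrite ltNge x1.
apply: ae_sub hM _ => x hM x1; rewrite patchE mem_set; last exact/I11E.
have := le_trans (hM x1) (ler_norm M); rewrite ler_norml /k => /andP[h1 h2].
by rewrite min_l// max_r.
Qed.

Lemma Linfty_bound f : Linfty f -> exists M,
  {ae mu, forall x, `|x| < 1 -> Normc.normc (f x) <= M}.
Proof.
move=> [_]; rewrite unlock.
(* The norm is defined by the essential supremum when the whole space has positive measure. *)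
have -> : (0 < mu [set: R])%E.
  apply: (@lt_le_trans _ _ (mu I11)).
    by rewrite /I11 lebesgue_measure_itv/= lte_fin gtrN ?ltr01// -EFinB lte_fin; lra.
  by apply: le_measure; rewrite ?inE//; exact: measurable_itv.
set F := abse \o _ => fin.
have [M FM] : exists M, (ess_sup mu F <= M%:E)%E.
  case: (ess_sup mu F) fin => [r _|//|_]; last by exists 0; rewrite leNye.
  by exists r.
exists M; have FM' : {ae mu, forall x, (F x <= M%:E)%E} by apply/ess_supP.
apply: ae_sub FM' _ => x + x1.
rewrite /F/= patchE mem_set; last exact/I11E.
by rewrite lee_fin; apply: le_trans; exact: ler_norm.
Qed.

Lemma hilbert_eq F h k G H : measurable_fun I11 (fun x => complex.Re (F x)) ->
  measurable_fun I11 (fun x => complex.Im (F x)) -> ig h -> ig k ->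
  (forall x, 1 <= `|x| -> h x = 0) -> (forall x, 1 <= `|x| -> k x = 0) ->
  {ae mu, forall x, `|x| < 1 -> F x = (h x +i* k x)%C} ->
  {ae mu, forall t, `|t| < 1 -> J (fun x => h x * trunc_kernel e (x - t)) @[e --> 0^'+] --> G t} ->
  {ae mu, forall t, `|t| < 1 -> J (fun x => k x * trunc_kernel e (x - t)) @[e --> 0^'+] --> H t} ->
  {ae mu, forall t, `|t| < 1 -> hilbert F t = (G t +i* H t)%C}.
Proof.
move=> mre mim ih ik h0 k0 Fhk hG kH.
have mI : measurable I11 by exact: measurable_itv.
have aere : {ae mu, forall x, h x = ((fun x => complex.Re (F x)) \_ I11) x}.
  apply: ae_sub Fhk _ => x Fx; rewrite patchE; case: ifPn => [|].
    by rewrite inE => /I11E/Fx ->.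
  move=> xI; apply: h0; rewrite leNgt; apply: contra xI => x1.
  by rewrite inE; exact/I11E.
have aeim : {ae mu, forall x, k x = ((fun x => complex.Im (F x)) \_ I11) x}.
  apply: ae_sub Fhk _ => x Fx; rewrite patchE; case: ifPn => [|].
    by rewrite inE => /I11E/Fx ->.
  move=> xI; apply: k0; rewrite leNgt; apply: contra xI => x1.
  by rewrite inE; exact/I11E.
have mre' : measurable_fun setT ((fun x => complex.Re (F x)) \_ I11).
  exact/(measurable_restrictT _ mI).
have mim' : measurable_fun setT ((fun x => complex.Im (F x)) \_ I11).
  exact/(measurable_restrictT _ mI).
have mk e t : measurable_fun setT (fun x => trunc_kernel e (x - t) : R).
  by apply: (measurableT_comp (measurable_trunc_kernel e)); exact: measurable_funB.
apply: ae_sub (ae_and hG kH) _ => t [ct dt] t1; apply: hilbert_parts => //.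
- exact: ig_ae ih aere.
- exact: ig_ae ik aeim.
- move: (ct t1); apply: cvg_trans; apply: near_eq_cvg; near=> e; apply/esym.
  apply: J_ae; [by apply: measurable_funM => //; exact: ig_measurable..|].
  by apply: ae_sub aere _ => x ->.
- move: (dt t1); apply: cvg_trans; apply: near_eq_cvg; near=> e; apply/esym.
  apply: J_ae; [by apply: measurable_funM => //; exact: ig_measurable..|].
  by apply: ae_sub aeim _ => x ->.
Unshelve. all: end_near. Qed.

Lemma ae_eq11P f g : ae_eq11 f g <-> {ae mu, forall x, `|x| < 1 -> f x = g x}.
Proof.
by split => H; apply: ae_sub H _ => x fg /I11E; exact: fg.
Qed.

Lemma check_hilbert_inverse f g : Lexp g -> Linfty f -> ae_eq11 (hilbert f) g ->
  ae_eq11 f (check_hilbert g).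
Proof.
move=> Lg Lf /ae_eq11P fg; case: (Lf) => -[mre mim] _; case: (Lg) => -[mgre mgim] _.
have [M fM] := Linfty_bound Lf.
(* The real results concern functions bounded at every point, so both parts of [f] are replaced by
   such representatives. *)
have [h bh fh] : exists2 h, bdd_supp h &
    {ae mu, forall x, `|x| < 1 -> complex.Re (f x) = h x}.
  apply: (bdd_representative (M := M)) => //; apply: ae_sub fM _ => x fx x1.
  exact: le_trans (Re_le_normc _) (fx x1).
have [k bk fk] : exists2 k, bdd_supp k &
    {ae mu, forall x, `|x| < 1 -> complex.Im (f x) = k x}.
  apply: (bdd_representative (M := M)) => //; apply: ae_sub fM _ => x fx x1.
  exact: le_trans (Im_le_normc _) (fx x1).
have fhk : {ae mu, forall x, `|x| < 1 -> f x = (h x +i* k x)%C}.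
  apply: ae_sub (ae_and fh fk) _ => x [fx gx] x1.
  by rewrite -fx// -gx//; case: (f x).
have [G tG] := exists_trace bh; have [H tH] := exists_trace bk.
have hilb : {ae mu, forall t, `|t| < 1 -> hilbert f t = (G t +i* H t)%C}.
  apply: (hilbert_eq (h := h) (k := k)) => //.
  - exact: bdd_supp_ig.
  - exact: bdd_supp_ig.
  - by case: bh.
  - by case: bk.
  - by apply: ae_sub (trace_trunc_cvg bh tG) _ => t c _.
  - by apply: ae_sub (trace_trunc_cvg bk tH) _ => t c _.
have gGH : {ae mu, forall x, `|x| < 1 -> g x = (G x +i* H x)%C}.
  by apply: ae_sub (ae_and fg hilb) _ => x [fx hx] x1; rewrite -fx// hx.
have iG : ig (fun x => G x / w x).
  apply: (Lexp_ig_div_w Lg); first by case: tG => -[].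
  by apply: ae_sub gGH _ => x gx x1; have := Re_le_normc (g x); rewrite gx.
have iH : ig (fun x => H x / w x).
  apply: (Lexp_ig_div_w Lg); first by case: tH => -[].
  by apply: ae_sub gGH _ => x gx x1; have := Im_le_normc (g x); rewrite gx.
have mwi : measurable_fun I11 (fun x => (w x)^-1).
  apply: measurable_funTS; exact: (measurableT_comp measurable_inv measurable_w).
have w_inv_out x : 1 <= `|x| -> (w x)^-1 = 0 by move=> x1; rewrite w_out// invr0.
have hgw : {ae mu, forall t, `|t| < 1 ->
    hilbert (fun x => g x / (w x)%:C%C) t = (- (h t / w t) +i* - (k t / w t))%C}.
  apply: (hilbert_eq (h := fun x => G x / w x) (k := fun x => H x / w x)) => //.
  - under eq_fun do rewrite Re_div_real; exact: measurable_funM.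
  - under eq_fun do rewrite Im_div_real; exact: measurable_funM.
  - by move=> x x1; rewrite w_inv_out// mulr0.
  - by move=> x x1; rewrite w_inv_out// mulr0.
  - apply: ae_sub gGH _ => x gx x1; rewrite gx//.
    by apply/eqP; rewrite eq_complex Re_div_real Im_div_real/= !eqxx.
  - exact: (div_w_trunc_cvg bh tG ig_w_inv iG).
  - exact: (div_w_trunc_cvg bk tH ig_w_inv iH).
apply/ae_eq11P; apply: ae_sub (ae_and fhk hgw) _ => x [fx gx] x1.
have wn := lt0r_neq0 (w_gt0 x1).
rewrite /check_hilbert gx// fx//; apply/eqP; rewrite eq_complex/=.
by apply/andP; split; apply/eqP; field.
Qed.

End airfoil_equation.
Theorem theorem5p6 (R : realType) (g : R -> R[i]) (hg : hilbert_range g) :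
  exists f : R -> R[i],
    [/\ Linfty f,
        ae_eq11 (hilbert f) g,
        (forall f' : R -> R[i],
           Linfty f' -> ae_eq11 (hilbert f') g -> ae_eq11 f' f) &
        ae_eq11 f (check_hilbert g)].
Proof.
case: hg => Lg [f Lf fg]; exists f.
have /ae_eq11P fT := check_hilbert_inverse Lg Lf fg.
split => //; last exact/ae_eq11P.
move=> f' Lf' f'g; have /ae_eq11P f'T := check_hilbert_inverse Lg Lf' f'g.
by apply/ae_eq11P; apply: ae_sub (ae_and fT f'T) _ => x [fx f'x] x1; rewrite fx// f'x.
Qed.
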